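(* There exists a continuous deformation (a continuous $1$-parameter family of surfaces) consisting exactly of the zero mean curvature surfaces that are also affine minimal in isotropic $3$-space $\mathbb{I}^3$, up to isometries and homotheties of $\mathbb{I}^3$. That is, there is a family of surfaces depending continuously on one real parameter such that every member of the family is a zero mean curvature surface that is also affine minimal, and every zero mean curvature immersion that is also affine minimal is, up to isometries and homotheties of $\mathbb{I}^3$, a piece of a member of the family.
   Context: Isotropic space: $\mathbb{R}^{3,1}$ is Minkowski $4$-space with bilinear form $\langle\cdot,\cdot\rangle$ of signature $(-+++)$, $\mathcal{L}=\{Y:\langle Y,Y\rangle=0\}$, $\mathfrak{p}=(1,0,0,1)^t\in\mathcal{L}$, and $\mathbb{I}^3=\{Y\in\mathbb{R}^{3,1}:\langle Y,\mathfrak{p}\rangle=0\}=\{(\mathbf l,\mathbf x,\mathbf y,\mathbf l)^t\}$, with degenerate induced metric $d\mathbf x^2+d\mathbf y^2$; it is identified with coordinate space $\{(\mathbf l,\mathbf x,\mathbf y)\}\cong\mathbb{R}^3$. Isometries of $\mathbb{I}^3$ are compositions of translations of $\mathbb{I}^3$ and the restrictions to $\mathbb{I}^3$ of $A\in\mathrm{SO}(3,1)$ with $A\mathfrak p=\mathfrak p$; homotheties are the maps $Y\mapsto\lambda Y$, $\lambda\in\mathbb{R}\setminus\{0\}$. Surfaces: $\Sigma$ is a simply-connected domain and $X:\Sigma\to\mathbb{I}^3$ is a spacelike immersion (the induced metric is Riemannian), with conformal coordinates $z=u+iv$ and $ds^2=e^{2\omega}(du^2+dv^2)$. The lightlike Gauss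 map $n:\Sigma\to\mathcal L$ is the unique map with $\langle dX,n\rangle=0$, $\langle n,\mathfrak p\rangle=1$. Put $L=\langle X_{uu},n\rangle$, $M=\langle X_{uv},n\rangle$, $N=\langle X_{vv},n\rangle$. The mean curvature is $H=\tfrac12e^{-2\omega}(L+N)$ and the Hopf differential is $Q\,dz^2=\tfrac14(L-N-2iM)\,dz^2$; zero mean curvature means $H\equiv0$. Affine minimality: view $X$ as an affine surface in $\mathbb{R}^3$ and put $\tilde L=\det(X_u,X_v,X_{uu})$, $\tilde M=\det(X_u,X_v,X_{uv})$, $\tilde N=\det(X_u,X_v,X_{vv})$. When $X$ is non-degenerate ($\tilde L\tilde N-\tilde M^2\ne0$), the Berwald–Blaschke metric is $d\tilde s^2=|\tilde L\tilde N-\tilde M^2|^{-1/4}(\tilde L\,du^2+2\tilde M\,du\,dv+\tilde N\,dv^2)$. For a zero mean curvature surface in conformal asymptotic coordinates normalized so that $Q=-\tfrac i2$, this is $d\tilde s^2=2e^{\omega}\,du\,dv$, and the affine normal is $\tilde n=e^{-\omega}X_{uv}$. The affine shape operator $\tilde S$ is defined by $d\tilde n=-dX\circ\tilde S$, the affine mean curvature is $\tilde H=\tfrac12\mathrm{tr}\,\tilde S$, and $X$ is affine minimal if it is non-degenerate with $\tilde H\equiv0$; planes are also counted as affine minimal. Continuity: a family $(X_t)_{t\in I}$, $I\subset\mathbb{R}$ an interval, of surfaces parametrized over a common domain of $\mathbb{C}$ is a continuous deformation if, for each $t_0\in I$, $X_t\to X_{t_0}$ as $t\to t_0$ uniformly,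 component-wise, on compact subdomains. Members of the family may fail to be immersed at isolated points of the domain; the conditions on them are imposed where they are immersed. ''A piece of'' means: after reparametrization, a restriction of. *)

(* Defs.v *)
(* Stdlib reals with Coquelicot. *)
From Stdlib Require Import Reals List.
From Coquelicot Require Import Coquelicot.
Open Scope R_scope.

(** * Minkowski 4-space and isotropic 3-space *)

Definition R31 : Type := (R * R * R * R)%type.

Definition mink (a b : R31) : R :=
  let '(a0, a1, a2, a3) := a in
  let '(b0, b1, b2, b3) := b in
  - (a0 * b0) + a1 * b1 + a2 * b2 + a3 * b3.

Definition lightlike (a : R31) : Prop := mink a a = 0.

Definition pvec : R31 := (1, 0, 0, 1).

(* I3 is the hyperplane <Y, pvec> = 0, given by its coordinates (l, x, y);
   [emb] is its inclusion in Minkowski space. *)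
Definition I3 : Type := (R * R * R)%type.

Definition cl (Y : I3) : R := fst (fst Y).
Definition cx (Y : I3) : R := snd (fst Y).
Definition cy (Y : I3) : R := snd Y.

Definition emb (Y : I3) : R31 := (cl Y, cx Y, cy Y, cl Y).

Definition det3 (a b c : R * R * R) : R :=
  let '(a1, a2, a3) := a in
  let '(b1, b2, b3) := b in
  let '(c1, c2, c3) := c in
  a1 * (b2 * c3 - b3 * c2) - b1 * (a2 * c3 - a3 * c2)
  + c1 * (a2 * b3 - a3 * b2).

Definition det4 (a b c d : R31) : R :=
  let '(a0, a1, a2, a3) := a in
  let '(b0, b1, b2, b3) := b in
  let '(c0, c1, c2, c3) := c in
  let '(d0, d1, d2, d3) := d in
  a0 * det3 (b1, b2, b3) (c1, c2, c3) (d1, d2, d3)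
  - b0 * det3 (a1, a2, a3) (c1, c2, c3) (d1, d2, d3)
  + c0 * det3 (a1, a2, a3) (b1, b2, b3) (d1, d2, d3)
  - d0 * det3 (a1, a2, a3) (b1, b2, b3) (c1, c2, c3).

Definition SO31 (A : R31 -> R31) : Prop :=
  (forall Y Z : R31, A (plus Y Z) = plus (A Y) (A Z)) /\
  (forall (c : R) (Y : R31), A (scal c Y) = scal c (A Y)) /\
  (forall Y Z : R31, mink (A Y) (A Z) = mink Y Z) /\
  det4 (A (1, 0, 0, 0)) (A (0, 1, 0, 0)) (A (0, 0, 1, 0)) (A (0, 0, 0, 1)) = 1.

(* Compositions of isometries and homotheties of I3. *)
Inductive similarity : (I3 -> I3) -> Prop :=
| sim_translation (T : I3) : similarity (fun Y => plus Y T)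
| sim_linear (A : R31 -> R31) (g : I3 -> I3) :
    SO31 A -> A pvec = pvec -> (forall Y, emb (g Y) = A (emb Y)) ->
    similarity g
| sim_homothety (c : R) : c <> 0 -> similarity (fun Y => scal c Y)
| sim_comp (f g : I3 -> I3) :
    similarity f -> similarity g -> similarity (fun Y => f (g Y)).

(** * Topology of the parameter plane *)

(* A continuous map on [0, 1] (or on the unit square) extends continuously by
   composing with the retraction of R onto [0, 1], so paths and homotopies are
   taken to be continuous everywhere. *)
Definition path_in (D : C -> Prop) (gamma : R -> C) : Prop :=
  (forall t, continuous gamma t) /\ (forall t, 0 <= t <= 1 -> D (gamma t)).

Definition plane_domain (D : C -> Prop) : Prop :=
  open D /\ (exists p, D p) /\
  (forall p q, D p -> D q ->
     exists gamma, path_in D gamma /\ gamma 0 = p /\ gamma 1 = q).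

Definition simply_connected_domain (D : C -> Prop) : Prop :=
  plane_domain D /\
  forall gamma, path_in D gamma -> gamma 0 = gamma 1 ->
    exists h : R * R -> C,
      (forall st, continuous h st) /\
      (forall s t, 0 <= s <= 1 -> 0 <= t <= 1 -> D (h (s, t))) /\
      (forall t, 0 <= t <= 1 -> h (0, t) = gamma t) /\
      (forall t, 0 <= t <= 1 -> h (1, t) = gamma 0) /\
      (forall s, 0 <= s <= 1 -> h (s, 0) = gamma 0 /\ h (s, 1) = gamma 0).

Definition compact_set (K : C -> Prop) : Prop :=
  forall (J : Type) (U : J -> C -> Prop),
    (forall j, open (U j)) -> (forall p, K p -> exists j, U j p) ->
    exists s : list J, forall p, K p -> exists j, In j s /\ U j p.

(** * Differential calculus in the parameters z = u + iv *)

Definition du (f : C -> R) (p : C) : R := Derive (fun u => f (u, snd p)) (fst p).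
Definition dv (f : C -> R) (p : C) : R := Derive (fun v => f (fst p, v)) (snd p).

Fixpoint Ck (k : nat) (D : C -> Prop) (f : C -> R) : Prop :=
  (forall p, D p -> continuous f p) /\
  match k with
  | O => True
  | S k' =>
      (forall p, D p -> ex_derive (fun u => f (u, snd p)) (fst p) /\
                        ex_derive (fun v => f (fst p, v)) (snd p)) /\
      Ck k' D (du f) /\ Ck k' D (dv f)
  end.

Definition smooth (D : C -> Prop) (f : C -> R) : Prop := forall k, Ck k D f.

Definition smooth_surface (D : C -> Prop) (X : C -> I3) : Prop :=
  smooth D (fun p => cl (X p)) /\ smooth D (fun p => cx (X p)) /\
  smooth D (fun p => cy (X p)).

Definition Xu (X : C -> I3) (p : C) : I3 :=
  (du (fun q => cl (X q)) p, du (fun q => cx (X q)) p, du (fun q => cy (X q)) p).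
Definition Xv (X : C -> I3) (p : C) : I3 :=
  (dv (fun q => cl (X q)) p, dv (fun q => cx (X q)) p, dv (fun q => cy (X q)) p).
Definition Xuu (X : C -> I3) : C -> I3 := Xu (Xu X).
Definition Xuv (X : C -> I3) : C -> I3 := Xv (Xu X).
Definition Xvv (X : C -> I3) : C -> I3 := Xv (Xv X).

Definition immersed_at (X : C -> I3) (p : C) : Prop :=
  forall a b : R,
    plus (scal a (Xu X p)) (scal b (Xv X p)) = (0, 0, 0) -> a = 0 /\ b = 0.

(** * Surfaces in isotropic space *)

Definition metric_uu (X : C -> I3) (p : C) := mink (emb (Xu X p)) (emb (Xu X p)).
Definition metric_uv (X : C -> I3) (p : C) := mink (emb (Xu X p)) (emb (Xv X p)).
Definition metric_vv (X : C -> I3) (p : C) := mink (emb (Xv X p)) (emb (Xv X p)).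

(* The induced metric at p is e^(2 omega) (du^2 + dv^2), where e^(2 omega) is
   [metric_uu X p]. *)
Definition spacelike_conformal_at (X : C -> I3) (p : C) : Prop :=
  0 < metric_uu X p /\ metric_uu X p = metric_vv X p /\ metric_uv X p = 0.

(* n is the value at p of the lightlike Gauss map. *)
Definition gauss_map_at (X : C -> I3) (p : C) (n : R31) : Prop :=
  lightlike n /\ mink (emb (Xu X p)) n = 0 /\ mink (emb (Xv X p)) n = 0 /\
  mink n pvec = 1.

Definition mean_curvature (X : C -> I3) (p : C) (n : R31) : R :=
  / 2 * / metric_uu X p * (mink (emb (Xuu X p)) n + mink (emb (Xvv X p)) n).

Definition zmc_at (X : C -> I3) (p : C) : Prop :=
  exists n, gauss_map_at X p n /\ mean_curvature X p n = 0.

(** * Affine geometry *)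

Definition aff_L (X : C -> I3) (p : C) : R := det3 (Xu X p) (Xv X p) (Xuu X p).
Definition aff_M (X : C -> I3) (p : C) : R := det3 (Xu X p) (Xv X p) (Xuv X p).
Definition aff_N (X : C -> I3) (p : C) : R := det3 (Xu X p) (Xv X p) (Xvv X p).

Definition aff_disc (X : C -> I3) (p : C) : R :=
  aff_L X p * aff_N X p - aff_M X p * aff_M X p.

Definition nondegenerate_at (X : C -> I3) (p : C) : Prop := aff_disc X p <> 0.

(* The coefficients of the Berwald-Blaschke metric
   bb_uu du^2 + 2 bb_uv du dv + bb_vv dv^2. *)
Definition bb_scale (X : C -> I3) (p : C) : R := Rpower (Rabs (aff_disc X p)) (- / 4).
Definition bb_uu (X : C -> I3) (p : C) : R := bb_scale X p * aff_L X p.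
Definition bb_uv (X : C -> I3) (p : C) : R := bb_scale X p * aff_M X p.
Definition bb_vv (X : C -> I3) (p : C) : R := bb_scale X p * aff_N X p.

(* The Laplace-Beltrami operator of the pseudo-Riemannian metric
   g11 du^2 + 2 g12 du dv + g22 dv^2. *)
Definition laplacian (g11 g12 g22 : C -> R) (f : C -> R) (p : C) : R :=
  let det q := g11 q * g22 q - g12 q * g12 q in
  let vol q := sqrt (Rabs (det q)) in
  / vol p *
  (du (fun q => vol q * ((g22 q * du f q - g12 q * dv f q) / det q)) p
   + dv (fun q => vol q * ((g11 q * dv f q - g12 q * du f q) / det q)) p).

(* The affine normal is half the Laplacian of X for the Berwald-Blaschke
   metric.  Where this metric is 2 e^omega du dv, the Laplacian is
   2 e^(-omega) d^2/dudv, and the affine normal is e^(-omega) X_uv. *)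
Definition affine_normal (X : C -> I3) (p : C) : I3 :=
  let lap := laplacian (bb_uu X) (bb_uv X) (bb_vv X) in
  (/ 2 * lap (fun q => cl (X q)) p,
   / 2 * lap (fun q => cx (X q)) p,
   / 2 * lap (fun q => cy (X q)) p).

(* d(affine_normal) = - dX o S at p, for the matrix S = (s11 s12; s21 s22) with
   respect to the basis (d/du, d/dv). *)
Definition affine_shape_operator_at (X : C -> I3) (p : C)
    (s11 s12 s21 s22 : R) : Prop :=
  Xu (affine_normal X) p =
    opp (plus (scal s11 (Xu X p)) (scal s21 (Xv X p))) /\
  Xv (affine_normal X) p =
    opp (plus (scal s12 (Xu X p)) (scal s22 (Xv X p))).

Definition zero_affine_mean_curvature_at (X : C -> I3) (p : C) : Prop :=
  exists s11 s12 s21 s22,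
    affine_shape_operator_at X p s11 s12 s21 s22 /\ / 2 * (s11 + s22) = 0.

Definition planar (D : C -> Prop) (X : C -> I3) : Prop :=
  exists a b c d : R, (a, b, c) <> (0, 0, 0) /\
    forall p, D p -> a * cl (X p) + b * cx (X p) + c * cy (X p) = d.

(* A smooth X is allowed to be singular in D; the conditions are imposed where
   it is immersed. *)
Definition zero_mean_curvature (D : C -> Prop) (X : C -> I3) : Prop :=
  forall p, D p -> immersed_at X p ->
    spacelike_conformal_at X p /\ zmc_at X p.

Definition affine_minimal (D : C -> Prop) (X : C -> I3) : Prop :=
  planar D X \/
  forall p, D p -> immersed_at X p ->
    nondegenerate_at X p /\ zero_affine_mean_curvature_at X p.

Definition isolated_singularities (D : C -> Prop) (X : C -> I3) : Prop :=
  forall p, D p -> ~ immersed_at X p ->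
    locally p (fun q => q <> p -> immersed_at X q).

(** * Families of surfaces *)

Definition interval (I : R -> Prop) : Prop :=
  is_connected I /\ exists a b, a < b /\ I a /\ I b.

Definition continuous_deformation (I : R -> Prop) (D : C -> Prop)
    (F : R -> C -> I3) : Prop :=
  forall t0, I t0 ->
  forall K : C -> Prop, compact_set K -> (forall p, K p -> D p) ->
  forall eps, 0 < eps ->
  exists delta, 0 < delta /\
    forall t, I t -> Rabs (t - t0) < delta ->
    forall p, K p ->
      Rabs (cl (F t p) - cl (F t0 p)) < eps /\
      Rabs (cx (F t p) - cx (F t0 p)) < eps /\
      Rabs (cy (F t p) - cy (F t0 p)) < eps.

(* The reparametrization phi is a smooth local diffeomorphism from Sigma into D,
   not necessarily injective: an immersion precomposed with a non-injective
   local diffeomorphism is again an immersion.  If X is injective, so is phi. *)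
Definition piece_of (Sigma : C -> Prop) (X : C -> I3) (D : C -> Prop)
    (Y : C -> I3) : Prop :=
  exists phi : C -> C,
    smooth Sigma (fun p => fst (phi p)) /\ smooth Sigma (fun p => snd (phi p)) /\
    forall p, Sigma p ->
      D (phi p) /\
      du (fun q => fst (phi q)) p * dv (fun q => snd (phi q)) p
      - dv (fun q => fst (phi q)) p * du (fun q => snd (phi q)) p <> 0 /\
      X p = Y (phi p).

(* Main.v *)
(* In conformal coordinates a zero mean curvature surface is
   X = (Re F, Re W, +- Im W) with F, W holomorphic and W' <> 0.  When X is
   nondegenerate put r = F'/W', b^2 = W' r', W' = b P^2 and r = P2/P, so that
   F' = b P P2.  In terms of the asymptotic coordinate zeta, d zeta = b dz, the
   functions P, P2 have Wronskian 1 and the trace of the affine shape operator is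
   a nonzero multiple of Re (P_zeta_zeta / P) / |P|^2.  A holomorphic function
   with vanishing real part is constant, so X is affine minimal iff
   P_zeta_zeta = i c P for a real constant c.  Integrating this linear equation
   gives, up to similarities and a reparametrization,
     (Re zeta^2, zeta),  (Re zeta^2, zeta^3), and
     (Im (zeta + d e^(-zeta)), e^zeta - 2 d zeta - d^2 e^(-zeta)) with d >= 0,
   besides the plane.  Since any conformal parametrization of the plane l = 0 is
   affine minimal, these types are joined to each other by flattening l to 0 and
   then deforming W. *)

Require Import Defs.
From Stdlib Require Import Reals Lra Lia List Classical ClassicalEpsilon FunctionalExtensionality.
From Coquelicot Require Import Coquelicot.
Open Scope R_scope.

(** * Smooth and holomorphic functions *)

(** A single coordinate [phi] is needed on all of Sigma, so W' and r' need global logarithms, and F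
    and zeta must be global primitives. All of these come from one fact: a closed real 1-form on a
    simply connected domain has a primitive. Paths and homotopies are only continuous, so nothing
    can be integrated along them; the integral is replaced by a finite sum of local increments over
    a fine subdivision, which is stable under refinement.

    Since zeta need not be injective, it never serves as a parameter: derivatives in zeta are
    derivatives in z divided by b, and the affine computation uses b, P, P2 as functions of z.

    The constant d is minus the ratio of the two exponentials in P, rescaled by a translation of
    zeta. The imaginary part of the translation makes d nonnegative; its real part serves the
    condition that a similarity scales l and (x, y) equally. The sign of Im W is an orientation,
    absorbed by conjugating the parameter of the family. *)

Lemma open_slice_u (D : C -> Prop) p : open D -> D p ->
  locally (fst p) (fun u => D (u, snd p)).
Proof.
  intros HD Hp. destruct (HD p Hp) as [e He].
  exists e. intros u Hu. apply He. split; simpl.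
  - exact Hu.
  - apply ball_center.
Qed.

Lemma open_slice_v (D : C -> Prop) p : open D -> D p ->
  locally (snd p) (fun v => D (fst p, v)).
Proof.
  intros HD Hp. destruct (HD p Hp) as [e He].
  exists e. intros u Hu. apply He. split; simpl.
  - apply ball_center.
  - exact Hu.
Qed.

Definition is_du (f : C -> R) (p : C) (a : R) : Prop :=
  is_derive (fun u => f (u, snd p)) (fst p) a.
Definition is_dv (f : C -> R) (p : C) (a : R) : Prop :=
  is_derive (fun v => f (fst p, v)) (snd p) a.

Lemma is_du_unique f p a : is_du f p a -> du f p = a.
Proof. apply is_derive_unique. Qed.
Lemma is_dv_unique f p a : is_dv f p a -> dv f p = a.
Proof. apply is_derive_unique. Qed.

Lemma is_du_ext (D : C -> Prop) f g p a : open D -> D p ->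
  (forall q, D q -> f q = g q) -> is_du f p a -> is_du g p a.
Proof.
  intros HD Hp E. apply is_derive_ext_loc.
  apply (filter_imp (fun u => D (u, snd p))); [intros; now apply E|].
  now apply open_slice_u.
Qed.
Lemma is_dv_ext (D : C -> Prop) f g p a : open D -> D p ->
  (forall q, D q -> f q = g q) -> is_dv f p a -> is_dv g p a.
Proof.
  intros HD Hp E. apply is_derive_ext_loc.
  apply (filter_imp (fun v => D (fst p, v))); [intros; now apply E|].
  now apply open_slice_v.
Qed.

Lemma du_ext (D : C -> Prop) f g p : open D -> D p ->
  (forall q, D q -> f q = g q) -> du f p = du g p.
Proof.
  intros HD Hp E. apply Derive_ext_loc.
  apply (filter_imp (fun u => D (u, snd p))); [intros; now apply E|].
  now apply open_slice_u.
Qed.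
Lemma dv_ext (D : C -> Prop) f g p : open D -> D p ->
  (forall q, D q -> f q = g q) -> dv f p = dv g p.
Proof.
  intros HD Hp E. apply Derive_ext_loc.
  apply (filter_imp (fun u => D (fst p, u))); [intros; now apply E|].
  now apply open_slice_v.
Qed.

Lemma continuous_ext_open (D : C -> Prop) (f g : C -> R) p : open D -> D p ->
  (forall q, D q -> f q = g q) -> continuous f p -> continuous g p.
Proof.
  intros HD Hp E. apply continuous_ext_loc.
  apply (filter_imp D); [intros; now apply E|]. now apply HD.
Qed.

Lemma Ck_ext k (D : C -> Prop) f g : open D ->
  (forall q, D q -> f q = g q) -> Ck k D f -> Ck k D g.
Proof.
  intros HD. revert f g.
  induction k as [|k IH]; intros f g E [Hc H]; split.
  - intros p Hp. apply (continuous_ext_open D f); auto.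
  - exact I.
  - intros p Hp. apply (continuous_ext_open D f); auto.
  - destruct H as [Hd [Hu Hv]]. split; [|split].
    + intros p Hp. destruct (Hd p Hp) as [[a Ha] [b Hb]]. split.
      * exists a. now apply (is_du_ext D f g p a).
      * exists b. now apply (is_dv_ext D f g p b).
    + apply (IH (du f)); auto. intros q Hq. now apply (du_ext D).
    + apply (IH (dv f)); auto. intros q Hq. now apply (dv_ext D).
Qed.

Lemma Ck_pred k D f : Ck (S k) D f -> Ck k D f.
Proof.
  revert f; induction k as [|k IH]; intros f [Hc [Hd [Hu Hv]]]; split; auto.
Qed.

(** [Ck] speaks of the total functions [du f] and [dv f], which agree with the candidates [fu] and
    [fv] only on [D]; openness of [D] makes [Ck_ext] applicable. *)
Lemma Ck_intro k (D : C -> Prop) f fu fv : open D ->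
  (forall p, D p -> continuous f p) ->
  (forall p, D p -> is_du f p (fu p) /\ is_dv f p (fv p)) ->
  Ck k D fu -> Ck k D fv -> Ck (S k) D f.
Proof.
  intros HD Hc Hd Hu Hv. split; [exact Hc|]. split; [|split].
  - intros p Hp. destruct (Hd p Hp). split; eexists; eauto.
  - apply (Ck_ext k D fu); auto.
    intros q Hq. symmetry. now apply is_du_unique, Hd.
  - apply (Ck_ext k D fv); auto.
    intros q Hq. symmetry. now apply is_dv_unique, Hd.
Qed.

Lemma Ck_cont k D f p : Ck k D f -> D p -> continuous f p.
Proof. destruct k; intros [H _]; apply H. Qed.

Lemma Ck_du k D f p : Ck (S k) D f -> D p -> is_du f p (du f p).
Proof. intros [_ [H _]] Hp. apply Derive_correct, H, Hp. Qed.
Lemma Ck_dv k D f p : Ck (S k) D f -> D p -> is_dv f p (dv f p).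
Proof. intros [_ [H _]] Hp. apply Derive_correct, H, Hp. Qed.

Lemma smooth_du D f : smooth D f -> smooth D (du f).
Proof. intros H k. apply (H (S k)). Qed.
Lemma smooth_dv D f : smooth D f -> smooth D (dv f).
Proof. intros H k. apply (H (S k)). Qed.
Lemma smooth_is_du D f p : smooth D f -> D p -> is_du f p (du f p).
Proof. intros H. apply (Ck_du 0), H. Qed.
Lemma smooth_is_dv D f p : smooth D f -> D p -> is_dv f p (dv f p).
Proof. intros H. apply (Ck_dv 0), H. Qed.
Lemma smooth_cont D f p : smooth D f -> D p -> continuous f p.
Proof. intros H. apply (Ck_cont 0), H. Qed.
Lemma smooth_ext (D : C -> Prop) f g : open D ->
  (forall q, D q -> f q = g q) -> smooth D f -> smooth D g.
Proof. intros HD E H k. now apply (Ck_ext k D f). Qed.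

Lemma smooth_const D c : open D -> smooth D (fun _ => c).
Proof.
  intros HD k. revert c; induction k as [|k IH]; intros c.
  - split; [|exact I]. intros; apply continuous_const.
  - apply (Ck_intro k D _ (fun _ => 0) (fun _ => 0)); auto.
    + intros; apply continuous_const.
    + intros; split; exact (is_derive_const (V:=R_NormedModule) c _).
Qed.

Lemma smooth_fst D : open D -> smooth D (fun p => fst p).
Proof.
  intros HD [|k].
  - split; [|exact I]. intros; apply continuous_fst.
  - apply (Ck_intro k D _ (fun _ => 1) (fun _ => 0)); auto.
    + intros; apply continuous_fst.
    + intros; split; unfold is_du, is_dv; simpl.
      * apply (is_derive_id (K:=R_AbsRing)).
      * exact (is_derive_const (V:=R_NormedModule) (K:=R_AbsRing) _ _).
    + now apply smooth_const.
    + now apply smooth_const.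
Qed.

Lemma smooth_snd D : open D -> smooth D (fun p => snd p).
Proof.
  intros HD [|k].
  - split; [|exact I]. intros; apply continuous_snd.
  - apply (Ck_intro k D _ (fun _ => 0) (fun _ => 1)); auto.
    + intros; apply continuous_snd.
    + intros; split; unfold is_du, is_dv; simpl.
      * exact (is_derive_const (V:=R_NormedModule) (K:=R_AbsRing) _ _).
      * apply (is_derive_id (K:=R_AbsRing)).
    + now apply smooth_const.
    + now apply smooth_const.
Qed.

Lemma Ck_plus k D f g : open D -> Ck k D f -> Ck k D g ->
  Ck k D (fun p => f p + g p).
Proof.
  intros HD. revert f g; induction k as [|k IH]; intros f g Hf Hg.
  - split; [|exact I]. intros p Hp.
    apply (continuous_plus f g); [apply Hf|apply Hg]; auto.
  - apply (Ck_intro k D _ (fun p => du f p + du g p) (fun p => dv f p + dv g p)); auto.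
    + intros p Hp. apply (continuous_plus f g); [apply Hf|apply Hg]; auto.
    + intros p Hp. split.
      * apply (is_derive_plus (V:=R_NormedModule)); eapply Ck_du; eauto.
      * apply (is_derive_plus (V:=R_NormedModule)); eapply Ck_dv; eauto.
    + apply IH; [apply Hf|apply Hg].
    + apply IH; [apply Hf|apply Hg].
Qed.

Lemma Ck_mult k D f g : open D -> Ck k D f -> Ck k D g ->
  Ck k D (fun p => f p * g p).
Proof.
  intros HD. revert f g; induction k as [|k IH]; intros f g Hf Hg.
  - split; [|exact I]. intros p Hp.
    apply (continuous_mult f g); [apply Hf|apply Hg]; auto.
  - apply (Ck_intro k D _ (fun p => du f p * g p + f p * du g p)
             (fun p => dv f p * g p + f p * dv g p)); auto.
    + intros p Hp. apply (continuous_mult f g); [apply Hf|apply Hg]; auto.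
    + intros p Hp. split.
      * assert (H := Ck_du _ _ _ p Hf Hp). assert (H' := Ck_du _ _ _ p Hg Hp).
        assert (E := is_derive_mult (K:=R_AbsRing) _ _ _ _ _ H H' Rmult_comm).
        destruct p; exact E.
      * assert (H := Ck_dv _ _ _ p Hf Hp). assert (H' := Ck_dv _ _ _ p Hg Hp).
        assert (E := is_derive_mult (K:=R_AbsRing) _ _ _ _ _ H H' Rmult_comm).
        destruct p; exact E.
    + apply Ck_plus; auto; apply IH; try apply Hf; try apply Hg;
        now apply Ck_pred.
    + apply Ck_plus; auto; apply IH; try apply Hf; try apply Hg;
        now apply Ck_pred.
Qed.

Lemma smooth_plus D f g : open D -> smooth D f -> smooth D g ->
  smooth D (fun p => f p + g p).
Proof. intros HD Hf Hg k. now apply Ck_plus. Qed.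
Lemma smooth_mult D f g : open D -> smooth D f -> smooth D g ->
  smooth D (fun p => f p * g p).
Proof. intros HD Hf Hg k. now apply Ck_mult. Qed.
Lemma smooth_opp D f : open D -> smooth D f -> smooth D (fun p => - f p).
Proof.
  intros HD Hf. apply (smooth_ext D (fun p => (-1) * f p)); auto.
  - intros; ring.
  - apply smooth_mult; auto. now apply smooth_const.
Qed.
Lemma smooth_minus D f g : open D -> smooth D f -> smooth D g ->
  smooth D (fun p => f p - g p).
Proof. intros HD Hf Hg. apply smooth_plus; auto. now apply smooth_opp. Qed.

Lemma smooth_inv D f : open D -> smooth D f -> (forall p, D p -> f p <> 0) ->
  smooth D (fun p => / f p).
Proof.
  intros HD Hf Hn.
  assert (Hc : forall p, D p -> continuous (fun p => / f p) p).
  { intros p Hp. apply (continuous_comp f Rinv).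
    - now apply (smooth_cont D).
    - apply continuity_pt_filterlim, continuity_pt_inv.
      + apply derivable_continuous_pt, derivable_pt_id.
      + now apply Hn. }
  intros k; induction k as [|k IH].
  - now split.
  - apply (Ck_intro k D _ (fun p => (-1) * du f p * (/ f p * / f p))
             (fun p => (-1) * dv f p * (/ f p * / f p))); auto.
    + intros p Hp. split.
      * assert (E := is_derive_inv _ _ _ (smooth_is_du D f p Hf Hp)).
        destruct p as [u v]. simpl in E. specialize (E (Hn _ Hp)).
        replace ((-1) * du f (u,v) * (/ f (u,v) * / f (u,v)))
          with (- du f (u,v) / f (u,v) ^ 2); [exact E|].
        field. now apply Hn.
      * assert (E := is_derive_inv _ _ _ (smooth_is_dv D f p Hf Hp)).
        destruct p as [u v]. simpl in E. specialize (E (Hn _ Hp)).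
        replace ((-1) * dv f (u,v) * (/ f (u,v) * / f (u,v)))
          with (- dv f (u,v) / f (u,v) ^ 2); [exact E|].
        field. now apply Hn.
    + apply Ck_mult; auto; apply Ck_mult; auto;
        [now apply smooth_const | now apply smooth_du].
    + apply Ck_mult; auto; apply Ck_mult; auto;
        [now apply smooth_const | now apply smooth_dv].
Qed.

(** [H] is a whole sequence of successive derivatives: the partials of [H n] composed with [f]
    involve [H (S n)], so the induction on [k] needs every [n] at once. *)
Lemma smooth_comp D f (H : nat -> R -> R) : open D -> smooth D f ->
  (forall n x, is_derive (H n) x (H (S n) x)) ->
  forall n, smooth D (fun p => H n (f p)).
Proof.
  intros HD Hf Hd n k. revert n; induction k as [|k IH]; intros n.
  all: assert (Hc : forall p, D p -> continuous (fun p => H n (f p)) p) by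
    (intros p Hp; apply (continuous_comp f (H n)); [now apply (smooth_cont D)|];
     apply (ex_derive_continuous (H n)); eexists; apply Hd).
  - now split.
  - apply (Ck_intro k D _ (fun p => du f p * H (S n) (f p))
             (fun p => dv f p * H (S n) (f p))); auto.
    + intros p Hp. split.
      * assert (E := is_derive_comp (H n) _ _ _ _ (Hd n _) (smooth_is_du D f p Hf Hp)).
        destruct p; exact E.
      * assert (E := is_derive_comp (H n) _ _ _ _ (Hd n _) (smooth_is_dv D f p Hf Hp)).
        destruct p; exact E.
    + apply Ck_mult; auto. now apply smooth_du.
    + apply Ck_mult; auto. now apply smooth_dv.
Qed.

Lemma smooth_exp D f : open D -> smooth D f -> smooth D (fun p => exp (f p)).
Proof.
  intros HD Hf. apply (smooth_comp D f (fun _ => exp) HD Hf); [|exact 0%nat].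
  intros _ x. apply is_derive_exp.
Qed.

(** The shifts of cos by multiples of PI / 2 are its successive derivatives, in the form that
    [smooth_comp] asks for. *)
Lemma is_derive_cos_shift (n : nat) x :
  is_derive (fun x => cos (x + INR n * (PI / 2))) x (cos (x + INR (S n) * (PI / 2))).
Proof.
  rewrite S_INR.
  replace (x + (INR n + 1) * (PI / 2)) with (PI / 2 + (x + INR n * (PI / 2))) by field.
  replace (cos (PI / 2 + _)) with (- sin (x + INR n * (PI / 2)))
    by (rewrite sin_cos; ring).
  auto_derive; [trivial|ring].
Qed.

Lemma smooth_cos D f : open D -> smooth D f -> smooth D (fun p => cos (f p)).
Proof.
  intros HD Hf.
  apply (smooth_ext D (fun p => cos (f p + INR 0 * (PI / 2)))); auto.
  - intros q _. simpl. f_equal. ring.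
  - exact (smooth_comp D f (fun n x => cos (x + INR n * (PI / 2))) HD Hf
             is_derive_cos_shift 0%nat).
Qed.

Lemma smooth_sin D f : open D -> smooth D f -> smooth D (fun p => sin (f p)).
Proof.
  intros HD Hf.
  apply (smooth_ext D (fun p => (-1) * cos (PI / 2 + f p))); auto.
  - intros q _. rewrite sin_cos. ring.
  - apply smooth_mult; auto; [now apply smooth_const|].
    apply smooth_cos; auto. apply smooth_plus; auto. now apply smooth_const.
Qed.

Lemma continuous_2d (f : C -> R) p :
  continuous f p <-> continuity_2d_pt (fun u v => f (u, v)) (fst p) (snd p).
Proof.
  rewrite continuity_2d_pt_filterlim. destruct p as [u v]; simpl. split; intros H.
  - eapply filterlim_ext; [|exact H]. now intros [a b].
  - eapply filterlim_ext; [|exact H]. now intros [a b].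
Qed.

Lemma open_locally_2d (D : C -> Prop) (P : R -> R -> Prop) p : open D -> D p ->
  (forall q, D q -> P (fst q) (snd q)) -> locally_2d P (fst p) (snd p).
Proof.
  intros HD Hp HP. destruct (HD p Hp) as [e He]. exists e. intros u v Hu Hv.
  apply (HP (u, v)). apply He. now split.
Qed.

Lemma smooth_schwarz D f p : open D -> smooth D f -> D p ->
  dv (du f) p = du (dv f) p.
Proof.
  intros HD Hf Hp.
  assert (E := Schwarz (fun u v => f (u, v)) (fst p) (snd p)).
  symmetry. apply E.
  - apply (open_locally_2d D); auto. intros q Hq.
    assert (H1 := proj2 (Hf 2%nat)). simpl in H1.
    destruct H1 as [H1 [[_ [H2 _]] [_ [H3 _]]]].
    destruct (H1 q Hq). destruct (H2 q Hq). destruct (H3 q Hq). auto.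
  - apply (continuous_2d (du (dv f)) p).
    apply (smooth_cont D); auto. now apply smooth_du, smooth_dv.
  - apply (continuous_2d (dv (du f)) p).
    apply (smooth_cont D); auto. now apply smooth_dv, smooth_du.
Qed.

(** * Complex-valued derivatives and the Cauchy-Riemann equations *)

Definition cder (h : R -> C) (t : R) (c : C) : Prop :=
  is_derive (fun s => fst (h s)) t (fst c) /\ is_derive (fun s => snd (h s)) t (snd c).

Lemma cder_eq h t c c' : cder h t c -> c = c' -> cder h t c'.
Proof. now intros H <-. Qed.
Lemma cder_const c t : cder (fun _ => c) t 0%C.
Proof. split; simpl; auto_derive; trivial. Qed.
Lemma cder_plus f g t a b : cder f t a -> cder g t b ->
  cder (fun s => f s + g s)%C t (a + b)%C.
Proof.
  intros [F1 F2] [G1 G2].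
  split; apply (is_derive_plus (V:=R_NormedModule)); assumption.
Qed.
Lemma is_derive_Rmult (f g : R -> R) t a b : is_derive f t a -> is_derive g t b ->
  is_derive (fun s => f s * g s) t (a * g t + f t * b).
Proof. intros Hf Hg. exact (is_derive_mult (K:=R_AbsRing) f g t a b Hf Hg Rmult_comm). Qed.
Lemma is_derive_Req (f : R -> R) t a b : is_derive f t a -> a = b -> is_derive f t b.
Proof. now intros H <-. Qed.
Lemma cder_mult f g t a b : cder f t a -> cder g t b ->
  cder (fun s => f s * g s)%C t (a * g t + f t * b)%C.
Proof.
  intros [F1 F2] [G1 G2]. split; simpl.
  - replace (_ + _) with
      ((fst a * fst (g t) + fst (f t) * fst b) - (snd a * snd (g t) + snd (f t) * snd b)) by ring.
    apply (is_derive_minus (V:=R_NormedModule)); now apply is_derive_Rmult.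
  - replace (_ + _) with
      ((fst a * snd (g t) + fst (f t) * snd b) + (snd a * fst (g t) + snd (f t) * fst b)) by ring.
    apply (is_derive_plus (V:=R_NormedModule)); now apply is_derive_Rmult.
Qed.
Lemma cder_conj f t a : cder f t a -> cder (fun s => Cconj (f s)) t (Cconj a).
Proof.
  intros [F1 F2]. split; simpl; auto.
  now apply (is_derive_opp (V:=R_NormedModule)).
Qed.
Lemma C_norm2_pos (z : C) : z <> 0%C -> 0 < fst z * fst z + snd z * snd z.
Proof.
  intros Hz. destruct z as [x y]; simpl.
  destruct (Req_dec x 0) as [->|]; [|nra].
  destruct (Req_dec y 0) as [->|]; [|nra]. now destruct Hz.
Qed.
Lemma cder_inv f t a : cder f t a -> f t <> 0%C ->
  cder (fun s => / f s)%C t (- a * (/ f t * / f t))%C.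
Proof.
  intros [F1 F2] Hn. apply C_norm2_pos in Hn.
  assert (HN : is_derive (fun s => fst (f s) ^ 2 + snd (f s) ^ 2) t
    (2 * fst (f t) * fst a + 2 * snd (f t) * snd a)).
  { apply (is_derive_plus (V:=R_NormedModule)).
    - eapply is_derive_Req;
        [exact (is_derive_pow (fun s => fst (f s)) 2 t _ F1)|simpl; ring].
    - eapply is_derive_Req;
        [exact (is_derive_pow (fun s => snd (f s)) 2 t _ F2)|simpl; ring]. }
  assert (Hn' : fst (f t) ^ 2 + snd (f t) ^ 2 <> 0) by (simpl; nra).
  assert (HI := is_derive_inv _ _ _ HN Hn').
  split.
  - eapply is_derive_Req; [exact (is_derive_Rmult _ _ _ _ _ F1 HI)|].
    simpl. field. simpl in Hn'. lra.
  - eapply is_derive_Req;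
     [exact (is_derive_Rmult _ _ _ _ _ (is_derive_opp (V:=R_NormedModule) _ _ _ F2) HI)|].
    unfold opp; simpl. field. simpl in Hn'. lra.
Qed.

Definition cexp (z : C) : C := (exp (fst z) * cos (snd z), exp (fst z) * sin (snd z)).

Lemma cder_exp f t a : cder f t a -> cder (fun s => cexp (f s)) t (a * cexp (f t))%C.
Proof.
  intros [F1 F2].
  assert (E1 := is_derive_comp (V:=R_NormedModule) exp _ _ _ _ (is_derive_exp _) F1).
  assert (E2 := is_derive_comp (V:=R_NormedModule) cos _ _ _ _ (is_derive_cos _) F2).
  assert (E3 := is_derive_comp (V:=R_NormedModule) sin _ _ _ _ (is_derive_sin _) F2).
  split; simpl.
  - eapply is_derive_Req; [exact (is_derive_Rmult _ _ _ _ _ E1 E2)|].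
    unfold scal; simpl; unfold mult; simpl; ring.
  - eapply is_derive_Req; [exact (is_derive_Rmult _ _ _ _ _ E1 E3)|].
    unfold scal; simpl; unfold mult; simpl; ring.
Qed.

(** Two independent complex partials, so that maps which are not holomorphic, such as quotients by a
    conjugate, obey the same calculus. *)
Definition is_pd (f : C -> C) (p a b : C) : Prop :=
  cder (fun u => f (u, snd p)) (fst p) a /\ cder (fun v => f (fst p, v)) (snd p) b.

(** The Cauchy-Riemann equations at a point, in the form f_v = i f_u; [c] is then the complex
    derivative. *)
Definition is_hd (f : C -> C) (p c : C) : Prop := is_pd f p c (Ci * c)%C.

Lemma is_pd_eq f p a b a' b' : is_pd f p a b -> a = a' -> b = b' -> is_pd f p a' b'.
Proof. now intros H <- <-. Qed.
Lemma is_hd_eq f p c c' : is_hd f p c -> c = c' -> is_hd f p c'.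
Proof. now intros H <-. Qed.

Lemma is_pd_ext (D : C -> Prop) f g p a b : open D -> D p ->
  (forall q, D q -> f q = g q) -> is_pd f p a b -> is_pd g p a b.
Proof.
  intros HD Hp E [[H1 H2] [H3 H4]].
  assert (E1 : forall q, D q -> fst (f q) = fst (g q)) by (intros; now rewrite E).
  assert (E2 : forall q, D q -> snd (f q) = snd (g q)) by (intros; now rewrite E).
  split; split.
  - exact (is_du_ext D (fun q => fst (f q)) _ p _ HD Hp E1 H1).
  - exact (is_du_ext D (fun q => snd (f q)) _ p _ HD Hp E2 H2).
  - exact (is_dv_ext D (fun q => fst (f q)) _ p _ HD Hp E1 H3).
  - exact (is_dv_ext D (fun q => snd (f q)) _ p _ HD Hp E2 H4).
Qed.
Lemma is_hd_ext (D : C -> Prop) f g p a : open D -> D p ->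
  (forall q, D q -> f q = g q) -> is_hd f p a -> is_hd g p a.
Proof. apply is_pd_ext. Qed.

Lemma is_pd_plus f g p a b a' b' : is_pd f p a b -> is_pd g p a' b' ->
  is_pd (fun q => f q + g q)%C p (a + a')%C (b + b')%C.
Proof. intros [F1 F2] [G1 G2]. split; now apply cder_plus. Qed.
Lemma is_pd_mult f g p a b a' b' : is_pd f p a b -> is_pd g p a' b' ->
  is_pd (fun q => f q * g q)%C p (a * g p + f p * a')%C (b * g p + f p * b')%C.
Proof.
  intros [F1 F2] [G1 G2]. destruct p; split.
  - exact (cder_mult _ _ _ _ _ F1 G1).
  - exact (cder_mult _ _ _ _ _ F2 G2).
Qed.
Lemma is_pd_conj f p a b : is_pd f p a b ->
  is_pd (fun q => Cconj (f q)) p (Cconj a) (Cconj b).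
Proof. intros [F1 F2]. split; now apply cder_conj. Qed.
Lemma is_pd_inv f p a b : is_pd f p a b -> f p <> 0%C ->
  is_pd (fun q => / f q)%C p (- a * (/ f p * / f p))%C (- b * (/ f p * / f p))%C.
Proof.
  intros [F1 F2] Hn. destruct p; split.
  - exact (cder_inv _ _ _ F1 Hn).
  - exact (cder_inv _ _ _ F2 Hn).
Qed.

Lemma is_hd_const c p : is_hd (fun _ => c) p 0%C.
Proof. split; [apply cder_const|]. eapply cder_eq; [apply cder_const|ring]. Qed.
Lemma is_hd_id p : is_hd (fun z => z) p 1%C.
Proof. split; split; simpl; auto_derive; trivial; ring. Qed.
Lemma is_hd_plus f g p a b : is_hd f p a -> is_hd g p b ->
  is_hd (fun q => f q + g q)%C p (a + b)%C.
Proof. intros F G. eapply is_pd_eq; [exact (is_pd_plus _ _ _ _ _ _ _ F G)| |]; ring. Qed.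
Lemma is_hd_mult f g p a b : is_hd f p a -> is_hd g p b ->
  is_hd (fun q => f q * g q)%C p (a * g p + f p * b)%C.
Proof. intros F G. eapply is_pd_eq; [exact (is_pd_mult _ _ _ _ _ _ _ F G)| |]; ring. Qed.
Lemma is_hd_scal c f p a : is_hd f p a -> is_hd (fun q => c * f q)%C p (c * a)%C.
Proof.
  intros F. eapply is_hd_eq; [exact (is_hd_mult _ _ _ _ _ (is_hd_const c p) F)|]. cbn beta. ring.
Qed.
Lemma is_hd_inv f p a : is_hd f p a -> f p <> 0%C ->
  is_hd (fun q => / f q)%C p (- a * (/ f p * / f p))%C.
Proof. intros F Hn. eapply is_pd_eq; [exact (is_pd_inv _ _ _ _ F Hn)| |]; ring. Qed.
Lemma is_hd_exp f p a : is_hd f p a -> is_hd (fun q => cexp (f q)) p (a * cexp (f p))%C.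
Proof.
  intros [F1 F2]. destruct p. split.
  - exact (cder_exp _ _ _ F1).
  - eapply cder_eq; [exact (cder_exp _ _ _ F2)|]. cbn [fst snd]. ring.
Qed.

Definition cd (f : C -> C) (p : C) : C :=
  (du (fun q => fst (f q)) p, du (fun q => snd (f q)) p).

Lemma is_hd_cd f p c : is_hd f p c -> cd f p = c.
Proof.
  intros [[H1 H2] _]. unfold cd.
  rewrite (is_du_unique (fun q => fst (f q)) p _ H1).
  rewrite (is_du_unique (fun q => snd (f q)) p _ H2). now destruct c.
Qed.

Definition smoothC (D : C -> Prop) (f : C -> C) : Prop :=
  smooth D (fun p => fst (f p)) /\ smooth D (fun p => snd (f p)).

(** Smoothness is part of the notion, and each closure lemma below carries it along. *)
Definition hol (D : C -> Prop) (f : C -> C) : Prop :=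
  smoothC D f /\ forall p, D p -> is_hd f p (cd f p).

Lemma hol_hd D f p : hol D f -> D p -> is_hd f p (cd f p).
Proof. intros [_ H]. apply H. Qed.

Lemma hol_intro (D : C -> Prop) f f' : smoothC D f ->
  (forall p, D p -> is_hd f p (f' p)) -> hol D f.
Proof.
  intros Hs H. split; auto. intros p Hp.
  now rewrite (is_hd_cd _ _ _ (H p Hp)); auto.
Qed.

Lemma hol_cr D f : smoothC D f ->
  (forall p, D p -> dv (fun q => fst (f q)) p = - du (fun q => snd (f q)) p /\
                    dv (fun q => snd (f q)) p = du (fun q => fst (f q)) p) ->
  hol D f.
Proof.
  intros [S1 S2] H. split; [now split|]. intros p Hp. destruct (H p Hp) as [E1 E2].
  split; split; simpl.
  - now apply (smooth_is_du D (fun q => fst (f q))).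
  - now apply (smooth_is_du D (fun q => snd (f q))).
  - replace (_ - _) with (dv (fun q => fst (f q)) p) by (rewrite E1; ring).
    now apply (smooth_is_dv D (fun q => fst (f q))).
  - replace (_ + _) with (dv (fun q => snd (f q)) p) by (rewrite E2; ring).
    now apply (smooth_is_dv D (fun q => snd (f q))).
Qed.

Lemma hol_dv D f p : hol D f -> D p ->
  dv (fun q => fst (f q)) p = - snd (cd f p) /\ dv (fun q => snd (f q)) p = fst (cd f p).
Proof.
  intros [_ H] Hp. destruct (H p Hp) as [_ [H3 H4]]. split.
  - rewrite (is_dv_unique (fun q => fst (f q)) p _ H3). simpl; ring.
  - rewrite (is_dv_unique (fun q => snd (f q)) p _ H4). simpl; ring.
Qed.

(** Differentiate the Cauchy-Riemann equations of [f] in u and exchange the mixed partials. *)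
Lemma hol_cd D f : open D -> hol D f -> hol D (cd f).
Proof.
  intros HD Hf. destruct (Hf) as [[S1 S2] _]. apply hol_cr.
  - split; simpl; now apply smooth_du.
  - intros p Hp; simpl.
    assert (Q1 := smooth_schwarz D _ p HD S1 Hp).
    assert (Q2 := smooth_schwarz D _ p HD S2 Hp).
    simpl in Q1, Q2. unfold cd. simpl.
    change (fun q => du (fun q0 => fst (f q0)) q) with (du (fun q0 => fst (f q0))).
    change (fun q => du (fun q0 => snd (f q0)) q) with (du (fun q0 => snd (f q0))).
    rewrite Q1, Q2. split.
    + rewrite (du_ext D _ (fun q => - du (fun q0 => snd (f q0)) q) p HD Hp).
      * unfold du at 1. now rewrite Derive_opp.
      * intros q Hq. apply (proj1 (hol_dv D f q Hf Hq)).
    + apply (du_ext D); auto.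
      intros q Hq. apply (proj2 (hol_dv D f q Hf Hq)).
Qed.

Lemma hol_ext (D : C -> Prop) f g : open D -> (forall q, D q -> f q = g q) ->
  hol D f -> hol D g.
Proof.
  intros HD E [[S1 S2] H].
  apply (hol_intro D g (cd f)).
  - split; [apply (smooth_ext D (fun p => fst (f p)))
           |apply (smooth_ext D (fun p => snd (f p)))]; auto;
      intros; now rewrite E.
  - intros p Hp. apply (is_hd_ext D f); auto.
Qed.
Lemma hol_const D c : open D -> hol D (fun _ => c).
Proof.
  intros HD. apply (hol_intro D _ (fun _ => 0%C)).
  - split; now apply smooth_const.
  - intros; apply is_hd_const.
Qed.
Lemma hol_id D : open D -> hol D (fun z => z).
Proof.
  intros HD. apply (hol_intro D _ (fun _ => 1%C)).
  - split; [now apply smooth_fst|now apply smooth_snd].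
  - intros; apply is_hd_id.
Qed.
Lemma hol_plus D f g : open D -> hol D f -> hol D g -> hol D (fun q => f q + g q)%C.
Proof.
  intros HD [[F1 F2] F] [[G1 G2] G].
  apply (hol_intro D _ (fun q => cd f q + cd g q)%C).
  - split; simpl; now apply smooth_plus.
  - intros p Hp. apply is_hd_plus; auto.
Qed.
Lemma hol_mult D f g : open D -> hol D f -> hol D g -> hol D (fun q => f q * g q)%C.
Proof.
  intros HD [[F1 F2] F] [[G1 G2] G].
  apply (hol_intro D _ (fun q => cd f q * g q + f q * cd g q)%C).
  - split; simpl; [apply smooth_minus|apply smooth_plus]; auto; now apply smooth_mult.
  - intros p Hp. apply is_hd_mult; auto.
Qed.
Lemma hol_scal D c f : open D -> hol D f -> hol D (fun q => c * f q)%C.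
Proof. intros HD Hf. apply hol_mult; auto. now apply hol_const. Qed.
Lemma hol_opp D f : open D -> hol D f -> hol D (fun q => - f q)%C.
Proof.
  intros HD Hf. apply (hol_ext D (fun q => (- (1)) * f q)%C); auto.
  - intros. ring.
  - now apply hol_scal.
Qed.
Lemma hol_minus D f g : open D -> hol D f -> hol D g -> hol D (fun q => f q - g q)%C.
Proof. intros HD Hf Hg. apply hol_plus; auto. now apply hol_opp. Qed.
Lemma hol_exp D f : open D -> hol D f -> hol D (fun q => cexp (f q)).
Proof.
  intros HD [[F1 F2] F].
  apply (hol_intro D _ (fun q => cd f q * cexp (f q))%C).
  - split; simpl; (apply smooth_mult; auto; [now apply smooth_exp|]);
      [now apply smooth_cos|now apply smooth_sin].
  - intros p Hp. apply is_hd_exp; auto.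
Qed.
Lemma hol_inv D f : open D -> hol D f -> (forall p, D p -> f p <> 0%C) ->
  hol D (fun q => / f q)%C.
Proof.
  intros HD [[F1 F2] F] Hn.
  apply (hol_intro D _ (fun q => - cd f q * (/ f q * / f q))%C).
  - assert (HN : smooth D (fun p => / (fst (f p) ^ 2 + snd (f p) ^ 2))).
    { apply smooth_inv; auto.
      - simpl. apply smooth_plus; auto; apply smooth_mult; auto;
        apply smooth_mult; auto; now apply smooth_const.
      - intros p Hp. specialize (C_norm2_pos _ (Hn p Hp)). nra. }
    split; simpl; apply smooth_mult; auto. now apply smooth_opp.
  - intros p Hp. apply is_hd_inv; auto.
Qed.
Lemma hol_div D f g : open D -> hol D f -> hol D g -> (forall p, D p -> g p <> 0%C) ->
  hol D (fun q => f q / g q)%C.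
Proof. intros. apply hol_mult; auto. now apply hol_inv. Qed.

(** * Primitives on simply connected domains *)

Fixpoint nsum (F : nat -> R) (n : nat) : R :=
  match n with O => 0 | S n => nsum F n + F n end.

(** A Lebesgue number for the cover of the compact image of the square by the balls of radius
    [e p]. *)
Lemma lebesgue_number (D : C -> Prop) (e : C -> posreal) (h : R * R -> C) :
  (forall st, continuous h st) ->
  (forall s t, 0 <= s <= 1 -> 0 <= t <= 1 -> D (h (s, t))) ->
  exists d : posreal, forall x y, 0 <= x <= 1 -> 0 <= y <= 1 ->
    exists p, D p /\ forall x' y', Rabs (x' - x) < d -> Rabs (y' - y) < d ->
      ball p (e p) (h (x', y')).
Proof.
  intros Hc HD.
  (* The factor 2 leaves room: a point within the chosen radius of (u, v) still has its whole
     neighbourhood of that radius inside the ball. *)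
  assert (H : forall u v, exists d : posreal,
    forall x y, Rabs (x - u) < 2 * d -> Rabs (y - v) < 2 * d ->
      ball (h (u, v)) (e (h (u, v))) (h (x, y))).
  { intros u v.
    assert (L : locally (u, v) (fun z => ball (h (u, v)) (e (h (u, v))) (h z)))
      by (apply (Hc (u, v)); apply locally_ball).
    destruct L as [d Hd].
    assert (Hp : 0 < d / 2) by (destruct d; simpl; lra).
    exists (mkposreal _ Hp). simpl. intros x y Hx Hy. apply Hd.
    split; simpl; [change (Rabs (x - u) < d)|change (Rabs (y - v) < d)]; lra. }
  pose (delta := fun u v => proj1_sig (constructive_indefinite_description _ (H u v))).
  assert (Hdelta : forall u v x y, Rabs (x - u) < 2 * delta u v ->
     Rabs (y - v) < 2 * delta u v -> ball (h (u, v)) (e (h (u, v))) (h (x, y)))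
    by (intros u v; apply (proj2_sig (constructive_indefinite_description _ (H u v)))).
  destruct (compactness_value_2d 0 1 0 1 delta) as [d Hd].
  exists d. intros x y Hx Hy.
  destruct (NNPP _ (Hd x y Hx Hy)) as (u & v & Hu & Hv & Hxu & Hyv & Hle).
  exists (h (u, v)). split; [now apply HD|]. intros x' y' Hx' Hy'.
  apply Hdelta.
  - replace (x' - u) with ((x' - x) + (x - u)) by ring.
    eapply Rle_lt_trans; [apply Rabs_triang|]. lra.
  - replace (y' - v) with ((y' - y) + (y - v)) by ring.
    eapply Rle_lt_trans; [apply Rabs_triang|]. lra.
Qed.

Lemma lebesgue_number_path (D : C -> Prop) (e : C -> posreal) gamma :
  path_in D gamma ->
  exists d : posreal, forall t, 0 <= t <= 1 ->
    exists p, D p /\ forall t', Rabs (t' - t) < d -> ball p (e p) (gamma t').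
Proof.
  intros [Hc HD].
  destruct (lebesgue_number D e (fun st => gamma (snd st))) as [d Hd].
  - intros st. apply (continuous_comp snd gamma); [apply continuous_snd|apply Hc].
  - intros; now apply HD.
  - exists d. intros t Ht. destruct (Hd t t Ht Ht) as [p [Hp Hb]].
    exists p; split; auto. intros t' Ht'. now apply (Hb t' t').
Qed.

Lemma grid_in N k : (k <= N)%nat -> (0 < N)%nat -> 0 <= INR k / INR N <= 1.
Proof.
  intros Hk HN. apply lt_0_INR in HN. apply le_INR in Hk.
  assert (0 <= INR k) by apply pos_INR.
  split.
  - apply Rmult_le_pos; [auto|]. left; now apply Rinv_0_lt_compat.
  - apply (Rmult_le_reg_r (INR N)); auto. field_simplify; lra.
Qed.

Lemma grid_step N k : (0 < N)%nat -> INR (S k) / INR N - INR k / INR N = / INR N.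
Proof. intros HN. apply lt_0_INR in HN. rewrite S_INR. field. lra. Qed.

Lemma inv_INR_small (d : posreal) :
  exists N0 : nat, (0 < N0)%nat /\ forall N, (N0 <= N)%nat -> / INR N < d.
Proof.
  destruct (archimed_cor1 d (cond_pos d)) as [N0 [H1 H2]].
  exists N0; split; auto. intros N HN.
  apply Rle_lt_trans with (/ INR N0); auto.
  apply Rinv_le_contravar; [now apply lt_0_INR|now apply le_INR].
Qed.

(** A property that spreads through a small ball around every point spreads along a path, once the
    path is cut finer than a Lebesgue number. *)
Lemma path_connected_ind (D : C -> Prop) (Q : C -> Prop) : plane_domain D ->
  (forall p, D p -> exists e : posreal,
     forall a b, ball p e a -> ball p e b -> Q a -> Q b) ->
  forall a b, D a -> D b -> Q a -> Q b.
Proof.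
  intros [_ [_ Hpath]] HQ a b Ha Hb Qa.
  destruct (Hpath a b Ha Hb) as [g [Hg [<- <-]]].
  (* Points outside [D] receive the dummy radius 1, so that the choice of radii is a total
     function. *)
  assert (H : forall p, exists e : posreal, D p ->
     forall a b, ball p e a -> ball p e b -> Q a -> Q b).
  { intros p. destruct (classic (D p)) as [Hp|Hp].
    - destruct (HQ p Hp) as [e He]. now exists e.
    - now exists (mkposreal 1 Rlt_0_1). }
  pose (e := fun p => proj1_sig (constructive_indefinite_description _ (H p))).
  assert (He : forall p, D p -> forall a b, ball p (e p) a -> ball p (e p) b -> Q a -> Q b)
    by (intros p; apply (proj2_sig (constructive_indefinite_description _ (H p)))).
  destruct (lebesgue_number_path D e g Hg) as [d Hd].
  destruct (inv_INR_small d) as [N [HN Hlt]]. specialize (Hlt N (le_n N)).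
  assert (Hk : forall k, (k <= N)%nat -> Q (g (INR k / INR N))).
  { induction k as [|k IH]; intros Hk.
    - simpl. unfold Rdiv. now rewrite Rmult_0_l.
    - destruct (Hd (INR k / INR N)) as [p [Hp Hb']]; [apply grid_in; lia|].
      apply (He p Hp (g (INR k / INR N))); [| |apply IH; lia]; apply Hb'.
      + rewrite Rminus_diag. rewrite Rabs_R0. apply cond_pos.
      + rewrite grid_step by lia. rewrite Rabs_pos_eq; auto.
        left; apply Rinv_0_lt_compat. now apply lt_0_INR. }
  specialize (Hk N (le_n N)). unfold Rdiv in Hk. rewrite Rinv_r in Hk; auto.
  apply not_0_INR; lia.
Qed.

(** The retraction of R onto [0, 1]. It extends pieces of paths to all of R, and later makes
    coefficients of the family piecewise linear. *)
Definition clamp (x : R) : R := Rmax 0 (Rmin 1 x).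

Lemma clamp_0 x : x <= 0 -> clamp x = 0.
Proof. intros H. unfold clamp. rewrite Rmin_right, Rmax_left; lra. Qed.
Lemma clamp_1 x : 1 <= x -> clamp x = 1.
Proof. intros H. unfold clamp. rewrite Rmin_left, Rmax_right; lra. Qed.
Lemma clamp_id x : 0 <= x <= 1 -> clamp x = x.
Proof. intros H. unfold clamp. rewrite Rmin_right, Rmax_right; lra. Qed.

Lemma clamp_in x : 0 <= clamp x <= 1.
Proof.
  unfold clamp, Rmax, Rmin. destruct (Rle_dec 1 x); destruct (Rle_dec 0 _); lra.
Qed.
Lemma clamp_lipschitz x y : Rabs (clamp x - clamp y) <= Rabs (x - y).
Proof.
  unfold clamp, Rmax, Rmin, Rabs.
  repeat destruct (Rle_dec _ _); repeat destruct (Rcase_abs _); lra.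
Qed.
Lemma lipschitz_continuous (f : R -> R) x :
  (forall y, Rabs (f y - f x) <= Rabs (y - x)) -> continuous f x.
Proof.
  intros H. apply filterlim_locally. intros eps. exists eps. intros y Hy.
  apply Rle_lt_trans with (Rabs (y - x)); [apply H|exact Hy].
Qed.
Lemma continuous_clamp x : continuous clamp x.
Proof. apply lipschitz_continuous. intros; apply clamp_lipschitz. Qed.

Lemma continuous_pair (f g : R -> R) t : continuous f t -> continuous g t ->
  continuous (fun t => (f t, g t) : C) t.
Proof.
  intros Hf Hg. apply (continuous_comp_2 f g (fun a b => (a, b) : C)); auto.
  eapply filterlim_ext; [|apply filterlim_id]. now intros [a b].
Qed.

Lemma continuous_affine a b t : continuous (fun t : R => a * t + b) t.
Proof. apply (ex_derive_continuous (V:=R_NormedModule)). auto_derive; trivial. Qed.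

Lemma ball_segment (p a b : C) (r s : R) : ball p r a -> ball p r b -> 0 <= s <= 1 ->
  ball p r (fst a + s * (fst b - fst a), snd a + s * (snd b - snd a)).
Proof.
  intros [A1 A2] [B1 B2] Hs.
  assert (H : forall x y z : R, ball x r y -> ball x r z -> ball x r (y + s * (z - y))).
  { intros x y z Hy Hz. apply Rabs_def2 in Hy. apply Rabs_def2 in Hz.
    unfold minus, plus, opp in Hy, Hz; simpl in Hy, Hz.
    assert (Hm : Rmin y z <= y + s * (z - y) <= Rmax y z)
      by (unfold Rmin, Rmax; destruct (Rle_dec y z); nra).
    unfold Rmin, Rmax in Hm.
    apply Rabs_def1; unfold minus, plus, opp; simpl; destruct (Rle_dec y z); lra. }
  split; simpl; now apply H.
Qed.

(** * Path integrals as finite sums of local increments *)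

Section Cochain.

Variable D : C -> Prop.
Variable seg : C -> C -> R.

(* [seg a b] plays the role of the integral of a closed form from a to b; it is
   only meaningful for nearby points. *)
Definition locally_exact : Prop :=
  forall p, D p -> exists (e : posreal) (g : C -> R),
    forall a b, ball p e a -> ball p e b -> seg a b = g b - g a.

Hypothesis Hseg : locally_exact.
Hypothesis HD : simply_connected_domain D.

Lemma exact_radius : { e : C -> posreal | forall p, D p -> exists g : C -> R,
    forall a b, ball p (e p) a -> ball p (e p) b -> seg a b = g b - g a }.
Proof.
  apply constructive_indefinite_description.
  assert (H : forall p, exists e : posreal, D p -> exists g : C -> R,
    forall a b, ball p e a -> ball p e b -> seg a b = g b - g a).
  { intros p. destruct (classic (D p)) as [Hp|Hp].
    - destruct (Hseg p Hp) as [e He]. now exists e.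
    - now exists (mkposreal 1 Rlt_0_1). }
  exists (fun p => proj1_sig (constructive_indefinite_description _ (H p))).
  intros p. apply (proj2_sig (constructive_indefinite_description _ (H p))).
Qed.

Let e := proj1_sig exact_radius.
Let He := proj2_sig exact_radius : forall p, D p -> exists g : C -> R,
    forall a b, ball p (e p) a -> ball p (e p) b -> seg a b = g b - g a.

Definition csum (x : nat -> C) (n : nat) : R := nsum (fun k => seg (x k) (x (S k))) n.

Lemma csum_ext x y n : (forall k, (k <= n)%nat -> x k = y k) -> csum x n = csum y n.
Proof.
  unfold csum. induction n as [|n IH]; intros H; simpl; auto.
  rewrite IH by (intros; apply H; lia). rewrite !H by lia. reflexivity.
Qed.
Lemma csum_add x n m : csum x (n + m) = csum x n + csum (fun k => x (n + k)%nat) m.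
Proof.
  unfold csum. induction m as [|m IH]; simpl.
  - rewrite Nat.add_0_r. ring.
  - rewrite Nat.add_succ_r. simpl. rewrite IH. ring.
Qed.
Lemma csum_telescope (P : C -> Prop) g x n :
  (forall a b, P a -> P b -> seg a b = g b - g a) ->
  (forall k, (k <= n)%nat -> P (x k)) -> csum x n = g (x n) - g (x O).
Proof.
  unfold csum. induction n as [|n IH]; intros Hg H; simpl; [ring|].
  rewrite IH by (auto; intros; apply H; lia). rewrite Hg by (apply H; lia). ring.
Qed.
Lemma csum_rev x n :
  (forall k, (k < n)%nat -> seg (x (S k)) (x k) = - seg (x k) (x (S k))) ->
  csum (fun k => x (n - k)%nat) n = - csum x n.
Proof.
  revert x. induction n as [|n IH]; intros x H; [unfold csum; simpl; ring|].
  transitivity (csum (fun k => x (S n - k)%nat) 1 + csum (fun k => x (n - k)%nat) n).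
  { change (S n) with (1 + n)%nat at 2. now rewrite csum_add. }
  rewrite IH by (intros; apply H; lia).
  unfold csum; simpl. rewrite Nat.sub_0_r, H by lia. ring.
Qed.
Lemma csum_refine x M N :
  (forall k, (k < N)%nat ->
     csum (fun j => x (k * M + j)%nat) M = seg (x (k * M)%nat) (x (S k * M)%nat)) ->
  csum x (N * M) = csum (fun k => x (k * M)%nat) N.
Proof.
  induction N as [|N IH]; intros H; [reflexivity|].
  replace (S N * M)%nat with (N * M + M)%nat by lia.
  rewrite csum_add, IH by (intros; apply H; lia).
  rewrite H by lia. reflexivity.
Qed.

Definition grid (gamma : R -> C) (N k : nat) : C := gamma (INR k / INR N).

(** The integral along [gamma]. On sufficiently fine uniform grids the sums agree exactly, so
    eventual constancy takes the place of a limit. *)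
Definition path_value (gamma : R -> C) (V : R) : Prop :=
  exists N0, forall N, (N0 <= N)%nat -> csum (grid gamma N) N = V.

(** Each cell of a fine grid lies in a ball where [seg] is a difference of a potential, so
    subdividing it changes nothing. Two fine grids are compared through their common refinement, of
    size the product. *)
Lemma path_value_exists gamma : path_in D gamma -> exists V, path_value gamma V.
Proof.
  intros Hg. destruct (lebesgue_number_path D e gamma Hg) as [d Hd].
  destruct (inv_INR_small d) as [N0 [HN0 Hlt]].
  assert (Hre : forall N M, (N0 <= N)%nat -> (0 < M)%nat ->
    csum (grid gamma (N * M)) (N * M) = csum (grid gamma N) N).
  { intros N M HN HM.
    assert (HNp : 0 < INR N) by (apply lt_0_INR; lia).
    assert (HMp : 0 < INR M) by (apply lt_0_INR; lia).
    rewrite csum_refine.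
    - apply csum_ext. intros k Hk. unfold grid. f_equal.
      rewrite !mult_INR. field. lra.
    - intros k Hk. destruct (Hd (INR k / INR N)) as [p [Hp Hb]]; [apply grid_in; lia|].
      destruct (He p Hp) as [g Hgg].
      assert (HB : forall j, (j <= M)%nat ->
        ball p (e p) (grid gamma (N * M) (k * M + j))).
      { intros j Hj. apply Hb. rewrite plus_INR, !mult_INR.
        replace (_ - _) with ((INR j / INR M) * / INR N) by (field; lra).
        destruct (grid_in M j Hj HM) as [G1 G2]. specialize (Hlt N HN).
        assert (0 < / INR N) by now apply Rinv_0_lt_compat.
        rewrite Rabs_pos_eq by nra. nra. }
      rewrite (csum_telescope (ball p (e p)) g); auto.
      rewrite Hgg.
      + do 3 f_equal; lia.
      + replace (k * M)%nat with (k * M + 0)%nat by lia. apply HB; lia.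
      + replace (S k * M)%nat with (k * M + M)%nat by lia. apply HB; lia. }
  exists (csum (grid gamma N0) N0). exists N0. intros N HN.
  rewrite <- (Hre N N0) by lia. rewrite Nat.mul_comm. apply Hre; lia.
Qed.

(** Subdivide the square of a contraction of the loop. The increments around each small cell cancel,
    so all rows have the same sum, and the last row is a constant path. *)
Lemma path_value_loop gamma : path_in D gamma -> gamma 0 = gamma 1 -> path_value gamma 0.
Proof.
  intros Hg Hl. destruct (proj2 HD gamma Hg Hl) as (h & Hc & HhD & H0 & H1 & Hside).
  destruct (lebesgue_number D e h Hc HhD) as [d Hd].
  destruct (inv_INR_small d) as [N0 [HN0 Hlt]].
  exists N0. intros N HN. specialize (Hlt N HN).
  assert (HNp : (0 < N)%nat) by lia.
  pose (x := fun j k => h (INR j / INR N, INR k / INR N)).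
  assert (Hself : forall p, D p -> seg p p = 0).
  { intros p Hp. destruct (He p Hp) as [g Hgg].
    rewrite Hgg by apply ball_center. ring. }
  assert (Hside0 : forall j, (j <= N)%nat -> x j 0%nat = gamma 0 /\ x j N = gamma 0).
  { intros j Hj. unfold x. destruct (Hside (INR j / INR N)) as [S1 S2]; [now apply grid_in|].
    split.
    - simpl INR at 2. unfold Rdiv at 2. now rewrite Rmult_0_l.
    - unfold Rdiv at 2. rewrite Rinv_r; auto. apply not_0_INR; lia. }
  assert (Hp0 : D (gamma 0)) by (apply (proj2 Hg); lra).
  (* The total over the boundary of the strip between rows j and j + 1, up to column m, vanishes;
     the induction adds one cell at a time. *)
  assert (Hcell : forall j, (j < N)%nat -> forall m, (m <= N)%nat ->
    csum (x j) m + seg (x j m) (x (S j) m) =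
    seg (x j 0%nat) (x (S j) 0%nat) + csum (x (S j)) m).
  { intros j Hj. induction m as [|m IH]; intros Hm; [unfold csum; simpl; ring|].
    specialize (IH ltac:(lia)).
    destruct (Hd (INR j / INR N) (INR m / INR N)) as [p [Hp Hb]];
      [apply grid_in; lia|apply grid_in; lia|].
    destruct (He p Hp) as [g Hgg].
    assert (HB : forall j' m', (j' = j \/ j' = S j) -> (m' = m \/ m' = S m) ->
      ball p (e p) (x j' m')).
    { assert (Hs : forall i i', i' = i \/ i' = S i -> Rabs (INR i' / INR N - INR i / INR N) < d).
      { intros i i' [->| ->].
        - rewrite Rminus_diag, Rabs_R0. apply cond_pos.
        - rewrite grid_step by lia. rewrite Rabs_pos_eq; auto.
          left; apply Rinv_0_lt_compat. now apply lt_0_INR. }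
      intros j' m' Hj' Hm'. apply Hb; auto. }
    unfold csum in *; simpl.
    assert (E1 := Hgg (x j m) (x j (S m)) ltac:(apply HB; auto) ltac:(apply HB; auto)).
    assert (E2 := Hgg (x (S j) m) (x (S j) (S m)) ltac:(apply HB; auto) ltac:(apply HB; auto)).
    assert (E3 := Hgg (x j m) (x (S j) m) ltac:(apply HB; auto) ltac:(apply HB; auto)).
    assert (E4 := Hgg (x j (S m)) (x (S j) (S m)) ltac:(apply HB; auto) ltac:(apply HB; auto)).
    lra. }
  (* Both ends of the strip are edges at the base point, where [seg] is 0. *)
  assert (Hrow : forall j, (j <= N)%nat -> csum (x j) N = csum (x 0%nat) N).
  { induction j as [|j IH]; intros Hj; auto.
    rewrite <- IH by lia.
    assert (E := Hcell j ltac:(lia) N (le_n N)).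
    destruct (Hside0 (S j) ltac:(lia)) as [E1 E2].
    rewrite (proj1 (Hside0 j ltac:(lia))), (proj2 (Hside0 j ltac:(lia))), E1, E2,
      Hself in E by auto.
    lra. }
  transitivity (csum (x 0%nat) N).
  - apply csum_ext. intros k Hk. unfold x, grid.
    simpl INR at 3. unfold Rdiv at 2. rewrite Rmult_0_l.
    symmetry. apply H0. now apply grid_in.
  - rewrite <- (Hrow N (le_n N)).
    rewrite (csum_telescope (fun q => q = gamma 0) (fun _ => 0)).
    + ring.
    + intros a b -> ->. rewrite Hself; auto. ring.
    + intros k Hk. unfold x. unfold Rdiv at 1. rewrite Rinv_r by (apply not_0_INR; lia).
      apply H1. now apply grid_in.
Qed.

(** The primitive at p is the integral along a chosen path from p0 to p. For nearby a and b, the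
    path to a, the segment from a to b and the reversed path to b form a loop, whose integral is
    0. *)
Lemma cochain_primitive : exists f : C -> R, forall p, D p ->
  exists e : posreal, forall a b, ball p e a -> ball p e b -> seg a b = f b - f a.
Proof.
  destruct (proj1 HD) as [Hopen [[p0 Hp0] Hpath]].
  assert (H : forall p, exists V, D p -> exists gamma, path_in D gamma /\
    gamma 0 = p0 /\ gamma 1 = p /\ path_value gamma V).
  { intros p. destruct (classic (D p)) as [Hp|Hp]; [|now exists 0].
    destruct (Hpath p0 p Hp0 Hp) as [g [Hg [G0 G1]]].
    destruct (path_value_exists g Hg) as [V HV]. exists V. intros _. now exists g. }
  pose (f := fun p => proj1_sig (constructive_indefinite_description _ (H p))).
  assert (Hf : forall p, D p -> exists gamma, path_in D gamma /\
    gamma 0 = p0 /\ gamma 1 = p /\ path_value gamma (f p))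
    by (intros p; apply (proj2_sig (constructive_indefinite_description _ (H p)))).
  exists f. intros p Hp.
  destruct (Hopen p Hp) as [r Hr].
  assert (Hm : 0 < Rmin r (e p)) by (apply Rmin_pos; apply cond_pos).
  exists (mkposreal _ Hm). intros a b Ha Hb. simpl in Ha, Hb.
  assert (Ha1 : ball p r a) by (apply (ball_le _ _ _ (Rmin_l _ _) _ Ha)).
  assert (Hb1 : ball p r b) by (apply (ball_le _ _ _ (Rmin_l _ _) _ Hb)).
  assert (Ha2 : ball p (e p) a) by (apply (ball_le _ _ _ (Rmin_r _ _) _ Ha)).
  assert (Hb2 : ball p (e p) b) by (apply (ball_le _ _ _ (Rmin_r _ _) _ Hb)).
  destruct (Hf a (Hr a Ha1)) as (ga & [Gac GaD] & Ga0 & Ga1 & [Na HNa]).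
  destruct (Hf b (Hr b Hb1)) as (gb & [Gbc GbD] & Gb0 & Gb1 & [Nb HNb]).
  pose (line := fun t => (fst a + clamp t * (fst b - fst a),
                          snd a + clamp t * (snd b - snd a)) : C).
  assert (Hline : forall t, ball p (Rmin r (e p)) (line t)).
  { intros t. apply ball_segment; auto. apply clamp_in. }
  (* Three increments are added, each frozen by [clamp] outside its own third of the time;
     continuity of the concatenation is then that of a sum. *)
  pose (loop := fun t : R =>
    plus (plus (ga (clamp (3 * t))) (minus (line (3 * t - 1)) a))
         (minus (gb (1 - clamp (3 * t - 2))) b) : C).
  assert (L1 : forall t, t <= 1 / 3 -> loop t = ga (clamp (3 * t))).
  { intros t Ht. unfold loop, line. rewrite (clamp_0 (3 * t - 1)) by lra.
    rewrite (clamp_0 (3 * t - 2)), Rminus_0_r, Gb1 by lra.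
    apply injective_projections; simpl; ring. }
  assert (L2 : forall t, 1 / 3 <= t <= 2 / 3 -> loop t = line (3 * t - 1)).
  { intros t Ht. unfold loop, line. rewrite (clamp_1 (3 * t)) by lra.
    rewrite (clamp_0 (3 * t - 2)), Rminus_0_r, Gb1, Ga1 by lra.
    apply injective_projections; simpl; ring. }
  assert (L3 : forall t, 2 / 3 <= t -> loop t = gb (1 - clamp (3 * t - 2))).
  { intros t Ht. unfold loop, line. rewrite (clamp_1 (3 * t)), (clamp_1 (3 * t - 1)) by lra.
    rewrite Ga1. apply injective_projections; simpl; ring. }
  assert (Hloop : path_in D loop).
  { split.
    - intros t.
      assert (Hcl : forall c, continuous (fun t : R => clamp (3 * t - c)) t).
      { intros c. apply (continuous_comp (fun t : R => 3 * t + - c) clamp).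
        - apply continuous_affine.
        - apply continuous_clamp. }
      apply (continuous_plus (V:=C_R_NormedModule)); [apply (continuous_plus (V:=C_R_NormedModule))|].
      + apply (continuous_comp (fun t : R => clamp (3 * t)) ga); auto.
        eapply continuous_ext; [|apply (Hcl 0)]. intros; simpl. now rewrite Rminus_0_r.
      + apply (continuous_minus (V:=C_R_NormedModule)); [|apply continuous_const].
        assert (Hl : forall x y, continuous (fun t : R => x + clamp (3 * t - 1) * y) t).
        { intros x y. apply (continuous_plus (V:=R_NormedModule)); [apply continuous_const|].
          apply (continuous_mult (K:=R_AbsRing)); [apply Hcl|apply continuous_const]. }
        apply continuous_pair; apply Hl.
      + apply (continuous_minus (V:=C_R_NormedModule)); [|apply continuous_const].
        apply (continuous_comp (fun t : R => 1 - clamp (3 * t - 2)) gb); auto.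
        apply (continuous_minus (V:=R_NormedModule)); [apply continuous_const|apply Hcl].
    - intros t Ht. destruct (Rle_dec t (1 / 3)); [rewrite L1 by lra; apply GaD, clamp_in|].
      destruct (Rle_dec t (2 / 3)).
      + rewrite L2 by lra. apply Hr. apply (ball_le _ _ _ (Rmin_l r (e p)) _ (Hline _)).
      + rewrite L3 by lra. apply GbD. destruct (clamp_in (3 * t - 2)); lra. }
  assert (Hcl : loop 0 = loop 1).
  { rewrite L1, L3 by lra. rewrite clamp_0, clamp_1, Rminus_diag by lra. congruence. }
  destruct (path_value_loop loop Hloop Hcl) as [N1 HN1].
  (* The third leg runs backwards: consecutive grid points on [gb] must share a ball so that [seg]
     is antisymmetric on them. *)
  destruct (lebesgue_number_path D e gb (conj Gbc GbD)) as [d Hd].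
  destruct (inv_INR_small d) as [N2 [HN2 Hlt]].
  pose (N := (Na + Nb + N1 + N2)%nat).
  specialize (HNa N ltac:(lia)). specialize (HNb N ltac:(lia)).
  (* With 3N steps, each third of [loop] receives exactly the N-step grid of its own path. *)
  specialize (HN1 (N + N + N)%nat ltac:(lia)). specialize (Hlt N ltac:(lia)).
  rewrite !csum_add in HN1.
  assert (HNp : 0 < INR N) by (apply lt_0_INR; lia).
  rewrite (csum_ext _ (grid ga N) N) in HN1.
  2: { intros k Hk. unfold grid. rewrite !plus_INR. apply le_INR in Hk.
       assert (0 <= INR k) by apply pos_INR.
       assert (HT : INR k / (INR N + INR N + INR N) = 1 / 3 * (INR k / INR N)) by (field; lra).
       assert (HK : 0 <= INR k / INR N <= 1) by (apply grid_in; [now apply INR_le|now apply INR_lt]).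
       rewrite HT, L1 by lra. rewrite clamp_id by lra. f_equal. lra. }
  rewrite (csum_ext (fun k => grid loop _ (N + k)) (grid line N) N) in HN1.
  2: { intros k Hk. unfold grid. rewrite !plus_INR. apply le_INR in Hk.
       assert (0 <= INR k) by apply pos_INR.
       assert (HT : (INR N + INR k) / (INR N + INR N + INR N) = 1 / 3 + 1 / 3 * (INR k / INR N))
         by (field; lra).
       assert (HK : 0 <= INR k / INR N <= 1) by (apply grid_in; [now apply INR_le|now apply INR_lt]).
       rewrite HT, L2 by lra. f_equal. lra. }
  rewrite (csum_ext (fun k => grid loop _ (N + N + k)) (fun k => grid gb N (N - k)) N) in HN1.
  2: { intros k Hk. unfold grid. rewrite minus_INR by auto. rewrite !plus_INR. apply le_INR in Hk.
       assert (0 <= INR k) by apply pos_INR.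
       assert (HT : (INR N + INR N + INR k) / (INR N + INR N + INR N)
          = 2 / 3 + 1 / 3 * (INR k / INR N)) by (field; lra).
       assert (HK : 0 <= INR k / INR N <= 1) by (apply grid_in; [now apply INR_le|now apply INR_lt]).
       rewrite HT, L3 by lra. rewrite clamp_id by lra. f_equal. field. lra. }
  rewrite csum_rev in HN1.
  2: { intros k Hk. unfold grid.
       destruct (Hd (INR k / INR N)) as [q [Hq Hb']]; [apply grid_in; lia|].
       destruct (He q Hq) as [g Hg].
       rewrite !Hg; [ring| | | |]; apply Hb';
         try (rewrite Rminus_diag, Rabs_R0; apply cond_pos);
         rewrite grid_step by lia; rewrite Rabs_pos_eq; auto;
         left; now apply Rinv_0_lt_compat. }
  destruct (He p Hp) as [g Hg].
  rewrite (csum_telescope (ball p (e p)) g (grid line N)) in HN1.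
  2: { exact Hg. }
  2: { intros k Hk. apply (ball_le _ _ _ (Rmin_r r (e p)) _ (Hline _)). }
  rewrite (Hg a b Ha2 Hb2).
  assert (E1 : grid line N N = b).
  { unfold grid, line. unfold Rdiv. rewrite Rinv_r by lra. rewrite clamp_1 by lra.
    apply injective_projections; simpl; ring. }
  assert (E0 : grid line N 0 = a).
  { unfold grid, line. simpl INR. unfold Rdiv. rewrite Rmult_0_l. rewrite clamp_0 by lra.
    apply injective_projections; simpl; ring. }
  rewrite E1, E0 in HN1. lra.
Qed.

End Cochain.

(** * Closed 1-forms and holomorphic primitives *)

Lemma partials_differentiable (D : C -> Prop) f fu p : open D -> D p ->
  (forall q, D q -> is_du f q (fu q)) -> continuous fu p ->
  forall b, is_dv f p b ->
  differentiable_pt_lim (fun u v => f (u, v)) (fst p) (snd p) (fu p) b.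
Proof.
  intros HD Hp Hu Hc b Hv. apply filterdiff_differentiable_pt_lim.
  destruct p as [u0 v0].
  apply (is_derive_filterdiff (fun u v => f (u, v)) u0 v0 (fun u v => fu (u, v)) b).
  - apply (filter_imp D); [|now apply HD]. intros [u v] Hq. exact (Hu _ Hq).
  - exact Hv.
  - eapply continuous_ext; [|exact Hc]. now intros [u v].
Qed.

Lemma partials_continuous (D : C -> Prop) f fu fv p : open D -> D p ->
  (forall q, D q -> is_du f q (fu q)) -> continuous fu p ->
  is_dv f p (fv p) -> continuous f p.
Proof.
  intros HD Hp Hu Hc Hv. apply continuous_2d.
  apply differentiable_continuity_pt. exists (fu p), (fv p).
  now apply (partials_differentiable D).
Qed.

Lemma smooth_of_partials (D : C -> Prop) f fu fv : open D -> smooth D fu -> smooth D fv ->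
  (forall p, D p -> is_du f p (fu p) /\ is_dv f p (fv p)) -> smooth D f.
Proof.
  intros HD Hu Hv H.
  assert (Hc : forall p, D p -> continuous f p).
  { intros p Hp. apply (partials_continuous D f fu fv); auto.
    - intros; now apply H.
    - now apply (smooth_cont D).
    - now apply H. }
  intros [|k]; [now split|]. apply (Ck_intro k D f fu fv); auto.
Qed.

Lemma ball_interval (x r a b z : R) : Rabs (a - x) < r -> Rabs (b - x) < r ->
  Rmin a b <= z <= Rmax a b -> Rabs (z - x) < r.
Proof.
  intros Ha Hb Hz. apply Rabs_def2 in Ha. apply Rabs_def2 in Hb.
  unfold Rmin, Rmax in Hz. apply Rabs_def1; destruct (Rle_dec a b); lra.
Qed.

Lemma continuous_slice_u f u v : continuous f ((u, v) : C) ->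
  continuous (fun u => f (u, v) : R) u.
Proof.
  intros H. apply (continuous_comp (fun u => (u, v) : C) f); auto.
  apply continuous_pair; [apply continuous_id|apply continuous_const].
Qed.
Lemma continuous_slice_v f u v : continuous f ((u, v) : C) ->
  continuous (fun v => f (u, v) : R) v.
Proof.
  intros H. apply (continuous_comp (fun v => (u, v) : C) f); auto.
  apply continuous_pair; [apply continuous_const|apply continuous_id].
Qed.

Section ClosedForm.

Variables (D : C -> Prop) (alpha beta : C -> R).
Hypotheses (HD : open D) (Ha : smooth D alpha) (Hb : smooth D beta)
  (Hcl : forall p, D p -> dv alpha p = du beta p).

(** The integral of alpha du + beta dv along the L-shaped path from a to b, horizontal leg first.
    Balls of C are squares here, so a ball containing a and b contains both legs. *)
Definition form_seg (a b : C) : R :=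
  RInt (fun s => alpha (s, snd a)) (fst a) (fst b) +
  RInt (fun t => beta (fst b, t)) (snd a) (snd b).

Lemma form_seg_primitive (p : C) (r : R) g : (forall q, ball p r q -> D q) ->
  (forall q, ball p r q -> is_du g q (alpha q) /\ is_dv g q (beta q)) ->
  forall a b, ball p r a -> ball p r b -> form_seg a b = g b - g a.
Proof.
  intros HrD Hg [a1 a2] [b1 b2] [A1 A2] [B1 B2]. unfold form_seg. simpl in *.
  assert (Q1 : forall x, Rmin a1 b1 <= x <= Rmax a1 b1 -> ball p r ((x, a2) : C)).
  { intros x Hx. split; simpl; auto. now apply (ball_interval _ _ a1 b1). }
  assert (Q2 : forall x, Rmin a2 b2 <= x <= Rmax a2 b2 -> ball p r ((b1, x) : C)).
  { intros x Hx. split; simpl; auto. now apply (ball_interval _ _ a2 b2). }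
  rewrite (is_RInt_unique (fun s => alpha (s, a2)) a1 b1 (g (b1, a2) - g (a1, a2))).
  rewrite (is_RInt_unique (fun t => beta (b1, t)) a2 b2 (g (b1, b2) - g (b1, a2))).
  - ring.
  - apply (is_RInt_derive (fun t => g (b1, t))).
    + intros x Hx. apply (Hg (b1, x)). auto.
    + intros x Hx. apply continuous_slice_v, (smooth_cont D); auto.
  - apply (is_RInt_derive (fun s => g (s, a2))).
    + intros x Hx. apply (Hg (x, a2)). auto.
    + intros x Hx. apply continuous_slice_u, (smooth_cont D); auto.
Qed.

(** The Poincare lemma on a square. The v-partial is the fundamental theorem of calculus. For the
    u-partial, differentiate under the integral; closedness turns the integrand into alpha_v, and
    the values of alpha at the corner cancel. *)
Lemma form_local_primitive (p : C) (r : posreal) : (forall q, ball p r q -> D q) ->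
  forall q, ball p r q ->
    is_du (form_seg p) q (alpha q) /\ is_dv (form_seg p) q (beta q).
Proof.
  intros HrD [u v] Hq. destruct p as [u0 v0].
  assert (HoB : forall q, ball (u0, v0) r q -> locally q (fun q => ball ((u0, v0) : C) r q)).
  { intros [a b] [A B]. simpl in A, B. apply Rabs_def2 in A. apply Rabs_def2 in B.
    unfold minus, plus, opp in A, B; simpl in A, B.
    assert (Hm : 0 < Rmin (Rmin (r - (a - u0)) (r + (a - u0)))
                          (Rmin (r - (b - v0)) (r + (b - v0)))).
    { repeat apply Rmin_pos; lra. }
    exists (mkposreal _ Hm). intros [c d] [E F]. simpl in E, F.
    apply Rabs_def2 in E. apply Rabs_def2 in F.
    unfold minus, plus, opp in E, F; simpl in E, F.
    revert E F. unfold Rmin.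
    split; apply Rabs_def1; unfold minus, plus, opp; simpl;
    repeat destruct (Rle_dec _ _) in *; lra. }
  assert (Q1 : forall u v, ball (u0, v0) r ((u, v) : C) ->
     forall x, Rmin u0 u <= x <= Rmax u0 u -> ball (u0, v0) r ((x, v0) : C)).
  { intros a b [A B] x Hx. split; simpl; [|apply ball_center].
    apply (ball_interval _ _ u0 a); auto. rewrite Rminus_diag, Rabs_R0; apply cond_pos. }
  assert (Q2 : forall u v, ball (u0, v0) r ((u, v) : C) ->
     forall x, Rmin v0 v <= x <= Rmax v0 v -> ball (u0, v0) r ((u, x) : C)).
  { intros a b [A B] x Hx. split; simpl; auto.
    apply (ball_interval _ _ v0 b); auto. rewrite Rminus_diag, Rabs_R0; apply cond_pos. }
  assert (HoU : locally u (fun u => ball (u0, v0) r ((u, v) : C))).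
  { apply (open_slice_u (fun q => ball (u0, v0) r q) (u, v)); auto. }
  assert (HoV : locally v (fun v => ball (u0, v0) r ((u, v) : C))).
  { apply (open_slice_v (fun q => ball (u0, v0) r q) (u, v)); auto. }
  unfold is_du, is_dv, form_seg; simpl. split.
  - assert (F1 : is_derive (fun x => RInt (fun s => alpha (s, v0)) u0 x) u (alpha (u, v0))).
    { apply (is_derive_RInt (V:=R_NormedModule) (fun s => alpha (s, v0)) _ u0).
      - eapply filter_imp; [|exact HoU]. intros x Hx. apply (RInt_correct (V:=R_CompleteNormedModule)).
        apply (ex_RInt_continuous (V:=R_CompleteNormedModule)).
        intros z Hz. apply continuous_slice_u, (smooth_cont D); auto. apply HrD.
        now apply (Q1 x v).
      - apply continuous_slice_u, (smooth_cont D); auto. apply HrD.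
        apply (Q1 u v); auto. split; [apply Rmin_r|apply Rmax_r]. }
    assert (F2 : is_derive (fun x => RInt (fun t => beta (x, t)) v0 v) u
       (RInt (fun t => Derive (fun x => beta (x, t)) u) v0 v)).
    { apply is_derive_RInt_param.
      - eapply filter_imp; [|exact HoU]. intros x Hx t Ht.
        exists (du beta (x, t)). apply (smooth_is_du D beta (x, t)); auto. apply HrD.
        now apply (Q2 x v).
      - intros t Ht. apply (continuous_2d (du beta) (u, t)).
        apply (smooth_cont D); [now apply smooth_du|]. apply HrD. now apply (Q2 u v).
      - eapply filter_imp; [|exact HoU]. intros x Hx.
        apply (ex_RInt_continuous (V:=R_CompleteNormedModule)).
        intros z Hz. apply continuous_slice_v, (smooth_cont D); auto. apply HrD.
        now apply (Q2 x v). }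
    assert (F3 : RInt (fun t => Derive (fun x => beta (x, t)) u) v0 v
       = alpha (u, v) - alpha (u, v0)).
    { apply is_RInt_unique.
      apply (is_RInt_ext (fun t => dv alpha (u, t))).
      - intros t Ht. apply (Hcl (u, t)). apply HrD. apply (Q2 u v); auto. lra.
      - apply (is_RInt_derive (fun t => alpha (u, t))).
        + intros x Hx. apply (smooth_is_dv D alpha (u, x)); auto. apply HrD.
          now apply (Q2 u v).
        + intros x Hx. apply continuous_slice_v, (smooth_cont D); [now apply smooth_dv|].
          apply HrD. now apply (Q2 u v). }
    rewrite F3 in F2.
    eapply is_derive_Req; [exact (is_derive_plus (V:=R_NormedModule) _ _ _ _ _ F1 F2)|].
    unfold plus; simpl. ring.
  - assert (F2 : is_derive (fun x => RInt (fun t => beta (u, t)) v0 x) v (beta (u, v))).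
    { apply (is_derive_RInt (V:=R_NormedModule) (fun t => beta (u, t)) _ v0).
      - eapply filter_imp; [|exact HoV]. intros x Hx. apply (RInt_correct (V:=R_CompleteNormedModule)).
        apply (ex_RInt_continuous (V:=R_CompleteNormedModule)).
        intros z Hz. apply continuous_slice_v, (smooth_cont D); auto. apply HrD.
        now apply (Q2 u x).
      - apply continuous_slice_v, (smooth_cont D); auto. }
    eapply is_derive_Req; [refine (is_derive_plus (V:=R_NormedModule) _ _ _ _ _ _ F2);
      exact (is_derive_const (V:=R_NormedModule) _ _)|].
    unfold plus, zero; simpl. ring.
Qed.

(** The global primitive of the cochain [form_seg] differs near p from the local one based at p by a
    constant, and so has the same partials. *)
Lemma closed_form_primitive : simply_connected_domain D ->
  exists f, smooth D f /\ forall p, D p -> is_du f p (alpha p) /\ is_dv f p (beta p).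
Proof.
  intros Hsc.
  assert (Hle : locally_exact D form_seg).
  { intros p Hp. destruct (HD p Hp) as [r Hr]. exists r, (form_seg p).
    apply form_seg_primitive; auto. now apply form_local_primitive. }
  destruct (cochain_primitive D form_seg Hle Hsc) as [f Hf].
  assert (Hd : forall p, D p -> is_du f p (alpha p) /\ is_dv f p (beta p)).
  { intros p Hp. destruct (HD p Hp) as [r Hr]. destruct (Hf p Hp) as [e He].
    destruct (form_local_primitive p r Hr p (ball_center p r)) as [Q1 Q2].
    assert (E : forall q, ball p e q -> f q = f p + form_seg p q).
    { intros q Hq. rewrite (He p q); auto; [ring|apply ball_center]. }
    split.
    - apply (is_derive_ext_loc (fun u => f p + form_seg p (u, snd p))).
      + exists e. intros u Hu. symmetry. apply E. split; [exact Hu|apply ball_center].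
      + eapply is_derive_Req; [refine (is_derive_plus (V:=R_NormedModule) _ _ _ _ _ _ Q1);
        exact (is_derive_const (V:=R_NormedModule) _ _)|]. unfold plus, zero; simpl. ring.
    - apply (is_derive_ext_loc (fun v => f p + form_seg p (fst p, v))).
      + exists e. intros u Hu. symmetry. apply E. split; [apply ball_center|exact Hu].
      + eapply is_derive_Req; [refine (is_derive_plus (V:=R_NormedModule) _ _ _ _ _ _ Q2);
        exact (is_derive_const (V:=R_NormedModule) _ _)|]. unfold plus, zero; simpl. ring. }
  exists f; split; auto. now apply (smooth_of_partials D f alpha beta).
Qed.

End ClosedForm.

(** [form_seg_primitive] for the zero form gives constancy on balls, and paths spread it. *)
Lemma zero_partials_const (D : C -> Prop) f : plane_domain D ->
  (forall p, D p -> is_du f p 0 /\ is_dv f p 0) -> forall a b, D a -> D b -> f a = f b.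
Proof.
  intros HD H a b Ha Hb. symmetry.
  apply (path_connected_ind D (fun q => f q = f a) HD) with (a := a); auto.
  intros p Hp. destruct (proj1 HD p Hp) as [r Hr]. exists r. intros x y Hx Hy <-.
  assert (E := form_seg_primitive D (fun _ => 0) (fun _ => 0)
    (smooth_const _ _ (proj1 HD)) (smooth_const _ _ (proj1 HD)) p r f Hr
    (fun q Hq => H q (Hr q Hq)) x y Hx Hy).
  unfold form_seg in E. rewrite !RInt_const in E. unfold scal in E; simpl in E.
  unfold mult in E; simpl in E. lra.
Qed.

Lemma hd_zero_const (D : C -> Prop) f : plane_domain D ->
  (forall p, D p -> is_hd f p 0%C) -> exists c, forall p, D p -> f p = c.
Proof.
  intros HD H. destruct (proj1 (proj2 HD)) as [p0 Hp0]. exists (f p0). intros p Hp.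
  apply injective_projections.
  - apply (zero_partials_const D (fun q => fst (f q))); auto.
    intros q Hq. destruct (H q Hq) as [[H1 H2] [H3 H4]]. split; [exact H1|].
    eapply is_derive_Req; [exact H3|]. simpl; ring.
  - apply (zero_partials_const D (fun q => snd (f q))); auto.
    intros q Hq. destruct (H q Hq) as [[H1 H2] [H3 H4]]. split; [exact H2|].
    eapply is_derive_Req; [exact H4|]. simpl; ring.
Qed.

Lemma hd_same_const (D : C -> Prop) f g f' : plane_domain D ->
  (forall p, D p -> is_hd f p (f' p)) -> (forall p, D p -> is_hd g p (f' p)) ->
  exists c, forall p, D p -> f p = (g p + c)%C.
Proof.
  intros HD Hf Hg.
  destruct (hd_zero_const D (fun p => f p + (- (1)) * g p)%C HD) as [c Hc].
  - intros p Hp. eapply is_hd_eq; [apply is_hd_plus;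
      [exact (Hf p Hp)|exact (is_hd_scal _ _ _ _ (Hg p Hp))]|]. ring.
  - exists c. intros p Hp. rewrite <- (Hc p Hp). ring.
Qed.

(** The harmonic conjugate is a primitive of - l_v du + l_u dv, which is closed because l is
    harmonic. *)
Lemma harmonic_hol D l : simply_connected_domain D -> smooth D l ->
  (forall p, D p -> du (du l) p + dv (dv l) p = 0) ->
  exists F, hol D F /\ forall p, fst (F p) = l p.
Proof.
  intros Hsc Hl Hlap. assert (HD := proj1 (proj1 Hsc)).
  destruct (closed_form_primitive D (fun p => - dv l p) (du l)) as [m [Hm Hp]]; auto.
  - apply smooth_opp; auto. now apply smooth_dv.
  - now apply smooth_du.
  - intros p Hp. specialize (Hlap p Hp). unfold dv at 1. rewrite Derive_opp.
    change (Derive (fun v => dv l (fst p, v)) (snd p)) with (dv (dv l) p). lra.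
  - exists (fun p => (l p, m p)). split; [|reflexivity].
    apply hol_cr; [now split|]. intros p Hq. destruct (Hp p Hq) as [E1 E2].
    simpl. change (fun q => l q) with l. change (fun q => m q) with m.
    rewrite (is_du_unique _ _ _ E1), (is_dv_unique _ _ _ E2). split; [symmetry; apply Ropp_involutive|reflexivity].
Qed.

(** The real and imaginary parts of f dz are closed by the Cauchy-Riemann equations. *)
Lemma hol_primitive D f : simply_connected_domain D -> hol D f ->
  exists F, hol D F /\ forall p, D p -> is_hd F p (f p).
Proof.
  intros Hsc Hf. assert (HD := proj1 (proj1 Hsc)).
  destruct (proj1 Hf) as [S1 S2].
  destruct (closed_form_primitive D (fun p => fst (f p)) (fun p => - snd (f p)))
    as [A [HA PA]]; auto.
  - now apply smooth_opp.
  - intros p Hp. rewrite (proj1 (hol_dv D f p Hf Hp)). unfold du at 1.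
    now rewrite Derive_opp.
  - destruct (closed_form_primitive D (fun p => snd (f p)) (fun p => fst (f p)))
      as [B [HB PB]]; auto.
    + intros p Hp. now rewrite (proj2 (hol_dv D f p Hf Hp)).
    + assert (H : forall p, D p -> is_hd (fun p => (A p, B p)) p (f p)).
      { intros p Hp. destruct (PA p Hp) as [A1 A2]. destruct (PB p Hp) as [B1 B2].
        split; split; auto.
        - eapply is_derive_Req; [exact A2|]. simpl; ring.
        - eapply is_derive_Req; [exact B2|]. simpl; ring. }
      exists (fun p => (A p, B p)). split; auto.
      apply (hol_intro D _ f); auto. now split.
Qed.

(** * The complex exponential, square roots and holomorphic logarithms *)

Lemma cexp_plus a b : cexp (a + b)%C = (cexp a * cexp b)%C.
Proof.
  unfold cexp. simpl. rewrite exp_plus, cos_plus, sin_plus.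
  apply injective_projections; simpl; ring.
Qed.
Lemma cexp_0 : cexp 0%C = 1%C.
Proof. unfold cexp. simpl. rewrite exp_0, cos_0, sin_0. apply injective_projections; simpl; ring. Qed.
Lemma cexp_opp_r a : (cexp a * cexp (- a) = 1)%C.
Proof. rewrite <- cexp_plus. replace (a + - a)%C with (RtoC 0) by ring. apply cexp_0. Qed.
Lemma cexp_neq_0 a : cexp a <> 0%C.
Proof.
  intros H. assert (E := cexp_opp_r a). rewrite H, Cmult_0_l in E.
  injection E. lra.
Qed.
Lemma cexp_opp a : (cexp (- a) = / cexp a)%C.
Proof.
  assert (H := cexp_neq_0 a). assert (E := cexp_opp_r a).
  transitivity ((cexp a * cexp (- a)) / cexp a)%C; [field; auto|]. rewrite E. field; auto.
Qed.

Lemma unit_circle_angle x y : x * x + y * y = 1 -> exists t, cos t = x /\ sin t = y.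
Proof.
  intros H. assert (Hx : -1 <= x <= 1) by nra.
  assert (Hs : sqrt (1 - x²) = Rabs y).
  { rewrite <- sqrt_Rsqr_abs. f_equal. unfold Rsqr. lra. }
  destruct (Rle_dec 0 y) as [Hy|Hy].
  - exists (acos x). split; [now apply cos_acos|]. rewrite sin_acos by auto.
    rewrite Hs. now apply Rabs_pos_eq.
  - exists (- acos x). rewrite cos_neg, sin_neg. split; [now apply cos_acos|].
    rewrite sin_acos by auto. rewrite Hs, Rabs_left by lra. ring.
Qed.

Lemma cexp_surj (z : C) : z <> 0%C -> exists a : C, cexp a = z.
Proof.
  intros Hz. assert (Hn := C_norm2_pos z Hz). destruct z as [x y]; simpl in Hn.
  pose (r := sqrt (x * x + y * y)).
  assert (Hr : 0 < r) by now apply sqrt_lt_R0.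
  assert (Hr2 : r * r = x * x + y * y) by (apply sqrt_sqrt; lra).
  destruct (unit_circle_angle (x / r) (y / r)) as [t [Hc Hs]].
  - replace (x / r * (x / r) + y / r * (y / r)) with ((x * x + y * y) / (r * r)) by (field; lra).
    rewrite Hr2. field. lra.
  - exists (ln r, t). unfold cexp; simpl. rewrite exp_ln, Hc, Hs by auto.
    f_equal; field; lra.
Qed.

Lemma csqrt_exists (z : C) : exists s : C, (s * s = z)%C.
Proof.
  destruct (classic (z = 0%C)) as [->|Hz]; [exists 0%C; ring|].
  destruct (cexp_surj z Hz) as [a <-]. exists (cexp (a / 2)%C).
  rewrite <- cexp_plus. f_equal. field.
Qed.

(** For a primitive L0 of g'/g, the product g e^(- L0) is a nonzero constant; a logarithm of that
    constant corrects L0. *)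
Lemma hol_log D g : simply_connected_domain D -> hol D g -> (forall p, D p -> g p <> 0%C) ->
  exists L, hol D L /\ forall p, D p -> g p = cexp (L p).
Proof.
  intros Hsc Hg Hn. assert (HP := proj1 Hsc). assert (HD := proj1 HP).
  destruct (hol_primitive D (fun p => cd g p / g p)%C Hsc) as [L0 [HL0 HL0']].
  { apply hol_div; auto. now apply hol_cd. }
  destruct (hd_zero_const D (fun p => g p * cexp (- (1) * L0 p))%C HP) as [c Hc].
  { intros p Hp. eapply is_hd_eq.
    - apply is_hd_mult; [now apply (hol_hd D)|].
      apply is_hd_exp. apply is_hd_scal. apply HL0'; auto.
    - cbv beta. field. now apply Hn. }
  destruct (proj1 (proj2 HP)) as [p0 Hp0].
  destruct (cexp_surj c) as [k Hk].
  { rewrite <- (Hc p0 Hp0). apply Cmult_neq_0; [now apply Hn|apply cexp_neq_0]. }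
  exists (fun p => L0 p + k)%C. split.
  - apply hol_plus; auto. now apply hol_const.
  - intros p Hp. rewrite cexp_plus, Hk, <- (Hc p Hp).
    replace (- (1) * L0 p)%C with (- L0 p)%C by ring. rewrite cexp_opp.
    field. apply cexp_neq_0.
Qed.

(** * The surfaces (Re F, Re W, eps Im W) *)

Lemma is_hd_partials f p c : is_hd f p c ->
  is_du (fun q => fst (f q)) p (fst c) /\ is_du (fun q => snd (f q)) p (snd c) /\
  is_dv (fun q => fst (f q)) p (fst (Ci * c)%C) /\ is_dv (fun q => snd (f q)) p (snd (Ci * c)%C).
Proof. intros [[H1 H2] [H3 H4]]. auto. Qed.

(* The point with l = Re F and x + i eps y = W. *)
Definition pt (eps : R) (W F : C) : I3 := (fst F, fst W, eps * snd W).

Definition surf (eps : R) (W F : C -> C) : C -> I3 := fun q => pt eps (W q) (F q).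

Lemma Xu_surf eps W F p W1 F1 : is_hd W p W1 -> is_hd F p F1 ->
  Xu (surf eps W F) p = pt eps W1 F1.
Proof.
  intros HW HF. destruct (is_hd_partials _ _ _ HW) as (W2 & W3 & _).
  destruct (is_hd_partials _ _ _ HF) as (F2 & _).
  unfold Xu, pt. f_equal; [f_equal|]; apply is_du_unique; auto.
  now apply (is_derive_scal (fun u => snd (W (u, snd p)))).
Qed.
Lemma Xv_surf eps W F p W1 F1 : is_hd W p W1 -> is_hd F p F1 ->
  Xv (surf eps W F) p = pt eps (Ci * W1)%C (Ci * F1)%C.
Proof.
  intros HW HF. destruct (is_hd_partials _ _ _ HW) as (_ & _ & W2 & W3).
  destruct (is_hd_partials _ _ _ HF) as (_ & _ & F2 & _).
  unfold Xv, pt. f_equal; [f_equal|]; apply is_dv_unique; auto.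
  now apply (is_derive_scal (fun v => snd (W (fst p, v)))).
Qed.

Lemma Xu_ext (U : C -> Prop) X Y p : open U -> U p -> (forall q, U q -> X q = Y q) ->
  Xu X p = Xu Y p.
Proof.
  intros HU Hp E. unfold Xu. f_equal; [f_equal|]; apply (du_ext U); auto;
    intros q Hq; now rewrite E.
Qed.
Lemma Xv_ext (U : C -> Prop) X Y p : open U -> U p -> (forall q, U q -> X q = Y q) ->
  Xv X p = Xv Y p.
Proof.
  intros HU Hp E. unfold Xv. f_equal; [f_equal|]; apply (dv_ext U); auto;
    intros q Hq; now rewrite E.
Qed.

Lemma surf_second eps (U : C -> Prop) W F W1 F1 p W2 F2 : open U -> U p ->
  (forall q, U q -> is_hd W q (W1 q)) -> (forall q, U q -> is_hd F q (F1 q)) ->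
  is_hd W1 p W2 -> is_hd F1 p F2 ->
  Xuu (surf eps W F) p = pt eps W2 F2 /\
  Xuv (surf eps W F) p = pt eps (Ci * W2)%C (Ci * F2)%C /\
  Xvv (surf eps W F) p = pt eps (- W2)%C (- F2)%C.
Proof.
  intros HU Hp HW HF HW2 HF2. unfold Xuu, Xuv, Xvv.
  assert (E1 : forall q, U q -> Xu (surf eps W F) q = surf eps W1 F1 q)
    by (intros; now apply Xu_surf; auto).
  assert (E2 : forall q, U q -> Xv (surf eps W F) q =
    surf eps (fun q => Ci * W1 q)%C (fun q => Ci * F1 q)%C q)
    by (intros; now apply Xv_surf; auto).
  rewrite (Xu_ext U _ _ p HU Hp E1), (Xv_ext U _ _ p HU Hp E1), (Xv_ext U _ _ p HU Hp E2).
  rewrite (Xu_surf eps W1 F1 p W2 F2), (Xv_surf eps W1 F1 p W2 F2) by auto.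
  rewrite (Xv_surf eps _ _ p (Ci * W2)%C (Ci * F2)%C) by now apply is_hd_scal.
  split; [reflexivity|split; [reflexivity|]].
  f_equal; apply injective_projections; simpl; ring.
Qed.

Lemma I3_comb (a b : R) (Y Z : I3) : plus (scal a Y) (scal b Z) =
  (a * cl Y + b * cl Z, a * cx Y + b * cx Z, a * cy Y + b * cy Z).
Proof. reflexivity. Qed.

(** The (x, y) part of the differential is multiplication by [W1], followed by a reflection when eps
    = -1. If [W1] is 0, both partials lie on the l-axis and are dependent. *)
Lemma surf_immersed eps W F p W1 F1 : eps * eps = 1 -> is_hd W p W1 -> is_hd F p F1 ->
  (immersed_at (surf eps W F) p <-> W1 <> 0%C).
Proof.
  intros He HW HF. unfold immersed_at.
  rewrite (Xu_surf eps W F p W1 F1), (Xv_surf eps W F p W1 F1) by auto.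
  destruct W1 as [w1 w2], F1 as [f1 f2]. split.
  - intros H E. injection E as -> ->.
    assert (E2 : forall a b, a * f1 + b * - f2 = 0 -> a = 0 /\ b = 0).
    { intros a b E. apply H. rewrite I3_comb. unfold pt, cl, cx, cy; simpl.
      repeat apply injective_projections; simpl; lra. }
    (* (f2, f1) is always a relation, which forces f1 = f2 = 0; but then (1, 1) is a relation
       too. *)
    destruct (E2 f2 f1) as [G1 G2]; [ring|].
    destruct (E2 1 1) as [G3 G4]; lra.
  - intros Hn a b E. apply C_norm2_pos in Hn. simpl in Hn.
    rewrite I3_comb in E. unfold pt, cl, cx, cy in E; simpl in E. injection E as E1 E2 E3.
    assert (E3' : a * w2 + b * w1 = 0).
    { replace (a * w2 + b * w1) with
        (eps * (a * (eps * w2) + b * (eps * (0 * w2 + 1 * w1)))) by (ring [He]).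
      rewrite E3. ring. }
    assert (E2' : a * w1 - b * w2 = 0) by lra.
    assert (Ea : a * (w1 * w1 + w2 * w2) = 0).
    { transitivity (w1 * (a * w1 - b * w2) + w2 * (a * w2 + b * w1)); [ring|].
      rewrite E2', E3'. ring. }
    assert (Eb : b * (w1 * w1 + w2 * w2) = 0).
    { transitivity (w1 * (a * w2 + b * w1) - w2 * (a * w1 - b * w2)); [ring|].
      rewrite E2', E3'. ring. }
    split; [apply Rmult_integral in Ea; lra|apply Rmult_integral in Eb; lra].
Qed.

Lemma surf_zmc eps (U : C -> Prop) W F p : eps * eps = 1 -> open U -> hol U W -> hol U F -> U p ->
  immersed_at (surf eps W F) p ->
  spacelike_conformal_at (surf eps W F) p /\ zmc_at (surf eps W F) p.
Proof.
  intros He HU HW HF Hp Him.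
  assert (HW1 := hol_hd _ _ _ HW Hp). assert (HF1 := hol_hd _ _ _ HF Hp).
  apply (surf_immersed eps W F p _ _ He HW1 HF1) in Him.
  apply C_norm2_pos in Him.
  assert (EU := Xu_surf eps W F p _ _ HW1 HF1).
  assert (EV := Xv_surf eps W F p _ _ HW1 HF1).
  destruct (surf_second eps U W F (cd W) (cd F) p (cd (cd W) p) (cd (cd F) p) HU Hp)
    as (Euu & _ & Evv); try (intros; apply (hol_hd U); auto; now apply hol_cd).
  assert (He' : forall x y, eps * x * (eps * y) = x * y)
    by (intros; transitivity (eps * eps * (x * y)); [ring|rewrite He; ring]).
  split.
  - unfold spacelike_conformal_at, metric_uu, metric_uv, metric_vv.
    rewrite EU, EV. destruct (cd W p) as [w1 w2], (cd F p) as [f1 f2].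
    simpl in Him. unfold emb, mink, pt, cl, cx, cy. simpl.
    rewrite !He'. split; [lra|split; ring].
  - unfold zmc_at, gauss_map_at, mean_curvature. rewrite EU, EV, Euu, Evv.
    destruct (cd W p) as [w1 w2], (cd F p) as [f1 f2]. simpl in Him.
    (* With n3 = n0 + 1, the tangency equations are solved by n1 = - Re (F'/W') and n2 = eps Im
       (F'/W'), and lightlikeness determines n0. The mean curvature vanishes because [Xuu] and [Xvv]
       are opposite. *)
    pose (N := w1 * w1 + w2 * w2).
    pose (n1 := - (f1 * w1 + f2 * w2) / N).
    pose (n2 := eps * (w1 * f2 - w2 * f1) / N).
    pose (n0 := - (1 + n1 * n1 + n2 * n2) / 2).
    exists (n0, n1, n2, 1 + n0). unfold lightlike, emb, mink, pt, cl, cx, cy, pvec; simpl.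
    assert (Hn2 : forall x, eps * x * n2 = x * ((w1 * f2 - w2 * f1) / N)).
    { intros x. unfold n2.
      transitivity (eps * eps * (x * ((w1 * f2 - w2 * f1) / N)));
        [unfold Rdiv; ring|rewrite He; ring]. }
    rewrite !Hn2. repeat split.
    + unfold n0. field.
    + unfold n1, N. field. lra.
    + unfold n1, N. field. lra.
    + ring.
    + ring.
Qed.

(** * Affine normal and shape operator *)

Definition nrm2 (z : C) : R := fst z * fst z + snd z * snd z.

Lemma nrm2_mult a b : nrm2 (a * b)%C = nrm2 a * nrm2 b.
Proof. unfold nrm2; simpl. ring. Qed.
Lemma nrm2_conj z : RtoC (nrm2 z) = (z * Cconj z)%C.
Proof. apply injective_projections; unfold nrm2; simpl; ring. Qed.

(* [r] is dF/dW; the tangential part of the second derivatives drops out. *)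
Lemma det3_surf eps w r w2 c :
  det3 (pt eps w (w * r)%C) (pt eps (Ci * w)%C (Ci * (w * r))%C) (pt eps w2 (w2 * r + c)%C)
  = eps * nrm2 w * fst c.
Proof. unfold nrm2; simpl. ring. Qed.

Lemma Rpower_quarter m : 0 < m -> Rpower (m ^ 4) (- / 4) = / m.
Proof.
  intros Hm. rewrite <- Rpower_pow by auto. rewrite Rpower_mult.
  replace (INR 4 * - / 4) with (- (1)) by (simpl; field).
  rewrite Rpower_Ropp, Rpower_1; auto.
Qed.

Lemma conj_neq_0 (z : C) : z <> 0%C -> Cconj z <> 0%C.
Proof.
  intros Hz E. apply C_norm2_pos in Hz. destruct z as [x y]. injection E as E1 E2.
  simpl in Hz. nra.
Qed.

Lemma fst_div_nrm2 (z w : C) : w <> 0%C -> fst (z * (/ w * / Cconj w))%C = fst z / nrm2 w.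
Proof.
  intros Hw. assert (H := C_norm2_pos w Hw).
  destruct z, w; unfold nrm2; simpl in *. field.
  repeat split; nra.
Qed.

Lemma snd_div_nrm2 (z w : C) : w <> 0%C -> snd (z * (/ w * / Cconj w))%C = snd z / nrm2 w.
Proof.
  intros Hw. assert (H := C_norm2_pos w Hw).
  destruct z, w; unfold nrm2; simpl in *. field.
  repeat split; nra.
Qed.

Lemma I3_opp (a b c : R) : opp ((a, b, c) : I3) = (- a, - b, - c).
Proof. reflexivity. Qed.

Lemma pt_comb eps (s w A : C) :
  opp (plus (scal (fst s) (pt eps w A)) (scal (snd s) (pt eps (Ci * w)%C (Ci * A)%C)))
  = pt eps (- (s * w))%C (- (s * A))%C.
Proof.
  rewrite I3_comb, I3_opp. unfold cl, cx, cy, pt; simpl.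
  repeat apply injective_projections; simpl; ring.
Qed.

Lemma pt_inj eps (w A w' A' : C) : eps * eps = 1 -> pt eps w A = pt eps w' A' -> w = w'.
Proof.
  intros He E. unfold pt in E. injection E as _ E1 E2.
  apply injective_projections; auto.
  transitivity (eps * eps * snd w); [rewrite He; ring|].
  transitivity (eps * eps * snd w'); [|rewrite He; ring].
  rewrite !Rmult_assoc. now rewrite E2.
Qed.

(* [p], [p2] are the derivatives of [P], [P2] with respect to the coordinate zeta
   with [d zeta = b dz], and [k] is [P_zeta_zeta / P]. *)
Section Affine.

Variables (U : C -> Prop) (eps : R) (W F b b1 P p P2 p2 k : C -> C).
Hypotheses (HU : open U) (Heps : eps * eps = 1)
  (HW : forall q, U q -> is_hd W q (b q * (P q * P q))%C)
  (HF : forall q, U q -> is_hd F q (b q * (P q * P2 q))%C)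
  (Hb : forall q, U q -> is_hd b q (b1 q))
  (HP : forall q, U q -> is_hd P q (b q * p q)%C)
  (Hp : forall q, U q -> is_hd p q (b q * (k q * P q))%C)
  (HP2 : forall q, U q -> is_hd P2 q (b q * p2 q)%C)
  (Hwr : forall q, U q -> (P q * p2 q - p q * P2 q = 1)%C)
  (Hb0 : forall q, U q -> b q <> 0%C) (HP0 : forall q, U q -> P q <> 0%C).

Let X := surf eps W F.

(** With r = P2 / P, the Wronskian gives W' r' = b^2, hence F'' = W'' r + b^2, and only b^2 survives
    in the determinants. The second form is thus a real multiple of Re (d zeta^2). *)
Lemma aff_forms q : U q ->
  aff_L X q = eps * nrm2 (b q * (P q * P q))%C * fst (b q * b q)%C /\
  aff_M X q = - (eps * nrm2 (b q * (P q * P q))%C * snd (b q * b q)%C) /\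
  aff_N X q = - (eps * nrm2 (b q * (P q * P q))%C * fst (b q * b q)%C).
Proof.
  intros Hq. unfold aff_L, aff_M, aff_N, X.
  assert (HPP : is_hd (fun q => P q * P q)%C q _) by (apply is_hd_mult; apply HP; auto).
  assert (HPP2 : is_hd (fun q => P q * P2 q)%C q _)
    by (apply is_hd_mult; [apply HP; auto|apply HP2; auto]).
  destruct (surf_second eps U W F _ _ q _ _ HU Hq HW HF
    (is_hd_mult _ _ _ _ _ (Hb q Hq) HPP) (is_hd_mult _ _ _ _ _ (Hb q Hq) HPP2))
    as (-> & -> & ->).
  rewrite (Xu_surf eps W F q _ _ (HW q Hq) (HF q Hq)).
  rewrite (Xv_surf eps W F q _ _ (HW q Hq) (HF q Hq)).
  specialize (Hwr q Hq). specialize (HP0 q Hq). cbv beta.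
  assert (E1 : (b q * (P q * P2 q) = b q * (P q * P q) * (P2 q / P q))%C) by (field; auto).
  match goal with |- context [pt eps ?B ?A] =>
    match A with (b1 q * _ + _)%C => set (A2 := A); set (B2 := B) end end.
  assert (E2 : A2 = (B2 * (P2 q / P q) + b q * b q)%C).
  { unfold A2, B2. rewrite <- (Cmult_1_r (b q * b q)), <- Hwr. field; auto. }
  rewrite E1, E2. split; [|split].
  - apply det3_surf.
  - replace (Ci * (B2 * (P2 q / P q) + b q * b q))%C
      with ((Ci * B2) * (P2 q / P q) + Ci * (b q * b q))%C by ring.
    rewrite det3_surf. simpl. ring.
  - replace (- (B2 * (P2 q / P q) + b q * b q))%C
      with ((- B2) * (P2 q / P q) + - (b q * b q))%C by ring.
    rewrite det3_surf. simpl. ring.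
Qed.

Lemma nrm2_pos_b q : U q -> 0 < nrm2 (b q).
Proof. intros Hq. now apply C_norm2_pos, Hb0. Qed.
Lemma nrm2_pos_P q : U q -> 0 < nrm2 (P q).
Proof. intros Hq. now apply C_norm2_pos, HP0. Qed.

(** A perfect fourth power up to sign, so the power -1/4 in the Berwald-Blaschke metric becomes the
    inverse of |b|^2 |P|^2. *)
Lemma aff_disc_eq q : U q -> aff_disc X q = - (nrm2 (b q) * nrm2 (P q)) ^ 4.
Proof.
  intros Hq. unfold aff_disc. destruct (aff_forms q Hq) as (-> & -> & ->).
  rewrite !nrm2_mult.
  transitivity (- (eps * eps * (nrm2 (b q) * nrm2 (P q) * nrm2 (P q)) ^ 2 * nrm2 (b q * b q)%C)).
  - generalize (b q * b q)%C (nrm2 (b q)) (nrm2 (P q)); intros c x y.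
    unfold nrm2. ring.
  - rewrite Heps, nrm2_mult. ring.
Qed.

Lemma surf_nondegenerate q : U q -> nondegenerate_at X q.
Proof.
  intros Hq. unfold nondegenerate_at. rewrite aff_disc_eq by auto.
  apply Ropp_neq_0_compat, pow_nonzero.
  assert (H1 := nrm2_pos_b q Hq). assert (H2 := nrm2_pos_P q Hq). nra.
Qed.

(** In other words, the Berwald-Blaschke metric is eps |P|^2 Re (d zeta^2). *)
Lemma bb_forms q : U q ->
  bb_uu X q = eps * nrm2 (P q) * fst (b q * b q)%C /\
  bb_uv X q = - (eps * nrm2 (P q) * snd (b q * b q)%C) /\
  bb_vv X q = - (eps * nrm2 (P q) * fst (b q * b q)%C).
Proof.
  intros Hq. assert (H1 := nrm2_pos_b q Hq). assert (H2 := nrm2_pos_P q Hq).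
  assert (Hs : bb_scale X q = / (nrm2 (b q) * nrm2 (P q))).
  { unfold bb_scale. rewrite aff_disc_eq by auto. rewrite Rabs_Ropp.
    rewrite Rabs_pos_eq by (apply pow_le; nra). apply Rpower_quarter; nra. }
  unfold bb_uu, bb_uv, bb_vv. destruct (aff_forms q Hq) as (-> & -> & ->).
  rewrite Hs, !nrm2_mult. repeat split; field; lra.
Qed.

(** [Psi] and [Xi] are the first and second derivatives of [Phi] in zeta = s + i t. The metric is
    eps |P|^2 (ds^2 - dt^2), and the s-second minus the t-second derivative of Re Phi is 2 Re
    Phi_zeta_zeta. *)
Lemma bb_laplacian Phi Psi Xi q : U q ->
  (forall q, U q -> is_hd Phi q (b q * Psi q)%C) ->
  is_hd Psi q (b q * Xi)%C ->
  laplacian (bb_uu X) (bb_uv X) (bb_vv X) (fun q => fst (Phi q)) q =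
    2 * eps * fst Xi / nrm2 (P q).
Proof.
  intros Hq HPhi HPsi. unfold laplacian.
  (* Up to eps, the real and imaginary parts of [V] are the components of the volume density times
     the gradient of Re Phi, whose divergence is taken. *)
  pose (V := fun q => (Cconj (b q) * Psi q)%C).
  assert (Hdet : forall q, U q -> bb_uu X q * bb_vv X q - bb_uv X q * bb_uv X q
    = - (nrm2 (P q) * nrm2 (b q)) ^ 2).
  { intros z Hz. destruct (bb_forms z Hz) as (-> & -> & ->).
    transitivity (- (eps * eps * nrm2 (P z) ^ 2 * nrm2 (b z * b z)%C)).
    - generalize (b z * b z)%C (nrm2 (P z)); intros c x. unfold nrm2. ring.
    - rewrite Heps, nrm2_mult. ring. }
  assert (Hvol : forall q, U q ->
    sqrt (Rabs (bb_uu X q * bb_vv X q - bb_uv X q * bb_uv X q)) = nrm2 (P q) * nrm2 (b q)).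
  { intros z Hz. assert (H1 := nrm2_pos_b z Hz). assert (H2 := nrm2_pos_P z Hz).
    rewrite Hdet, Rabs_Ropp by auto. rewrite Rabs_pos_eq by (apply pow_le; nra).
    apply sqrt_pow2. nra. }
  assert (Hdu : forall q, U q -> du (fun q => fst (Phi q)) q = fst (b q * Psi q)%C).
  { intros z Hz. apply is_du_unique, (is_hd_partials _ _ _ (HPhi z Hz)). }
  assert (Hdv : forall q, U q -> dv (fun q => fst (Phi q)) q = fst (Ci * (b q * Psi q))%C).
  { intros z Hz. apply is_dv_unique, (is_hd_partials _ _ _ (HPhi z Hz)). }
  assert (HV := is_pd_mult _ _ _ _ _ _ _ (is_pd_conj _ _ _ _ (Hb q Hq)) HPsi).
  destruct HV as [[HV1 _] [_ HV2]].
  rewrite (du_ext U _ (fun q => eps * fst (V q)) q HU Hq).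
  2: { intros z Hz. rewrite Hvol, Hdet, Hdu, Hdv by auto.
       destruct (bb_forms z Hz) as (E1 & E2 & E3). rewrite ?E1, ?E2, ?E3. clear E1 E2 E3. unfold V.
       assert (H1 := nrm2_pos_b z Hz). assert (H2 := nrm2_pos_P z Hz).
       revert H1 H2. generalize (nrm2 (P z)). intros x H1 H2.
       unfold nrm2 in *. destruct (b z), (Psi z); simpl in *. field. lra. }
  rewrite (dv_ext U _ (fun q => eps * snd (V q)) q HU Hq).
  2: { intros z Hz. rewrite Hvol, Hdet, Hdu, Hdv by auto.
       destruct (bb_forms z Hz) as (E1 & E2 & E3). rewrite ?E1, ?E2, ?E3. clear E1 E2 E3. unfold V.
       assert (H1 := nrm2_pos_b z Hz). assert (H2 := nrm2_pos_P z Hz).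
       revert H1 H2. generalize (nrm2 (P z)). intros x H1 H2.
       unfold nrm2 in *. destruct (b z), (Psi z); simpl in *. field. lra. }
  rewrite (is_du_unique _ _ _ (is_derive_scal _ _ eps _ HV1)).
  rewrite (is_dv_unique _ _ _ (is_derive_scal _ _ eps _ HV2)).
  rewrite Hvol by auto.
  assert (H1 := nrm2_pos_b q Hq). assert (H2 := nrm2_pos_P q Hq).
  revert H1 H2. generalize (nrm2 (P q)). intros x H1 H2.
  unfold nrm2 in *. destruct (b q), (Psi q), Xi, (b1 q); simpl in *. field. lra.
Qed.

(* Up to the sign [eps], the affine normal is the point [pt eps Tw Tl]. *)
Definition Tw (q : C) : C := (2 * p q * / Cconj (P q))%C.
Definition Tl (q : C) : C := (Tw q * (P2 q * / P q) + / P q * / Cconj (P q))%C.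

(** [bb_laplacian] applies with W_zeta_zeta = 2 p P and F_zeta_zeta = p P2 + P p2 = 2 p P2 + 1. As y
    = Re (- i eps W), a second eps appears in the last coordinate and cancels the first. *)
Lemma affine_normal_eq q : U q ->
  affine_normal X q = (eps * fst (Tl q), eps * fst (Tw q), snd (Tw q)).
Proof.
  intros Hq. specialize (Hwr q Hq) as Hw. specialize (HP0 q Hq) as Hn.
  assert (Hn' := conj_neq_0 _ Hn). assert (Hpos := nrm2_pos_P q Hq).
  unfold affine_normal. f_equal; [f_equal|].
  - change (fun q0 => cl (X q0)) with (fun q0 => fst (F q0)).
    rewrite (bb_laplacian F (fun q => P q * P2 q)%C (2 * p q * P2 q + 1)%C q Hq HF).
    + replace (Tl q) with ((2 * p q * P2 q + 1) * (/ P q * / Cconj (P q)))%C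
        by (unfold Tl, Tw; field; auto).
      rewrite fst_div_nrm2 by auto. field. lra.
    + eapply is_hd_eq; [apply is_hd_mult; [apply HP|apply HP2]; auto|].
      cbv beta. rewrite <- Hw. ring.
  - change (fun q0 => cx (X q0)) with (fun q0 => fst (W q0)).
    rewrite (bb_laplacian W (fun q => P q * P q)%C (2 * p q * P q)%C q Hq HW).
    + replace (Tw q) with ((2 * p q * P q) * (/ P q * / Cconj (P q)))%C
        by (unfold Tw; field; auto).
      rewrite fst_div_nrm2 by auto. field. lra.
    + eapply is_hd_eq; [apply is_hd_mult; apply HP; auto|]. ring.
  - replace (Tw q) with ((2 * p q * P q) * (/ P q * / Cconj (P q)))%C
        by (unfold Tw; field; auto).
    assert (E : forall z, fst (- Ci * eps * z)%C = eps * snd z) by (intros; simpl; ring).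
    transitivity (/ 2 * laplacian (bb_uu X) (bb_uv X) (bb_vv X)
      (fun q => fst (- Ci * eps * W q)%C) q).
    { f_equal. f_equal. apply functional_extensionality. intros z. now rewrite E. }
    rewrite (bb_laplacian (fun q => - Ci * eps * W q)%C (fun q => - Ci * eps * (P q * P q))%C
      (- Ci * eps * (2 * p q * P q))%C q Hq).
    + rewrite E, snd_div_nrm2 by auto.
      transitivity (eps * eps * (snd (2 * p q * P q)%C / nrm2 (P q))); [field; lra|].
      rewrite Heps. ring.
    + intros z Hz. eapply is_hd_eq; [apply is_hd_scal, HW; auto|]. ring.
    + eapply is_hd_eq; [apply is_hd_scal, is_hd_mult; apply HP; auto|]. ring.
Qed.

Lemma Xu_affine_normal q tlu twu tlv twv : U q -> is_pd Tl q tlu tlv -> is_pd Tw q twu twv ->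
  Xu (affine_normal X) q = (eps * fst tlu, eps * fst twu, snd twu) /\
  Xv (affine_normal X) q = (eps * fst tlv, eps * fst twv, snd twv).
Proof.
  intros Hq [[L1 _] [L2 _]] [[W1 W2] [W3 W4]].
  rewrite (Xu_ext U _ _ q HU Hq affine_normal_eq), (Xv_ext U _ _ q HU Hq affine_normal_eq).
  split; unfold Xu, Xv; f_equal; [f_equal| |f_equal|].
  - apply is_du_unique. exact (is_derive_scal _ _ eps _ L1).
  - apply is_du_unique. exact (is_derive_scal _ _ eps _ W1).
  - apply is_du_unique. exact W2.
  - apply is_dv_unique. exact (is_derive_scal _ _ eps _ L2).
  - apply is_dv_unique. exact (is_derive_scal _ _ eps _ W3).
  - apply is_dv_unique. exact W4.
Qed.

(** [Tw] is a holomorphic factor times an antiholomorphic one; the two resulting terms are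
    multiplied by i and - i on passing from the u-partial to the v-partial. *)
Lemma Tw_pd q : U q ->
  is_pd Tw q (2 * b q * k q * P q / Cconj (P q)
              - 2 * p q * Cconj (b q * p q) / (Cconj (P q) * Cconj (P q)))%C
             (Ci * (2 * b q * k q * P q / Cconj (P q)
              + 2 * p q * Cconj (b q * p q) / (Cconj (P q) * Cconj (P q))))%C.
Proof.
  intros Hq. assert (Hn := conj_neq_0 _ (HP0 q Hq)).
  eapply is_pd_eq;
    [apply is_pd_mult; [apply (is_hd_scal 2), (Hp q Hq)
                       |apply is_pd_inv; [apply is_pd_conj, (HP q Hq)|exact Hn]]| |].
  - cbv beta. field; auto.
  - replace (Cconj (Ci * (b q * p q)))%C with (- Ci * Cconj (b q * p q))%C
      by (apply injective_projections; simpl; ring).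
    cbv beta. field; auto.
Qed.

(** The last two terms are of the form c - conj c, with real part 0. Hence the differential of the
    affine normal is, like that of X, determined by its W-part through the factor r = P2 / P: it is
    tangent to the surface. *)
Lemma Tl_pd q twu twv : U q -> is_pd Tw q twu twv ->
  is_pd Tl q (twu * (P2 q / P q) + b q * p q / (P q * P q * Cconj (P q))
     - Cconj (b q * p q / (P q * P q * Cconj (P q))))%C
   (twv * (P2 q / P q) + Ci * b q * p q / (P q * P q * Cconj (P q))
     - Cconj (Ci * b q * p q / (P q * P q * Cconj (P q))))%C.
Proof.
  intros Hq HT. assert (Hn0 := HP0 q Hq). assert (Hn := conj_neq_0 _ Hn0).
  assert (Hw := Hwr q Hq).
  assert (HI := is_hd_inv _ _ _ (HP q Hq) Hn0).
  assert (HC := is_pd_inv _ _ _ _ (is_pd_conj _ _ _ _ (HP q Hq)) Hn).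
  assert (E : forall c, Cconj (c * b q * p q / (P q * P q * Cconj (P q)))%C
    = (Cconj (c * (b q * p q)) / (Cconj (P q) * Cconj (P q) * P q))%C).
  { intros c. unfold Cdiv. rewrite !Cmult_conj, Cinv_conj by
      (repeat apply Cmult_neq_0; auto). rewrite !Cmult_conj, Cconj_conj. ring. }
  assert (E2 : (p2 q = (1 + p q * P2 q) / P q)%C) by (rewrite <- Hw; field; auto).
  eapply is_pd_eq; [apply is_pd_plus;
    [apply is_pd_mult; [exact HT|exact (is_hd_mult _ _ _ _ _ (HP2 q Hq) HI)]
    |exact (is_pd_mult _ _ _ _ _ _ _ HI HC)]| |].
  - specialize (E 1%C). rewrite !Cmult_1_l in E. rewrite E. cbv beta. unfold Tw.
    rewrite E2. field. auto.
  - rewrite E. cbv beta. unfold Tw. rewrite E2. field. auto.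
Qed.

(** The columns of the shape operator are read as complex numbers s = s11 + i s21 and t = s12 + i
    s22, so the trace is Re (s - i t). In Tw_u - i Tw_v the antiholomorphic terms cancel, leaving 4
    k W' / |P|^2; dividing by W' gives a real multiple of k. *)
Lemma surf_affine_minimal_at q : U q ->
  (zero_affine_mean_curvature_at X q <-> fst (k q) = 0).
Proof.
  intros Hq. assert (Hn0 := HP0 q Hq). assert (Hn := conj_neq_0 _ Hn0).
  assert (Hbq := Hb0 q Hq).
  pose (w := (b q * (P q * P q))%C). pose (A := (b q * (P q * P2 q))%C).
  assert (Hw0 : w <> 0%C) by (unfold w; repeat apply Cmult_neq_0; auto).
  assert (HT := Tw_pd q Hq). assert (HL := Tl_pd q _ _ Hq HT).
  remember (2 * b q * k q * P q / Cconj (P q)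
              - 2 * p q * Cconj (b q * p q) / (Cconj (P q) * Cconj (P q)))%C as twu eqn:Eu.
  remember (Ci * (2 * b q * k q * P q / Cconj (P q)
              + 2 * p q * Cconj (b q * p q) / (Cconj (P q) * Cconj (P q))))%C as twv eqn:Ev.
  destruct (Xu_affine_normal q _ _ _ _ Hq HL HT) as [EU EV].
  assert (Ept : forall z t : C, (eps * fst t, eps * fst z, snd z) = pt eps (eps * z)%C (eps * t)%C).
  { intros z t. unfold pt. simpl. repeat apply injective_projections; simpl; try ring.
    transitivity (eps * eps * snd z); [rewrite Heps; ring|ring]. }
  assert (Ez : (twu - Ci * twv = 4 * k q * (w * (/ P q * / Cconj (P q))))%C).
  { rewrite Eu, Ev. unfold w.
    transitivity (2 * b q * k q * P q / Cconj (P q) * (1 - Ci * Ci)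
      - 2 * p q * Cconj (b q * p q) / (Cconj (P q) * Cconj (P q)) * (1 + Ci * Ci))%C; [ring|].
    replace (Ci * Ci)%C with (- (1))%C by (apply injective_projections; simpl; ring).
    field; auto. }
  assert (HN := nrm2_pos_P q Hq).
  unfold zero_affine_mean_curvature_at, affine_shape_operator_at.
  rewrite EU, EV, !Ept. unfold X.
  rewrite (Xu_surf eps W F q _ _ (HW q Hq) (HF q Hq)).
  rewrite (Xv_surf eps W F q _ _ (HW q Hq) (HF q Hq)).
  fold w A. split.
  - intros (s11 & s12 & s21 & s22 & [S1 S2] & Htr).
    apply (fun E => eq_trans E (pt_comb eps (s11, s21) w A)) in S1.
    apply (fun E => eq_trans E (pt_comb eps (s12, s22) w A)) in S2.
    apply pt_inj in S1; auto. apply pt_inj in S2; auto.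
    assert (E : (4 * eps * k q * (/ P q * / Cconj (P q)) = - (((s11, s21) : C) - Ci * (s12, s22)))%C).
    { transitivity ((eps * twu - Ci * (eps * twv)) / w)%C.
      - replace (eps * twu - Ci * (eps * twv))%C with (eps * (twu - Ci * twv))%C by ring.
        rewrite Ez. field; auto.
      - rewrite S1, S2. field; auto. }
    assert (E' := f_equal fst E). rewrite fst_div_nrm2 in E' by auto. simpl in E'.
    assert (E2 : 4 * eps * fst (k q) / nrm2 (P q) = 0).
    { transitivity (- (s11 + s22)); [|lra]. rewrite <- Rplus_0_r at 1.
      transitivity (((4 * eps - 0 * 0) * fst (k q) - (4 * 0 + 0 * eps) * snd (k q)) / nrm2 (P q));
        [field; lra|]. rewrite E'. ring. }
    transitivity (eps * nrm2 (P q) / 4 * (4 * eps * fst (k q) / nrm2 (P q))).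
    + transitivity (eps * eps * fst (k q)); [rewrite Heps; ring|]. field. lra.
    + rewrite E2. ring.
  - intros Hk. pose (s := (- (eps * twu / w))%C). pose (t := (- (eps * twv / w))%C).
    exists (fst s), (fst t), (snd s), (snd t).
    rewrite !pt_comb.
    assert (Hs : forall z, (- (- (eps * z / w) * w) = eps * z)%C) by (intros; field; auto).
    assert (Hs' : forall z, (- (- (eps * z / w) * A) = eps * (z * (P2 q / P q)))%C)
      by (intros; unfold A, w; field; auto).
    unfold s at 1 2, t at 1 2. rewrite !Hs, !Hs'. repeat split.
    + unfold pt. f_equal. f_equal. simpl. ring.
    + unfold pt. f_equal. f_equal. simpl. ring.
    + assert (E : fst s + snd t = fst (s - Ci * t)%C) by (simpl; ring). rewrite E.
      replace (s - Ci * t)%C with (- (4 * eps * k q * (/ P q * / Cconj (P q))))%C.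
      * rewrite <- (Ropp_involutive (fst _)).
        change (- fst (- (4 * eps * k q * (/ P q * / Cconj (P q))))%C) with
          (- - fst (4 * eps * k q * (/ P q * / Cconj (P q)))%C).
        rewrite fst_div_nrm2 by auto. simpl. rewrite Hk. field. lra.
      * unfold s, t. transitivity (- (eps * (twu - Ci * twv) / w))%C; [|field; auto].
        rewrite Ez. field; auto.
Qed.

End Affine.

(** * The family *)

Lemma simple_zero_isolated (D : C -> Prop) h p : open D -> hol D h -> D p ->
  h p = 0%C -> cd h p <> 0%C -> locally p (fun q => q <> p -> h q <> 0%C).
Proof.
  intros HD Hh Hp H0 Hn. assert (HN := C_norm2_pos _ Hn).
  assert (Hs := proj1 Hh). destruct Hs as [S1 S2].
  destruct (hol_dv D h p Hh Hp) as [V1 V2].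
  (* If each component of the first-order expansion errs by at most eta times the larger coordinate
     of q - p, a zero q gives |h'(p)|^2 |q - p|^2 <= 2 eta^2 |q - p|^2, although |h'(p)|^2 = 4
     eta^2. *)
  pose (eta := sqrt (nrm2 (cd h p)) / 2).
  assert (Heta : 0 < eta) by (apply Rdiv_lt_0_compat; [now apply sqrt_lt_R0|lra]).
  assert (Heta2 : 4 * (eta * eta) = nrm2 (cd h p)).
  { unfold eta. rewrite <- (sqrt_sqrt (nrm2 (cd h p))) at 3 by (unfold nrm2; lra). field. }
  assert (D1 := partials_differentiable D (fun q => fst (h q)) (du (fun q => fst (h q))) p HD Hp
    (fun q => smooth_is_du D _ q S1) (smooth_cont _ _ _ (smooth_du _ _ S1) Hp)
    _ (smooth_is_dv D _ p S1 Hp) (mkposreal _ Heta)).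
  assert (D2 := partials_differentiable D (fun q => snd (h q)) (du (fun q => snd (h q))) p HD Hp
    (fun q => smooth_is_du D _ q S2) (smooth_cont _ _ _ (smooth_du _ _ S2) Hp)
    _ (smooth_is_dv D _ p S2 Hp) (mkposreal _ Heta)).
  destruct (locally_2d_and _ _ _ _ D1 D2) as [d Hd]. exists d.
  intros q Hq Hqp Hz. destruct (Hd (fst q) (snd q) (proj1 Hq) (proj2 Hq)) as [E1 E2].
  clear Hd D1 D2. rewrite V1 in E1. rewrite V2 in E2.
  rewrite <- (surjective_pairing q), <- (surjective_pairing p), Hz, H0 in E1, E2.
  change (du (fun q => fst (h q)) p) with (fst (cd h p)) in E1.
  change (du (fun q => snd (h q)) p) with (snd (cd h p)) in E2.
  unfold nrm2 in *. destruct (cd h p) as [c1 c2]. simpl in E1, E2, HN, Heta2.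
  revert E1 E2. set (x := fst q - fst p). set (y := snd q - snd p). intros E1 E2.
  assert (Hm : Rmax (Rabs x) (Rabs y) * Rmax (Rabs x) (Rabs y) <= x * x + y * y).
  { assert (Hx := Rsqr_abs x). assert (Hy := Rsqr_abs y). unfold Rsqr in Hx, Hy.
    unfold Rmax. destruct (Rle_dec _ _); nra. }
  set (m := Rmax (Rabs x) (Rabs y)) in *.
  assert (Hsq : forall z r, Rabs z <= r -> z * z <= r * r).
  { intros z r Hz'. assert (Hz2 := Rsqr_abs z). unfold Rsqr in Hz2.
    assert (0 <= Rabs z) by apply Rabs_pos. nra. }
  apply Hsq in E1. apply Hsq in E2.
  assert (HS : (c1 * c1 + c2 * c2) * (x * x + y * y) <= 2 * (eta * eta) * (m * m)) by nra.
  assert (Hpos : 0 < x * x + y * y).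
  { destruct (Req_dec x 0) as [Ex|Ex]; [|nra].
    destruct (Req_dec y 0) as [Ey|Ey]; [|nra].
    destruct Hqp. apply injective_projections; unfold x, y in *; lra. }
  nra.
Qed.

(** The open sets |f| < n cover K, and the largest index of a finite subcover is a bound. *)
Lemma compact_bounded (K : C -> Prop) (f : C -> R) : compact_set K ->
  (forall p, continuous f p) -> exists M, 0 < M /\ forall p, K p -> Rabs (f p) <= M.
Proof.
  intros HK Hf.
  destruct (HK nat (fun n p => Rabs (f p) < INR n)) as [s Hs].
  - intros n p Hp.
    assert (Hc : continuous (fun p => Rabs (f p)) p).
    { apply (continuous_comp f Rabs); auto. apply continuous_Rabs. }
    apply (Hc (fun r => r < INR n)). now apply (open_lt (INR n)).
  - intros p _. destruct (INR_unbounded (Rabs (f p))) as [n Hn]. now exists n.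
  - exists (1 + INR (list_max s)). split; [assert (H := pos_INR (list_max s)); lra|].
    intros p Hp. destruct (Hs p Hp) as [n [Hin Hlt]].
    assert (Hle : (n <= list_max s)%nat).
    { assert (H := proj1 (list_max_le s (list_max s)) (le_n _)).
      rewrite Forall_forall in H. now apply H. }
    apply le_INR in Hle. lra.
Qed.

(* For t <= -3 the member is (Re z^2, z^3) with the first coordinate scaled by
   -3 - t, for -2 <= t <= 0 it is (Re z^2, z) scaled likewise (the plane for
   t = -2 and t = 0), for 1 <= t <= 2 a helicoid with scaled first coordinate, and
   for t >= 2 the last type of the header with d = t - 2.  On (-3, -2) and (0, 1)
   the first coordinate vanishes while W passes from z^3 to z, and from z to e^z. *)
Definition fam_a (t : R) : R := clamp (-2 - t).
Definition fam_e (t : R) : R := clamp t.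
Definition fam_d (t : R) : R := Rmax 0 (t - 2).
(** Where d = 0, this makes W a convex combination of z^3, z and e^z; once e = 1 it is the
    coefficient -2 d of the last type. *)
Definition fam_b (t : R) : R := 1 - fam_a t - fam_e t - 2 * fam_d t.
(** A ramp to the left of -3 and a tent on [-2, 0]. The normal forms are taken where the value is 1,
    at t = -4 and at the peak t = -1. *)
Definition fam_c1 (t : R) : R := Rmax 0 (-3 - t) + Rmax 0 (1 - Rabs (t + 1)).
Definition fam_c2 (t : R) : R := clamp (t - 1).

Definition famW (t : R) (z : C) : C :=
  (fam_a t * (z * z * z) + fam_b t * z + fam_e t * cexp z
   + - (fam_d t * fam_d t)%R * cexp (- (1) * z))%C.
Definition famF (t : R) (z : C) : C :=
  (fam_c1 t * (z * z) + - Ci * fam_c2 t * z + - Ci * fam_d t * cexp (- (1) * z))%C.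

Definition fam (t : R) : C -> I3 := surf 1 (famW t) (famF t).

Definition plane : C -> Prop := fun _ => True.

Lemma open_plane : open plane.
Proof. apply open_true. Qed.

Lemma famW_hd t z : is_hd (famW t) z
  (3 * fam_a t * (z * z) + fam_b t + fam_e t * cexp z
   + (fam_d t * fam_d t)%R * cexp (- (1) * z))%C.
Proof.
  assert (Hz := is_hd_id z).
  eapply is_hd_eq.
  - unfold famW. apply is_hd_plus; [apply is_hd_plus; [apply is_hd_plus|]|]; apply is_hd_scal.
    + apply is_hd_mult; [apply is_hd_mult|]; exact Hz.
    + exact Hz.
    + apply is_hd_exp; exact Hz.
    + apply is_hd_exp, is_hd_scal; exact Hz.
  - cbv beta. ring.
Qed.
Lemma famF_hd t z : is_hd (famF t) z
  (2 * fam_c1 t * z + - Ci * fam_c2 t + Ci * fam_d t * cexp (- (1) * z))%C.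
Proof.
  assert (Hz := is_hd_id z).
  eapply is_hd_eq.
  - unfold famF. apply is_hd_plus; [apply is_hd_plus|]; apply is_hd_scal.
    + apply is_hd_mult; exact Hz.
    + exact Hz.
    + apply is_hd_exp, is_hd_scal; exact Hz.
  - cbv beta. ring.
Qed.
Lemma famW_hol t : hol plane (famW t).
Proof.
  assert (HO := open_plane). assert (Hz := hol_id plane HO).
  unfold famW. apply hol_plus; [exact HO|apply hol_plus; [exact HO|apply hol_plus; [exact HO| |]|]|];
    apply hol_scal; auto.
  - apply (hol_mult plane (fun z => z * z)%C (fun z => z)); auto. now apply hol_mult.
  - now apply (hol_exp plane (fun z => z)).
  - apply hol_exp; auto. now apply hol_scal.
Qed.
Lemma famF_hol t : hol plane (famF t).
Proof.
  assert (HO := open_plane). assert (Hz := hol_id plane HO).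
  unfold famF. apply hol_plus; [exact HO|apply hol_plus; [exact HO| |]|];
    apply hol_scal; auto.
  - now apply hol_mult.
  - apply hol_exp; auto. now apply hol_scal.
Qed.

(** The coefficients on the five pieces of the line. For t >= 1, d stays 0 until c2 has reached 1;
    the factored form of d shows that it vanishes with c2. *)
Lemma fam_regions t :
  (t <= -3 /\ fam_a t = 1 /\ fam_b t = 0 /\ fam_e t = 0 /\ fam_d t = 0 /\ fam_c2 t = 0
     /\ fam_c1 t = -3 - t) \/
  (-3 < t <= -2 /\ fam_a t = -2 - t /\ fam_b t = 3 + t /\ fam_e t = 0 /\ fam_d t = 0
     /\ fam_c2 t = 0 /\ fam_c1 t = 0) \/
  (-2 <= t <= 0 /\ fam_a t = 0 /\ fam_b t = 1 /\ fam_e t = 0 /\ fam_d t = 0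
     /\ fam_c2 t = 0 /\ fam_c1 t = 1 - Rabs (t + 1)) \/
  (0 <= t <= 1 /\ fam_a t = 0 /\ fam_b t = 1 - t /\ fam_e t = t /\ fam_d t = 0
     /\ fam_c2 t = 0 /\ fam_c1 t = 0) \/
  (1 <= t /\ fam_a t = 0 /\ fam_b t = - (2 * fam_d t) /\ fam_e t = 1
     /\ fam_d t = fam_c2 t * Rmax 0 (t - 2)
     /\ fam_c2 t = Rmin 1 (t - 1) /\ fam_c1 t = 0).
Proof.
  assert (Hfar : t <= -2 \/ 0 <= t -> Rmax 0 (1 - Rabs (t + 1)) = 0).
  { intros H. apply Rmax_left. unfold Rabs. destruct (Rcase_abs (t + 1)); lra. }
  unfold fam_b, fam_a, fam_e, fam_d, fam_c1, fam_c2.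
  destruct (Rle_dec t (-3)); [left|destruct (Rle_dec t (-2)); [right; left|
    destruct (Rle_dec t 0); [right; right; left|destruct (Rle_dec t 1);
    [right; right; right; left|right; right; right; right]]]].
  - rewrite (clamp_1 (-2 - t)), (clamp_0 t), (Rmax_left 0 (t - 2)), (clamp_0 (t - 1)),
      (Rmax_right 0 (-3 - t)), Hfar by lra. repeat split; lra.
  - rewrite (clamp_id (-2 - t)), (clamp_0 t), (Rmax_left 0 (t - 2)), (clamp_0 (t - 1)),
      (Rmax_left 0 (-3 - t)), Hfar by lra. repeat split; lra.
  - rewrite (clamp_0 (-2 - t)), (clamp_0 t), (Rmax_left 0 (t - 2)), (clamp_0 (t - 1)),
      (Rmax_left 0 (-3 - t)), (Rmax_right 0 (1 - _)) by
      (unfold Rabs; destruct (Rcase_abs (t + 1)); lra). repeat split; lra.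
  - rewrite (clamp_0 (-2 - t)), (clamp_id t), (Rmax_left 0 (t - 2)), (clamp_0 (t - 1)),
      (Rmax_left 0 (-3 - t)), Hfar by lra. repeat split; lra.
  - rewrite (clamp_0 (-2 - t)), (clamp_1 t), (Rmax_left 0 (-3 - t)), Hfar by lra.
    destruct (Rle_dec t 2).
    + rewrite (Rmax_left 0 (t - 2)), (clamp_id (t - 1)), Rmin_right by lra. repeat split; lra.
    + rewrite (Rmax_right 0 (t - 2)), (clamp_1 (t - 1)), Rmin_left by lra. repeat split; lra.
Qed.

Lemma hol_open_neq_0 D h : open D -> hol D h -> open (fun z => D z /\ h z <> 0%C).
Proof.
  intros HD [[S1 S2] _] z [Hz Hn]. apply filter_and; [now apply HD|].
  assert (Hc : continuous (fun z => nrm2 (h z)) z).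
  { apply (smooth_cont D); auto. unfold nrm2. apply smooth_plus; auto; now apply smooth_mult. }
  assert (Hpos : 0 < nrm2 (h z)) by now apply C_norm2_pos.
  assert (HL : locally z (fun z => 0 < nrm2 (h z))).
  { apply (Hc (fun r => 0 < r)). now apply (open_gt 0). }
  revert HL. apply filter_imp. intros w Hw E. rewrite E in Hw. unfold nrm2 in Hw.
  simpl in Hw. lra.
Qed.

(** For constant b one has zeta = b z, and the surface is immersed exactly where P is nonzero; the
    local computation applies on that open set. *)
Lemma weierstrass_affine_minimal eps (W F P p P2 p2 : C -> C) (b k : C) :
  eps * eps = 1 -> b <> 0%C -> hol plane P ->
  (forall z, is_hd W z (b * (P z * P z))%C) -> (forall z, is_hd F z (b * (P z * P2 z))%C) ->
  (forall z, is_hd P z (b * p z)%C) -> (forall z, is_hd p z (b * (k * P z))%C) ->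
  (forall z, is_hd P2 z (b * p2 z)%C) -> (forall z, P z * p2 z - p z * P2 z = 1)%C ->
  fst k = 0 ->
  affine_minimal plane (surf eps W F).
Proof.
  intros He Hb HPh HW HF HP Hp HP2 Hwr Hk. right. intros z Hz Him.
  rewrite (surf_immersed eps W F z _ _ He (HW z) (HF z)) in Him.
  pose (U := fun z => plane z /\ P z <> 0%C).
  assert (HU : open U) by (apply hol_open_neq_0; auto; apply open_plane).
  assert (Hin : U z).
  { split; [exact I|]. intros E. apply Him. rewrite E. ring. }
  split.
  - apply (surf_nondegenerate U eps W F (fun _ => b) (fun _ => 0%C) P p P2 p2); auto;
      try (intros; apply is_hd_const); now intros q [_ Hq].
  - apply (surf_affine_minimal_at U eps W F (fun _ => b) (fun _ => 0%C) P p P2 p2 (fun _ => k));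
      auto; try (intros; apply is_hd_const); now intros q [_ Hq].
Qed.

Lemma fam_planar t : fam_c1 t = 0 -> fam_c2 t = 0 -> fam_d t = 0 ->
  affine_minimal plane (fam t).
Proof.
  intros E1 E2 E3. left. exists 1, 0, 0, 0. split.
  - intros E. injection E. lra.
  - intros z _. unfold fam, surf, pt, cl, cx, cy, famF. simpl. rewrite E1, E2, E3. ring.
Qed.

Lemma RtoC_neq_0 (x : R) : x <> 0 -> RtoC x <> 0%C.
Proof. intros H E. apply H. now injection E. Qed.

Lemma cexp_half z : cexp z = (cexp (/ 2 * z) * cexp (/ 2 * z))%C.
Proof. rewrite <- cexp_plus. f_equal. field. Qed.

Lemma fam_affine_minimal t : affine_minimal plane (fam t).
Proof.
  assert (HO := open_plane). assert (Hid := hol_id plane HO).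
  destruct (fam_regions t) as [(Ht & Ea & Eb & Ee & Ed & E2 & E1)|
    [(Ht & Ea & Eb & Ee & Ed & E2 & E1)|[(Ht & Ea & Eb & Ee & Ed & E2 & E1)|
    [(Ht & Ea & Eb & Ee & Ed & E2 & E1)|(Ht & Ea & Eb & Ee & Ed & E2 & E1)]]]].
  - destruct (Req_dec (fam_c1 t) 0) as [E|Hn]; [now apply fam_planar|].
    assert (HnC := RtoC_neq_0 _ Hn).
    (* W' = 3 z^2 suggests P = mu z with b mu^2 = 3. The constant P2 = - b / mu gives Wronskian 1,
       and F' = - b^2 z must be 2 c1 z. *)
    destruct (csqrt_exists (- 2 * fam_c1 t)%C) as [b Hb].
    assert (Hb0 : b <> 0%C).
    { intros ->. apply HnC. replace (RtoC (fam_c1 t)) with (- / 2 * (- 2 * fam_c1 t))%C by field.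
      rewrite <- Hb. ring. }
    destruct (csqrt_exists (3 / b)%C) as [mu Hmu].
    assert (Hmu0 : mu <> 0%C).
    { intros ->. assert (E : (b * (3 / b) = 3)%C) by (field; auto).
      rewrite <- Hmu in E. ring_simplify in E. injection E. lra. }
    apply (weierstrass_affine_minimal 1 _ _ (fun z => mu * z)%C (fun _ => mu / b)%C
      (fun _ => - b / mu)%C (fun _ => 0%C) b 0%C); auto.
    + lra.
    + now apply hol_scal.
    + intros z. eapply is_hd_eq; [apply famW_hd|]. rewrite Ea, Eb, Ee, Ed.
      replace (b * (mu * z * (mu * z)))%C with (b * (mu * mu) * (z * z))%C by ring.
      rewrite Hmu. rewrite Rmult_0_l. field. auto.
    + intros z. eapply is_hd_eq; [apply famF_hd|]. rewrite E2, Ed.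
      replace (b * (mu * z * (- b / mu)))%C with (- (b * b) * z)%C by (field; auto).
      rewrite Hb. ring.
    + intros z. eapply is_hd_eq; [apply is_hd_scal, is_hd_id|]. field; auto.
    + intros z. eapply is_hd_eq; [apply is_hd_const|]. ring.
    + intros z. eapply is_hd_eq; [apply is_hd_const|]. ring.
    + intros z. field. auto.
  - apply fam_planar; lra.
  - destruct (Req_dec (fam_c1 t) 0) as [E|Hn]; [now apply fam_planar|].
    assert (HnC := RtoC_neq_0 _ Hn).
    (* Here W' = 1, so P = mu is constant with b mu^2 = 1; P2 = (b / mu) z gives Wronskian 1, and F'
       = b^2 z must be 2 c1 z. *)
    destruct (csqrt_exists (2 * fam_c1 t)%C) as [b Hb].
    assert (Hb0 : b <> 0%C).
    { intros ->. apply HnC. replace (RtoC (fam_c1 t)) with (/ 2 * (2 * fam_c1 t))%C by field.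
      rewrite <- Hb. ring. }
    destruct (csqrt_exists (1 / b)%C) as [mu Hmu].
    assert (Hmu0 : mu <> 0%C).
    { intros ->. assert (E : (b * (1 / b) = 1)%C) by (field; auto).
      rewrite <- Hmu in E. ring_simplify in E. injection E. lra. }
    apply (weierstrass_affine_minimal 1 _ _ (fun _ => mu)%C (fun _ => 0%C)
      (fun z => b / mu * z)%C (fun _ => / mu)%C b 0%C); auto.
    + lra.
    + now apply hol_const.
    + intros z. eapply is_hd_eq; [apply famW_hd|]. rewrite Ea, Eb, Ee, Ed.
      rewrite Hmu. rewrite Rmult_0_l. field. auto.
    + intros z. eapply is_hd_eq; [apply famF_hd|]. rewrite E2, Ed.
      replace (b * (mu * (b / mu * z)))%C with ((b * b) * z)%C by (field; auto).
      rewrite Hb. ring.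
    + intros z. eapply is_hd_eq; [apply is_hd_const|]. ring.
    + intros z. eapply is_hd_eq; [apply is_hd_const|]. ring.
    + intros z. eapply is_hd_eq; [apply is_hd_scal, is_hd_id|]. field; auto.
    + intros z. field. auto.
  - apply fam_planar; lra.
  - destruct (Req_dec (fam_c2 t) 0) as [E|Hn].
    { apply fam_planar; auto. rewrite Ed, E. ring. }
    assert (HnC := RtoC_neq_0 _ Hn).
    (* F' = b P P2 will produce c2 d where the family has d; the two agree since d is nonzero only
       where c2 = 1. *)
    assert (Edc : fam_d t = fam_c2 t * fam_d t).
    { destruct (Rle_dec t 2).
      - unfold fam_d. rewrite Rmax_left by lra. ring.
      - rewrite E2, Rmin_left by lra. ring. }
    (* W' = e^z - 2 d + d^2 e^(-z) is the square of e^(z/2) - d e^(-z/2), which is P up to mu with b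
       mu^2 = 1. Then k = 1 / (4 b^2), which is imaginary for b^2 = i c2. *)
    destruct (csqrt_exists (Ci * fam_c2 t)%C) as [b Hb].
    assert (HCi : Ci <> 0%C) by (intros E; injection E; lra).
    assert (Hb0 : b <> 0%C).
    { intros ->. assert (E : (Ci * fam_c2 t <> 0)%C) by now apply Cmult_neq_0.
      apply E. rewrite <- Hb. ring. }
    destruct (csqrt_exists (1 / b)%C) as [mu Hmu].
    assert (Hmu0 : mu <> 0%C).
    { intros ->. assert (E : (b * (1 / b) = 1)%C) by (field; auto).
      rewrite <- Hmu in E. ring_simplify in E. injection E. lra. }
    assert (Hh : forall c z, is_hd (fun z => cexp (c * z))%C z (c * cexp (c * z))%C).
    { intros c z. eapply is_hd_eq; [apply is_hd_exp, is_hd_scal, is_hd_id|]. ring. }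
    assert (Ehalf : forall z, cexp (- / 2 * z) = (/ cexp (/ 2 * z))%C).
    { intros z. rewrite <- cexp_opp. f_equal. ring. }
    assert (Eneg : forall z, cexp (- (1) * z) = (/ cexp (/ 2 * z) * / cexp (/ 2 * z))%C).
    { intros z. rewrite <- !cexp_opp, <- cexp_plus. f_equal. field. }
    assert (HE := fun z => cexp_neq_0 (/ 2 * z)%C).
    apply (weierstrass_affine_minimal 1 _ _
      (fun z => mu * (cexp (/ 2 * z) + - fam_d t * cexp (- / 2 * z)))%C
      (fun z => mu / (2 * b) * (cexp (/ 2 * z) + fam_d t * cexp (- / 2 * z)))%C
      (fun z => - b / mu * cexp (- / 2 * z))%C
      (fun z => / (2 * mu) * cexp (- / 2 * z))%C b (0, - / (4 * fam_c2 t))); auto.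
    + lra.
    + apply hol_scal; auto. apply hol_plus; auto.
      * apply hol_exp; auto. now apply hol_scal.
      * apply hol_scal; auto. apply hol_exp; auto. now apply hol_scal.
    + intros z. eapply is_hd_eq; [apply famW_hd|]. rewrite Ea, Eb, Ee, Eneg, Ehalf.
      rewrite (cexp_half z), RtoC_opp, !RtoC_mult.
      transitivity ((b * (mu * mu)) * ((cexp (/ 2 * z) + - fam_d t * / cexp (/ 2 * z))
          * (cexp (/ 2 * z) + - fam_d t * / cexp (/ 2 * z))))%C; [|ring].
      rewrite Hmu. field. auto.
    + intros z. eapply is_hd_eq; [apply famF_hd|]. rewrite E1, Eneg, Ehalf.
      transitivity (- (b * b) * (1 - fam_d t * (/ cexp (/ 2 * z) * / cexp (/ 2 * z))))%C;
        [|field; auto].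
      rewrite Hb. rewrite Edc at 1. rewrite RtoC_mult. field. auto.
    + intros z. eapply is_hd_eq; [apply is_hd_scal, is_hd_plus;
        [apply Hh|apply is_hd_scal, Hh]|]. field. auto.
    + intros z. eapply is_hd_eq; [apply is_hd_scal, is_hd_plus;
        [apply Hh|apply is_hd_scal, Hh]|].
      assert (Ek : (4 * (b * b) * (0, - / (4 * fam_c2 t))%R = 1)%C).
      { rewrite Hb. apply injective_projections; simpl; field; auto. }
      transitivity (4 * (b * b) * (0, - / (4 * fam_c2 t))%R *
        (mu / (2 * b) * (/ 2 * cexp (/ 2 * z) + fam_d t * (- / 2 * cexp (- / 2 * z)))))%C.
      * rewrite Ek. ring.
      * field. auto.
    + intros z. eapply is_hd_eq; [apply is_hd_scal, Hh|]. field. auto.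
    + intros z. rewrite Ehalf. field. auto.
Qed.

(** Immersion fails at the zeros of W'. These are double for z^3 and for t >= 1, where [h] is a
    square root of W' up to a factor without zeros; on the other pieces W' itself serves. *)
Lemma fam_simple_zeros t : exists h, hol plane h /\
  (forall z, cd (famW t) z = 0%C <-> h z = 0%C) /\ (forall z, h z = 0%C -> cd h z <> 0%C).
Proof.
  assert (HO := open_plane). assert (Hid := hol_id plane HO).
  assert (HW := fun z => is_hd_cd _ _ _ (famW_hd t z)).
  assert (Hself : (forall z, cd (famW t) z = 0%C -> cd (cd (famW t)) z <> 0%C) ->
    exists h, hol plane h /\ (forall z, cd (famW t) z = 0%C <-> h z = 0%C) /\
     (forall z, h z = 0%C -> cd h z <> 0%C)).
  { intros H. exists (cd (famW t)). split; [now apply hol_cd, famW_hol|]. split; [intros z; tauto|exact H]. }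
  assert (H1 : RtoC 1 <> 0%C) by (apply RtoC_neq_0; lra).
  assert (Hexp : forall c z, is_hd (fun z => cexp (c * z))%C z (c * cexp (c * z))%C).
  { intros c z. eapply is_hd_eq; [apply is_hd_exp, is_hd_scal, is_hd_id|]. ring. }
  assert (Hcd2 : forall z, cd (cd (famW t)) z = (6 * fam_a t * z + fam_e t * cexp z
    + - (fam_d t * fam_d t)%R * cexp (- (1) * z))%C).
  { intros z. apply is_hd_cd. rewrite (functional_extensionality _ _ HW).
    eapply is_hd_eq.
    - apply is_hd_plus; [apply is_hd_plus; [apply is_hd_plus|]|].
      + apply is_hd_scal, is_hd_mult; apply is_hd_id.
      + apply is_hd_const.
      + apply is_hd_scal, is_hd_exp, is_hd_id.
      + apply is_hd_scal, Hexp.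
    - cbv beta. ring. }
  destruct (fam_regions t) as [(Ht & Ea & Eb & Ee & Ed & E2 & E1)|
    [(Ht & Ea & Eb & Ee & Ed & E2 & E1)|[(Ht & Ea & Eb & Ee & Ed & E2 & E1)|
    [(Ht & Ea & Eb & Ee & Ed & E2 & E1)|(Ht & Ea & Eb & Ee & Ed & E2 & E1)]]]].
  - exists (fun z => z). split; [exact Hid|]. split.
    + intros z. rewrite HW, Ea, Eb, Ee, Ed, Rmult_0_l. split; [|intros ->; ring].
      intros E. apply NNPP. intros Hz.
      assert (H3 : RtoC 3 <> 0%C) by (apply RtoC_neq_0; lra).
      apply (Cmult_neq_0 3 (z * z)%C); auto.
      * now apply Cmult_neq_0.
      * rewrite <- E. ring.
    + intros z _. now rewrite (is_hd_cd _ _ _ (is_hd_id z)).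
  - apply Hself. intros z Hz E. rewrite Hcd2, Ee, Ed, Rmult_0_l in E.
    rewrite HW, Ee, Ed, Rmult_0_l in Hz.
    apply (RtoC_neq_0 (fam_b t)); [lra|].
    (* W' - (z / 2) W'' equals [fam_b t], which is positive on this piece. *)
    transitivity ((3 * fam_a t * (z * z) + fam_b t + 0 * cexp z + 0 * cexp (- (1) * z))
       - z / 2 * (6 * fam_a t * z + 0 * cexp z + - 0 * cexp (- (1) * z)))%C; [field|].
    rewrite Hz, E. ring.
  - apply Hself. intros z Hz. exfalso. apply H1. rewrite <- Hz, HW, Ea, Eb, Ee, Ed, Rmult_0_l.
    ring.
  - apply Hself. intros z Hz E. rewrite Hcd2, Ea, Ed, Rmult_0_l in E.
    rewrite HW, Ea, Ed, Eb, Ee, Rmult_0_l in Hz. rewrite Ee in E.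
    apply H1.
    assert (Et : RtoC t = 0%C).
    { apply NNPP. intros Ht0. apply (Cmult_neq_0 t (cexp z)); auto using cexp_neq_0.
      rewrite <- E. ring. }
    rewrite RtoC_minus, Et in Hz. rewrite <- Hz. ring.
  - exists (fun z => cexp z + - fam_d t)%C. split; [|split].
    + apply hol_plus; auto; [now apply (hol_exp plane (fun z => z))|now apply hol_const].
    + intros z.
      assert (E : cd (famW t) z = ((cexp z + - fam_d t) * (cexp z + - fam_d t)
        * cexp (- (1) * z))%C).
      { rewrite HW, Ea, Eb, Ee, RtoC_opp, !RtoC_mult.
        replace (- (1) * z)%C with (- z)%C by ring. rewrite cexp_opp.
        field. apply cexp_neq_0. }
      rewrite E. split; [|intros ->; ring].
      intros E0. apply NNPP. intros Hz. revert E0.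
      repeat apply Cmult_neq_0; auto using cexp_neq_0.
    + intros z _. rewrite (is_hd_cd _ z (cexp z)); [apply cexp_neq_0|].
      eapply is_hd_eq; [apply is_hd_plus; [apply is_hd_exp, is_hd_id|apply is_hd_const]|].
      cbv beta. ring.
Qed.

Lemma fam_isolated t : isolated_singularities plane (fam t).
Proof.
  destruct (fam_simple_zeros t) as [h [Hh [E Hs]]].
  assert (Him : forall z, immersed_at (fam t) z <-> h z <> 0%C).
  { intros z. rewrite <- E.
    eapply surf_immersed; [lra| |apply famF_hd].
    apply (hol_hd plane); [apply famW_hol|exact I]. }
  intros z _ Hn. rewrite Him in Hn. apply NNPP in Hn.
  assert (HL := simple_zero_isolated plane h z open_plane Hh I Hn (Hs z Hn)).
  revert HL. apply filter_imp. intros q Hq Hqz. apply Him. auto.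
Qed.

Lemma fam_smooth t : smooth_surface plane (fam t).
Proof.
  destruct (famW_hol t) as [[W1 W2] _]. destruct (famF_hol t) as [[F1 _] _].
  assert (HO := open_plane). split; [exact F1|split; [exact W1|]].
  unfold fam, surf, pt, cy; simpl.
  apply smooth_mult; auto. now apply smooth_const.
Qed.

Lemma continuous_Rmax_0 (f : R -> R) t : continuous f t -> continuous (fun t => Rmax 0 (f t)) t.
Proof.
  intros Hf. apply (continuous_comp f (Rmax 0)); auto.
  apply lipschitz_continuous. intros y. unfold Rmax, Rabs.
  repeat destruct (Rle_dec _ _); repeat destruct (Rcase_abs _); lra.
Qed.

Lemma fam_continuous : continuous_deformation (fun _ => True) plane fam.
Proof.
  assert (HO := open_plane).
  assert (Haff : forall c x t : R, continuous (fun t : R => c * t + x) t)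
    by (intros; apply continuous_affine).
  assert (Hcl : forall c x t : R, continuous (fun t : R => clamp (c * t + x)) t).
  { intros. apply (continuous_comp (fun t : R => c * t + x) clamp); auto. apply continuous_clamp. }
  assert (Ca : forall t, continuous fam_a t).
  { intros t. eapply continuous_ext; [|apply (Hcl (-1) (-2))]. intros; unfold fam_a; f_equal; ring. }
  assert (Ce : forall t, continuous fam_e t) by (intros; apply continuous_clamp).
  assert (Cd : forall t, continuous fam_d t).
  { intros t. apply continuous_Rmax_0.
    eapply continuous_ext; [|apply (Haff 1 (-2))]. intros; simpl; ring. }
  assert (C2 : forall t, continuous fam_c2 t).
  { intros t. eapply continuous_ext; [|apply (Hcl 1 (-1))]. intros; unfold fam_c2; f_equal; ring. }
  assert (C1 : forall t, continuous fam_c1 t).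
  { intros t. apply (continuous_plus (V:=R_NormedModule)); apply continuous_Rmax_0.
    - eapply continuous_ext; [|apply (Haff (-1) (-3))]. intros; simpl; ring.
    - apply (continuous_minus (V:=R_NormedModule)); [apply continuous_const|].
      apply (continuous_comp (fun t : R => t + 1) Rabs).
      + eapply continuous_ext; [|apply (Haff 1 1)]. intros; simpl; ring.
      + apply continuous_Rabs. }
  assert (Cb : forall t, continuous fam_b t).
  { intros t. apply (continuous_minus (V:=R_NormedModule) (fun t => 1 - fam_a t - fam_e t)).
    - apply (continuous_minus (V:=R_NormedModule) (fun t => 1 - fam_a t)); auto.
      apply (continuous_minus (V:=R_NormedModule)); auto. apply continuous_const.
    - apply (continuous_mult (K:=R_AbsRing)); auto. apply continuous_const. }
  assert (Cdd : forall t, continuous (fun t => - (fam_d t * fam_d t)) t).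
  { intros t. apply (continuous_opp (V:=R_NormedModule)).
    now apply (continuous_mult (K:=R_AbsRing)). }
  intros t0 _ K HK _ e He.
  assert (Hbd : forall h, hol plane h -> exists M, 0 < M /\ forall p, K p ->
     Rabs (fst (h p)) <= M /\ Rabs (snd (h p)) <= M).
  { intros h [[S1 S2] _].
    destruct (compact_bounded K _ HK (fun p => smooth_cont _ _ p S1 I)) as [M1 [P1 B1]].
    destruct (compact_bounded K _ HK (fun p => smooth_cont _ _ p S2 I)) as [M2 [P2 B2]].
    exists (M1 + M2). split; [lra|]. intros p Hp. specialize (B1 p Hp). specialize (B2 p Hp).
    split; lra. }
  assert (Hid := hol_id plane HO).
  destruct (Hbd (fun z => z)) as [M1 [P1 B1]]; auto.
  destruct (Hbd (fun z => z * z)%C) as [M2 [P2 B2]]; [now apply hol_mult|].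
  destruct (Hbd (fun z => z * z * z)%C) as [M3 [P3 B3]];
    [apply (hol_mult plane (fun z => z * z)%C (fun z => z)); auto; now apply hol_mult|].
  destruct (Hbd cexp) as [M4 [P4 B4]]; [now apply (hol_exp plane (fun z => z))|].
  destruct (Hbd (fun z => cexp (- (1) * z))%C) as [M5 [P5 B5]];
    [apply hol_exp; auto; now apply hol_scal|].
  pose (M := M1 + M2 + M3 + M4 + M5).
  assert (HM : 0 < M) by (unfold M; lra).
  (* Each coordinate difference is a sum of at most four products of a coefficient difference with a
     function bounded by M on K. Each product is at most e / 5, so the sum stays strictly below
     e. *)
  assert (Heta : 0 < e / (5 * M)) by (apply Rdiv_lt_0_compat; lra).
  set (eta := mkposreal _ Heta).
  assert (HN : forall f : R -> R, (forall t, continuous f t) ->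
    locally t0 (fun t => Rabs (f t - f t0) < eta)).
  { intros f Hf. apply (Hf t0 (fun y => Rabs (y - f t0) < eta)). now exists eta. }
  destruct (filter_and _ _ (filter_and _ _ (HN _ Ca) (filter_and _ _ (HN _ Cb) (HN _ Ce)))
    (filter_and _ _ (filter_and _ _ (HN _ Cd) (HN _ C1)) (filter_and _ _ (HN _ C2) (HN _ Cdd))))
    as [d Hd].
  exists d. split; [apply cond_pos|]. intros t _ Ht p Hp.
  destruct (Hd t Ht) as [[Na [Nb Ne]] [[Nd N1] [N2 Ndd]]]. simpl in Na, Nb, Ne, Nd, N1, N2, Ndd.
  specialize (B1 p Hp). specialize (B2 p Hp). specialize (B3 p Hp).
  specialize (B4 p Hp). specialize (B5 p Hp). clear Hd.
  assert (Hterm : forall c c' x : R, Rabs (c - c') < e / (5 * M) -> Rabs x <= M ->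
    Rabs ((c - c') * x) <= e / 5).
  { intros c c' x Hc Hx. rewrite Rabs_mult.
    replace (e / 5) with (e / (5 * M) * M) by (field; lra).
    apply Rmult_le_compat; auto using Rabs_pos; lra. }
  assert (Hsum : forall a b c f, Rabs a <= e / 5 -> Rabs b <= e / 5 -> Rabs c <= e / 5 ->
    Rabs f <= e / 5 -> Rabs (a + b + c + f) < e).
  { intros a b c f Ha Hb Hc Hf.
    assert (T1 := Rabs_triang (a + b + c) f). assert (T2 := Rabs_triang (a + b) c).
    assert (T3 := Rabs_triang a b). lra. }
  split; [|split].
  - replace (_ - _) with ((fam_c1 t - fam_c1 t0) * fst (p * p)%C
      + (fam_c2 t - fam_c2 t0) * snd p
      + (fam_d t - fam_d t0) * snd (cexp (- (1) * p)%C)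
      + (fam_d t - fam_d t0) * 0).
    2: { unfold fam, surf, pt, cl, famF.
         generalize (cexp (- (1) * p)%C). intros E. simpl. ring. }
    apply Hsum; apply Hterm; auto; try (unfold M; lra).
    rewrite Rabs_R0; lra.
  - replace (_ - _) with ((fam_a t - fam_a t0) * fst (p * p * p)%C
      + (fam_b t - fam_b t0) * fst p + (fam_e t - fam_e t0) * fst (cexp p)
      + (- (fam_d t * fam_d t) - - (fam_d t0 * fam_d t0)) * fst (cexp (- (1) * p)%C)).
    2: { unfold fam, surf, pt, cx, famW.
         generalize (cexp (- (1) * p)%C) (cexp p). intros E E'. simpl. ring. }
    apply Hsum; apply Hterm; auto; unfold M; lra.
  - replace (_ - _) with ((fam_a t - fam_a t0) * snd (p * p * p)%C
      + (fam_b t - fam_b t0) * snd p + (fam_e t - fam_e t0) * snd (cexp p)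
      + (- (fam_d t * fam_d t) - - (fam_d t0 * fam_d t0)) * snd (cexp (- (1) * p)%C)).
    2: { unfold fam, surf, pt, cy, famW.
         generalize (cexp (- (1) * p)%C) (cexp p). intros E E'. simpl. ring. }
    apply Hsum; apply Hterm; auto; unfold M; lra.
Qed.

(** * Reduction to normal forms *)

Ltac pair_eq := repeat match goal with |- (_, _) = (_, _) => apply f_equal2 end.

(* A null rotation with parameters al, be followed by the rotation by (c, d). *)
Definition parabolic_isometry (al be c d : R) (Y : R31) : R31 :=
  let '(y0, x, y, y3) := Y in
  let s := y0 - y3 in
  let q := al * x + be * y + (al * al + be * be) * s / 2 in
  let x' := x + al * s in
  let y' := y + be * s in
  (y0 + q, c * x' - d * y', d * x' + c * y', y3 + q).

Lemma R31_plus (a b c d a' b' c' d' : R) :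
  plus ((a, b, c, d) : R31) ((a', b', c', d') : R31) = (a + a', b + b', c + c', d + d').
Proof. reflexivity. Qed.
Lemma R31_scal (k a b c d : R) :
  scal k ((a, b, c, d) : R31) = (k * a, k * b, k * c, k * d).
Proof. reflexivity. Qed.

Lemma parabolic_isometry_SO31 al be c d : c * c + d * d = 1 ->
  SO31 (parabolic_isometry al be c d).
Proof.
  intros H. split; [|split; [|split]].
  - intros [[[a0 a1] a2] a3] [[[b0 b1] b2] b3]. rewrite R31_plus. unfold parabolic_isometry.
    rewrite R31_plus. pair_eq; field.
  - intros k [[[a0 a1] a2] a3]. rewrite R31_scal. unfold parabolic_isometry.
    rewrite R31_scal. pair_eq; field.
  - intros [[[a0 a1] a2] a3] [[[b0 b1] b2] b3]. unfold parabolic_isometry, mink.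
    transitivity (- (a0 * b0) + a3 * b3
       + (c * c + d * d - 1) * ((a1 + al * (a0 - a3)) * (b1 + al * (b0 - b3))
                              + (a2 + be * (a0 - a3)) * (b2 + be * (b0 - b3)))
       + a1 * b1 + a2 * b2); [field|].
    rewrite H. ring.
  - unfold parabolic_isometry, det4, det3. transitivity (c * c + d * d); [field|exact H].
Qed.

(** A homothety by k, a null rotation, a rotation and a translation. The null rotation supplies Re
    (m w); the homothety scales l and w alike, whence |mu| = |k|. *)
Lemma similarity_complex (k : R) (mu m : C) (c0 : R) (c1 : C) : k <> 0 -> nrm2 mu = k * k ->
  exists g, similarity g /\ forall (l : R) (w : C), g (l, fst w, snd w) =
    (k * l + fst (m * w)%C + c0, fst (mu * w + c1)%C, snd (mu * w + c1)%C).
Proof.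
  intros Hk Hmu.
  pose (A := parabolic_isometry (fst m / k) (- snd m / k) (fst mu / k) (snd mu / k)).
  pose (h := fun Y : I3 => (cl Y + (fst m / k * cx Y + - snd m / k * cy Y),
    fst mu / k * cx Y - snd mu / k * cy Y, snd mu / k * cx Y + fst mu / k * cy Y) : I3).
  assert (Hh : similarity h).
  { apply (sim_linear A).
    - apply parabolic_isometry_SO31.
      transitivity (nrm2 mu / (k * k)); [unfold nrm2|rewrite Hmu]; field; auto.
    - unfold A, parabolic_isometry, pvec. pair_eq; unfold Rdiv; ring.
    - intros [[l x] y]. unfold A, h, parabolic_isometry, emb, cl, cx, cy. simpl.
      pair_eq; unfold Rdiv; ring. }
  exists (fun Y => plus (h (scal k Y)) ((c0, fst c1, snd c1) : I3)). split.
  - apply (sim_comp (fun Y => plus Y ((c0, fst c1, snd c1) : I3)) (fun Y => h (scal k Y))).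
    + apply sim_translation.
    + apply (sim_comp h (fun Y => scal k Y)); auto. now apply sim_homothety.
  - intros l [x y].
    change (scal k ((l, fst (x, y), snd (x, y)) : I3)) with ((k * l, k * x, k * y) : I3).
    unfold h, cl, cx, cy. simpl.
    match goal with |- plus (?a, ?b, ?c) (?a', ?b', ?c') = _ =>
      change (((a + a', b + b', c + c') : I3) =
       (k * l + (fst m * x - snd m * y) + c0, fst mu * x - snd mu * y + fst c1,
   fst mu * y + snd mu * x + snd c1)) end.
    pair_eq; field; auto.
Qed.

(** * Holomorphic representation of zero mean curvature surfaces *)

Lemma hol_harmonic D f p : open D -> hol D f -> D p ->
  du (du (fun q => fst (f q))) p + dv (dv (fun q => fst (f q))) p = 0 /\
  du (du (fun q => snd (f q))) p + dv (dv (fun q => snd (f q))) p = 0.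
Proof.
  intros HD Hf Hp. assert (Hc := hol_cd D f HD Hf).
  destruct (hol_dv D (cd f) p Hc Hp) as [E1 E2]. simpl in E1, E2.
  change (fun q => du (fun q0 => fst (f q0)) q) with (du (fun q0 => fst (f q0))) in E1, E2.
  change (fun q => du (fun q0 => snd (f q0)) q) with (du (fun q0 => snd (f q0))) in E1, E2.
  split.
  - rewrite (dv_ext D _ (fun q => - du (fun q0 => snd (f q0)) q) p HD Hp).
    + unfold dv. rewrite Derive_opp.
      change (Derive (fun v => du (fun q0 => snd (f q0)) (fst p, v)) (snd p))
        with (dv (du (fun q0 => snd (f q0))) p). rewrite E2. ring.
    + intros q Hq. apply (proj1 (hol_dv D f q Hf Hq)).
  - rewrite (dv_ext D _ (du (fun q0 => fst (f q0))) p HD Hp).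
    + rewrite E1. ring.
    + intros q Hq. apply (proj2 (hol_dv D f q Hf Hq)).
Qed.

Lemma sum_sqr_0 (a b : R) : a * a + b * b = 0 -> a = 0 /\ b = 0.
Proof. intros H. now apply Rplus_sqr_eq_0. Qed.

Lemma conformal_immersed X p : spacelike_conformal_at X p -> immersed_at X p.
Proof.
  intros (H1 & H2 & H3) a b E. rewrite I3_comb in E.
  unfold metric_uu, metric_uv, metric_vv, mink, emb in *.
  destruct (Xu X p) as [[lu xu] yu], (Xv X p) as [[lv xv] yv].
  unfold cl, cx, cy in *; simpl in *. injection E as _ E1 E2.
  assert (Hz : (a * a + b * b) * (xu * xu + yu * yu) = 0).
  { transitivity ((a * xu + b * xv) ^ 2 + (a * yu + b * yv) ^ 2
      - 2 * a * b * (- (lu * lv) + xu * xv + yu * yv + lu * lv)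
      + b * b * ((- (lu * lu) + xu * xu + yu * yu + lu * lu)
         - (- (lv * lv) + xv * xv + yv * yv + lv * lv))); [ring|].
    rewrite E1, E2, H3, H2. ring. }
  apply Rmult_integral in Hz. destruct Hz as [Hz|Hz]; [|lra].
  now apply sum_sqr_0.
Qed.

(** Lagrange's identity gives J^2 = E^2 for the Jacobian J and E = xu^2 + yu^2. For either sign a
    sum of two squares vanishes, which is the Cauchy-Riemann system or its conjugate. *)
Lemma conformal_sign xu yu xv yv : 0 < xu * xu + yu * yu ->
  xu * xu + yu * yu = xv * xv + yv * yv -> xu * xv + yu * yv = 0 ->
  xu * yv - xv * yu <> 0 /\
  (0 < xu * yv - xv * yu -> xv = - yu /\ yv = xu) /\
  (~ 0 < xu * yv - xv * yu -> xv = yu /\ yv = - xu).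
Proof.
  intros H1 H2 H3.
  assert (HJ : ((xu * yv - xv * yu) - (xu * xu + yu * yu)) *
     ((xu * yv - xv * yu) + (xu * xu + yu * yu)) = 0).
  { transitivity ((xu * xu + yu * yu) * ((xv * xv + yv * yv) - (xu * xu + yu * yu))
     - (xu * xv + yu * yv) ^ 2); [ring|]. rewrite H3, H2. ring. }
  apply Rmult_integral in HJ. destruct HJ as [HJ|HJ].
  - split; [lra|]. split; [|lra]. intros _.
    assert (Hs : (xv + yu) * (xv + yu) + (yv - xu) * (yv - xu) = 0) by lra.
    apply sum_sqr_0 in Hs. lra.
  - split; [lra|]. split; [lra|]. intros _.
    assert (Hs : (xv - yu) * (xv - yu) + (yv + xu) * (yv + xu) = 0) by lra.
    apply sum_sqr_0 in Hs. lra.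
Qed.

Lemma surface_representation Sigma X : simply_connected_domain Sigma ->
  smooth_surface Sigma X -> (forall p, Sigma p -> spacelike_conformal_at X p) ->
  zero_mean_curvature Sigma X ->
  exists eps W F, eps * eps = 1 /\ hol Sigma W /\ hol Sigma F /\ X = surf eps W F /\
    forall p, Sigma p -> cd W p <> 0%C.
Proof.
  intros Hsc (Sl & Sx & Sy) Hconf Hzmc. assert (HP := proj1 Hsc). assert (HO := proj1 HP).
  pose (x := fun p => cx (X p)). pose (y := fun p => cy (X p)). pose (l := fun p => cl (X p)).
  fold x in Sx. fold y in Sy. fold l in Sl.
  pose (J := fun p => du x p * dv y p - dv x p * du y p).
  assert (Hsign : forall p, Sigma p -> 0 < du x p * du x p + du y p * du y p /\ J p <> 0 /\
    (0 < J p -> dv x p = - du y p /\ dv y p = du x p) /\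
    (~ 0 < J p -> dv x p = du y p /\ dv y p = - du x p)).
  { intros p Hp. destruct (Hconf p Hp) as (H1 & H2 & H3).
    unfold metric_uu, metric_uv, metric_vv, mink, emb, Xu, Xv, cl, cx, cy in H1, H2, H3.
    simpl in H1, H2, H3.
    change (fun q => snd (fst (X q))) with x in *. change (fun q => snd (X q)) with y in *.
    change (fun q => fst (fst (X q))) with l in *.
    assert (HE : 0 < du x p * du x p + du y p * du y p) by lra.
    split; [exact HE|]. apply conformal_sign; lra. }
  assert (SJ : smooth Sigma J).
  { apply smooth_minus; auto; apply smooth_mult; auto;
      try now apply smooth_du. all: now apply smooth_dv. }
  assert (Hloc : forall p, Sigma p -> exists e : posreal,
     forall a b, ball p e a -> ball p e b -> (0 < J a <-> 0 < J b)).
  { intros p Hp. assert (Hc := smooth_cont _ _ p SJ Hp).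
    destruct (Rle_dec (J p) 0) as [Hle|Hgt].
    - assert (Hlt : J p < 0) by (destruct (Hsign p Hp) as (_ & Hn & _); lra).
      destruct (Hc (fun r => r < 0) (open_lt 0 _ Hlt)) as [e He].
      exists e. intros a b Ha Hb. apply He in Ha. apply He in Hb. lra.
    - assert (Hlt : 0 < J p) by lra.
      destruct (Hc (fun r => 0 < r) (open_gt 0 _ Hlt)) as [e He].
      exists e. intros a b Ha Hb. apply He in Ha. apply He in Hb. lra. }
  (* J is continuous without zeros, so it has one sign on the connected Sigma; eps records it. *)
  assert (Hglob : exists eps, eps * eps = 1 /\ forall p, Sigma p ->
     dv x p = - (eps * du y p) /\ eps * dv y p = du x p).
  { destruct (proj1 (proj2 HP)) as [p0 Hp0].
    destruct (classic (0 < J p0)) as [H0|H0].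
    - exists 1. split; [ring|]. intros p Hp.
      assert (HJ : 0 < J p).
      { apply (path_connected_ind Sigma (fun q => 0 < J q) HP) with (a := p0); auto.
        intros q Hq. destruct (Hloc q Hq) as [e He]. exists e. intros a b Ha Hb.
        now apply He. }
      destruct (Hsign p Hp) as (_ & _ & Hpos & _). destruct (Hpos HJ) as [-> ->]. lra.
    - exists (-1). split; [ring|]. intros p Hp.
      assert (HJ : ~ 0 < J p).
      { apply (path_connected_ind Sigma (fun q => ~ 0 < J q) HP) with (a := p0); auto.
        intros q Hq. destruct (Hloc q Hq) as [e He]. exists e. intros a b Ha Hb.
        rewrite (He a b); auto. }
      destruct (Hsign p Hp) as (_ & _ & _ & Hneg). destruct (Hneg HJ) as [-> ->]. lra. }
  destruct Hglob as (eps & Heps & Hcr).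
  pose (W := fun p => (x p, eps * y p) : C).
  assert (HW : hol Sigma W).
  { apply hol_cr.
    - split; [exact Sx|]. apply smooth_mult; auto. now apply smooth_const.
    - intros p Hp. unfold W; simpl. change (fun q => x q) with x.
      destruct (Hcr p Hp) as [E1 E2]. unfold du at 1 , dv at 2. rewrite !Derive_scal.
      split; [exact E1|exact E2]. }
  (* As x and y are already harmonic, <X_uu + X_vv, n> reduces to the Laplacian of l times <n, pvec>
     = 1. *)
  assert (Hlap : forall p, Sigma p -> du (du l) p + dv (dv l) p = 0).
  { intros p Hp.
    destruct (Hzmc p Hp (conformal_immersed X p (Hconf p Hp))) as [_ [n [(_ & _ & _ & Hn) Hmc]]].
    destruct (hol_harmonic Sigma W p HO HW Hp) as [Lx _].
    destruct (hol_harmonic Sigma (fun q => - Ci * eps * W q)%C p HO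
       (hol_scal _ _ _ HO HW) Hp) as [Ly _].
    assert (Ex : (fun q => fst (W q)) = x) by reflexivity.
    assert (Ey : (fun q => fst (- Ci * eps * W q)%C) = y).
    { apply functional_extensionality. intros q. unfold W; simpl.
      transitivity (eps * eps * y q); [ring|rewrite Heps; ring]. }
    rewrite Ex in Lx. rewrite Ey in Ly.
    destruct (Hsign p Hp) as (HE & _).
    destruct (Hconf p Hp) as (HE' & _).
    unfold mean_curvature in Hmc. apply Rmult_integral in Hmc. destruct Hmc as [Hmc|Hmc].
    { exfalso. apply Rmult_integral in Hmc. destruct Hmc as [Hmc|Hmc]; [lra|].
      assert (0 < / metric_uu X p) by now apply Rinv_0_lt_compat. lra. }
    destruct n as [[[n0 n1] n2] n3].
    unfold mink, emb, Xuu, Xvv, Xu, Xv, cl, cx, cy, pvec in Hmc, Hn. simpl in Hmc, Hn.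
    change (fun q => snd (fst (X q))) with x in *. change (fun q => snd (X q)) with y in *.
    change (fun q => fst (fst (X q))) with l in *.
    change (fun q => du x q) with (du x) in *. change (fun q => dv x q) with (dv x) in *.
    change (fun q => du y q) with (du y) in *. change (fun q => dv y q) with (dv y) in *.
    change (fun q => du l q) with (du l) in *. change (fun q => dv l q) with (dv l) in *.
    assert (E : (du (du l) p + dv (dv l) p) * (- (n0 * 1) + n1 * 0 + n2 * 0 + n3 * 1)
      + (du (du x) p + dv (dv x) p) * n1 + (du (du y) p + dv (dv y) p) * n2 = 0)
      by (etransitivity; [|exact Hmc]; ring).
    rewrite Lx, Ly, Hn in E. lra. }
  destruct (harmonic_hol Sigma l Hsc Sl Hlap) as [F [HF EF]].
  exists eps, W, F. split; [exact Heps|]. split; [exact HW|]. split; [exact HF|]. split.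
  - apply functional_extensionality. intros q. unfold surf, pt, W; simpl. rewrite EF.
    rewrite <- Rmult_assoc, Heps, Rmult_1_l. unfold l, x, y. destruct (X q) as [[? ?] ?].
    reflexivity.
  - intros p Hp E. destruct (Hsign p Hp) as (HE & _). unfold cd in E. injection E as E1 E2.
    unfold W in E1, E2; simpl in E1, E2. change (fun q => x q) with x in E1.
    unfold du in E2. rewrite Derive_scal in E2.
    change (Derive (fun u => y (u, snd p)) (fst p)) with (du y p) in E2.
    assert (E3 : du y p = 0).
    { transitivity (eps * (eps * du y p)); [rewrite <- Rmult_assoc, Heps; ring|].
      rewrite E2. ring. }
    rewrite E1, E3 in HE. lra.
Qed.

(** If r' = 0 then F'' = W'' r, and all three determinants vanish. Thus nondegeneracy keeps r' away
    from 0, so that it has a logarithm. *)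
Lemma surf_degenerate D eps W F r p : open D -> hol D W -> hol D F -> hol D r -> D p ->
  (forall q, D q -> cd F q = cd W q * r q)%C -> cd r p = 0%C -> aff_disc (surf eps W F) p = 0.
Proof.
  intros HO HW HF Hr Hp E Hr0.
  assert (HW2 := hol_hd _ _ _ (hol_cd D W HO HW) Hp).
  assert (HF2 : is_hd (cd F) p (cd (cd W) p * r p + cd W p * cd r p)%C).
  { apply (is_hd_ext D (fun q => cd W q * r q)%C); auto.
    - intros q Hq. symmetry; auto.
    - apply is_hd_mult; auto. now apply (hol_hd D). }
  destruct (surf_second eps D W F (cd W) (cd F) p _ _ HO Hp
    (fun q Hq => hol_hd D W q HW Hq) (fun q Hq => hol_hd D F q HF Hq) HW2 HF2) as (E1 & E2 & E3).
  unfold aff_disc, aff_L, aff_M, aff_N. rewrite E1, E2, E3.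
  rewrite (Xu_surf eps W F p _ _ (hol_hd D W p HW Hp) (hol_hd D F p HF Hp)).
  rewrite (Xv_surf eps W F p _ _ (hol_hd D W p HW Hp) (hol_hd D F p HF Hp)).
  rewrite Hr0, (E p Hp).
  set (w := cd W p). set (w2 := cd (cd W) p).
  rewrite det3_surf.
  replace (Ci * (w2 * r p + w * 0))%C with ((Ci * w2) * r p + 0)%C by ring.
  rewrite det3_surf. simpl. ring.
Qed.

(** b and P are a square root of W' r' and a fourth root of W' / r', built from the same two
    logarithms; so b P^2 = W' and P^2 r' = b hold without any choice of sign. With P2 = r P, the
    latter is the Wronskian relation. *)
Lemma weierstrass_data D eps W F : simply_connected_domain D -> hol D W -> hol D F ->
  (forall q, D q -> cd W q <> 0%C) -> (forall q, D q -> nondegenerate_at (surf eps W F) q) ->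
  exists b P p P2 p2 k : C -> C, hol D b /\ hol D P /\ hol D k /\
    forall q, D q ->
      (is_hd W q (b q * (P q * P q)) /\ is_hd F q (b q * (P q * P2 q)) /\
      is_hd P q (b q * p q) /\ is_hd p q (b q * (k q * P q)) /\ is_hd P2 q (b q * p2 q) /\
      P q * p2 q - p q * P2 q = 1 /\ b q <> 0 /\ P q <> 0)%C.
Proof.
  intros Hsc HW HF HW0 Hnd. assert (HP := proj1 Hsc). assert (HO := proj1 HP).
  assert (HW1 := hol_cd D W HO HW). assert (HF1 := hol_cd D F HO HF).
  pose (r := fun q => (cd F q / cd W q)%C).
  assert (Hr : hol D r) by now apply hol_div.
  assert (Er : forall q, D q -> (cd F q = cd W q * r q)%C)
    by (intros q Hq; unfold r; field; now apply HW0).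
  assert (Hr0 : forall q, D q -> cd r q <> 0%C).
  { intros q Hq E. apply (Hnd q Hq). now apply (surf_degenerate D eps W F r). }
  destruct (hol_log D (cd W) Hsc HW1 HW0) as [LW [HLW EW]].
  destruct (hol_log D (cd r) Hsc (hol_cd D r HO Hr) Hr0) as [Lr [HLr Elr]].
  pose (b := fun q => cexp (/ 2 * (LW q + Lr q))%C).
  pose (P := fun q => cexp (/ 4 * (LW q - Lr q))%C).
  assert (Hb : hol D b) by (apply hol_exp; auto; apply hol_scal; auto; now apply hol_plus).
  assert (HPh : hol D P) by (apply hol_exp; auto; apply hol_scal; auto; now apply hol_minus).
  assert (Hb0 : forall q, D q -> b q <> 0%C) by (intros; apply cexp_neq_0).
  assert (HP0 : forall q, D q -> P q <> 0%C) by (intros; apply cexp_neq_0).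
  pose (p := fun q => (cd P q / b q)%C).
  assert (Hp : hol D p) by (apply hol_div; auto; now apply hol_cd).
  pose (k := fun q => (cd p q / (b q * P q))%C).
  assert (Hk : hol D k).
  { apply hol_div; auto; [now apply hol_cd|now apply hol_mult|].
    intros q Hq. apply Cmult_neq_0; auto. }
  pose (P2 := fun q => (r q * P q)%C).
  assert (HP2 : hol D P2) by now apply hol_mult.
  exists b, P, p, P2, (fun q => cd P2 q / b q)%C, k.
  repeat (split; [assumption|]). intros q Hq.
  assert (EWb : cd W q = (b q * (P q * P q))%C).
  { rewrite EW by auto. unfold b, P. rewrite <- !cexp_plus. f_equal. field. }
  assert (Erb : (P q * P q * cd r q = b q)%C).
  { rewrite Elr by auto. unfold b, P. rewrite <- !cexp_plus. f_equal. field. }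
  assert (Hbq := Hb0 q Hq). assert (HPq := HP0 q Hq).
  split; [|split; [|split; [|split; [|split; [|split; [|split; auto]]]]]].
  - rewrite <- EWb. now apply (hol_hd D).
  - replace (b q * (P q * P2 q))%C with (cd F q); [now apply (hol_hd D)|].
    rewrite Er, EWb by auto. unfold P2. ring.
  - replace (b q * p q)%C with (cd P q) by (unfold p; field; auto). now apply (hol_hd D).
  - replace (b q * (k q * P q))%C with (cd p q) by (unfold k; field; auto). now apply (hol_hd D).
  - replace (b q * (cd P2 q / b q))%C with (cd P2 q) by (field; auto). now apply (hol_hd D).
  - assert (E2 : cd P2 q = (cd r q * P q + r q * cd P q)%C).
    { apply is_hd_cd, is_hd_mult; now apply (hol_hd D). }
    rewrite E2. unfold p, P2. rewrite <- Erb.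
    assert (Hrq := Hr0 q Hq). field; auto.
Qed.

(** * Normal forms of the nondegenerate surfaces *)

Lemma nrm2_inv (z : C) : z <> 0%C -> nrm2 (/ z)%C = / nrm2 z.
Proof.
  intros Hz. assert (H := C_norm2_pos z Hz). destruct z; unfold nrm2; simpl in *.
  field. repeat split; nra.
Qed.
Lemma nrm2_RtoC (x : R) : nrm2 x = x * x.
Proof. unfold nrm2; simpl. ring. Qed.

(** Choose q along the conjugate of d. This makes the parameter of the last type nonnegative while
    |q| is prescribed by the similarity. *)
Lemma exists_mult_nonneg (d : C) (T : R) : 0 < T -> exists q : C, q <> 0%C /\ nrm2 q = T /\
  exists x : R, 0 <= x /\ (d * q)%C = x.
Proof.
  intros HT. destruct (classic (d = 0%C)) as [->|Hd].
  - exists (RtoC (sqrt T)). split; [apply RtoC_neq_0; assert (H := sqrt_lt_R0 T HT); lra|].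
    split; [rewrite nrm2_RtoC; apply sqrt_sqrt; lra|]. exists 0. split; [lra|ring].
  - assert (HN := C_norm2_pos d Hd). fold (nrm2 d) in HN.
    assert (HTN : 0 < T / nrm2 d) by now apply Rdiv_lt_0_compat.
    pose (s := sqrt (T / nrm2 d)). assert (Hs : 0 < s) by now apply sqrt_lt_R0.
    assert (Hs2 : s * s = T / nrm2 d) by (apply sqrt_sqrt; lra).
    exists (s * Cconj d)%C. split; [|split].
    + apply Cmult_neq_0; [apply RtoC_neq_0; lra|now apply conj_neq_0].
    + rewrite nrm2_mult, nrm2_RtoC, Hs2.
      replace (nrm2 (Cconj d)) with (nrm2 d) by (unfold nrm2; simpl; ring). field. lra.
    + exists (s * nrm2 d). split; [nra|]. rewrite RtoC_mult, nrm2_conj. ring.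
Qed.

(* Up to the real-linear term [fst (m * W)], which an isometry absorbs, the
   surface is the member [t] of the family in the coordinate [phi]. *)
Definition normal_form (D : C -> Prop) (W F : C -> C) : Prop :=
  exists (t k : R) (mu m c0 c1 : C) (phi : C -> C), hol D phi /\ k <> 0 /\ nrm2 mu = k * k /\
    (t <= 0 \/ 1 <= t) /\
    forall q, D q -> cd phi q <> 0%C /\ famW t (phi q) = (mu * W q + c1)%C /\
      famF t (phi q) = (k * F q + m * W q + c0)%C.

Section NormalForm.

Variables (D : C -> Prop) (W F b P p P2 p2 z : C -> C).
Hypotheses (HD : plane_domain D) (Hz : hol D z) (Hzb : forall q, D q -> is_hd z q (b q))
  (HW : forall q, D q -> is_hd W q (b q * (P q * P q))%C)
  (HF : forall q, D q -> is_hd F q (b q * (P q * P2 q))%C)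
  (HP : forall q, D q -> is_hd P q (b q * p q)%C)
  (HP2 : forall q, D q -> is_hd P2 q (b q * p2 q)%C)
  (Hwr : forall q, D q -> (P q * p2 q - p q * P2 q = 1)%C)
  (Hb0 : forall q, D q -> b q <> 0%C) (HP0 : forall q, D q -> P q <> 0%C).

Lemma cd_scal_z (c : C) q : D q -> c <> 0%C -> cd (fun q => c * z q)%C q <> 0%C.
Proof.
  intros Hq Hc. rewrite (is_hd_cd _ q (c * b q)%C); [apply Cmult_neq_0; auto|].
  apply is_hd_scal; auto.
Qed.

Lemma normal_form_paraboloid : (forall q, D q -> p q = 0%C) -> normal_form D W F.
Proof.
  intros Hp0. assert (HO := proj1 HD). destruct (proj1 (proj2 HD)) as [q0 Hq0].
  destruct (hd_zero_const D P HD) as [a Ea].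
  { intros q Hq. eapply is_hd_eq; [apply HP; auto|]. rewrite Hp0 by auto. ring. }
  assert (Ha : a <> 0%C) by (rewrite <- (Ea q0 Hq0); auto).
  destruct (hd_same_const D W (fun q => a * a * z q)%C _ HD HW) as [w0 Ew].
  { intros q Hq. eapply is_hd_eq; [apply is_hd_scal, Hzb; auto|]. rewrite Ea by auto. ring. }
  assert (Ep2 : forall q, D q -> (p2 q = / a)%C).
  { intros q Hq. specialize (Hwr q Hq). rewrite Hp0, Ea in Hwr by auto.
    transitivity ((a * p2 q - 0 * P2 q) / a)%C; [field; auto|]. rewrite Hwr. field; auto. }
  destruct (hd_same_const D P2 (fun q => / a * z q)%C _ HD HP2) as [c E2].
  { intros q Hq. eapply is_hd_eq; [apply is_hd_scal, Hzb; auto|]. rewrite Ep2 by auto. ring. }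
  destruct (hd_same_const D F (fun q => / 2 * (z q * z q) + c * a * z q)%C _ HD HF) as [f0 Ef].
  { intros q Hq. eapply is_hd_eq; [apply is_hd_plus; [apply is_hd_scal, is_hd_mult; apply Hzb; auto|
      apply is_hd_scal, Hzb; auto]|]. rewrite Ea, E2 by auto. field; auto. }
  pose (N := nrm2 a). assert (HN : 0 < N) by now apply C_norm2_pos.
  (* Up to terms absorbed by the similarity, W = a^2 z and F = z^2 / 2. For phi = nu z one needs mu
     = nu / a^2, nu^2 = k / 2 and |mu| = k, whose solution is k = 1 / (2 |a|^4). *)
  pose (kk := / (2 * (N * N))).
  assert (Hkk : 0 < kk) by (apply Rinv_0_lt_compat; nra).
  pose (nu := sqrt (kk / 2)).
  assert (Hnu : 0 < nu) by (apply sqrt_lt_R0; lra).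
  assert (Hnu2 : nu * nu = kk / 2) by (apply sqrt_sqrt; lra).
  assert (HnuC : (nu * nu = kk / 2)%C).
  { rewrite <- RtoC_mult, Hnu2. unfold Rdiv. rewrite RtoC_mult, RtoC_inv by lra. reflexivity. }
  assert (Hnu0 : RtoC nu <> 0%C) by (apply RtoC_neq_0; lra).
  exists (-1), kk, (nu / (a * a))%C, (- (kk * c / a))%C, (- kk * f0 + kk * c / a * w0)%C,
    (- (nu / (a * a)) * w0)%C, (fun q => nu * z q)%C.
  split; [now apply hol_scal|]. split; [lra|]. split; [|split; [lra|]].
  - unfold Cdiv. rewrite nrm2_mult, nrm2_inv, nrm2_mult, nrm2_RtoC by now apply Cmult_neq_0.
    rewrite Hnu2. fold N. unfold kk. field. lra.
  - intros q Hq. split; [now apply cd_scal_z|].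
    destruct (fam_regions (-1)) as [H|[H|[(_ & Ra & Rb & Re & Rd & R2 & R1)|[H|H]]]];
      try (exfalso; lra).
    replace (-1 + 1) with 0 in R1 by ring. rewrite Rabs_R0, Rminus_0_r in R1.
    unfold famW, famF. rewrite Ra, Rb, Re, Rd, R2, R1, Rmult_0_l, Ew, Ef by auto. split.
    + field; auto.
    + transitivity ((nu * nu) * (z q * z q))%C; [ring|]. rewrite HnuC. field; auto.
Qed.

Lemma normal_form_cuspidal (a : C) : a <> 0%C -> (forall q, D q -> p q = a) -> normal_form D W F.
Proof.
  intros Ha Hpa. assert (HO := proj1 HD).
  destruct (hd_same_const D P (fun q => a * z q)%C _ HD HP) as [e0 Ee].
  { intros q Hq. eapply is_hd_eq; [apply is_hd_scal, Hzb; auto|]. rewrite Hpa by auto. ring. }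
  pose (y := fun q => (z q + e0 / a)%C).
  assert (Hy : hol D y) by (apply hol_plus; auto; now apply hol_const).
  assert (Hyb : forall q, D q -> is_hd y q (b q)).
  { intros q Hq. eapply is_hd_eq; [apply is_hd_plus; [apply Hzb; auto|apply is_hd_const]|]. ring. }
  assert (EP : forall q, D q -> (P q = a * y q)%C).
  { intros q Hq. rewrite Ee by auto. unfold y. field; auto. }
  assert (H3 : RtoC 3 <> 0%C) by (apply RtoC_neq_0; lra).
  destruct (hd_same_const D W (fun q => a * a / 3 * (y q * y q * y q))%C _ HD HW) as [w0 Ew].
  { intros q Hq. eapply is_hd_eq;
     [apply is_hd_scal; apply (is_hd_mult (fun q => y q * y q)%C y); [apply is_hd_mult|]; apply Hyb; auto|].
    rewrite EP by auto. field; auto. }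
  (* P and P2 + 1/a have Wronskian 0, so P2 = c P - 1/a. The multiple c P contributes c W to F,
     which a null rotation removes. *)
  destruct (hd_zero_const D (fun q => (P2 q + / a) * / P q)%C HD) as [c Ec].
  { intros q Hq. assert (HPq := HP0 q Hq). eapply is_hd_eq;
      [apply is_hd_mult; [apply is_hd_plus; [apply HP2; auto|apply is_hd_const]|
        apply is_hd_inv; [apply HP; auto|auto]]|].
    cbv beta. specialize (Hwr q Hq). rewrite Hpa in * by auto.
    transitivity (b q * ((P q * p2 q - a * P2 q) - 1) / (P q * P q))%C; [field; auto|].
    rewrite Hwr. field; auto. }
  destruct (hd_same_const D F (fun q => c * W q + - / 2 * (y q * y q))%C _ HD HF) as [f0 Ef].
  { intros q Hq. assert (HPq := HP0 q Hq). eapply is_hd_eq; [apply is_hd_plus;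
      [apply is_hd_scal, HW; auto|apply is_hd_scal, is_hd_mult; apply Hyb; auto]|].
    rewrite <- (Ec q Hq).
    transitivity (b q * (P q * P2 q) + b q * (P q / a - y q))%C; [field; auto|].
    rewrite EP by auto. field; auto. }
  pose (N := nrm2 a). assert (HN : 0 < N) by now apply C_norm2_pos.
  (* Matching phi^3 with mu (a^2 / 3) y^3 and phi^2 with - k y^2 / 2 for phi = nu y gives mu = 3
     nu^3 / a^2 and k = -2 nu^2; then |mu| = |k| forces nu = 2 |a|^2 / 3. *)
  pose (nu := 2 * N / 3). assert (Hnu : 0 < nu) by (unfold nu; lra).
  assert (Hnu0 : RtoC nu <> 0%C) by (apply RtoC_neq_0; lra).
  pose (kk := - (2 * (nu * nu))).
  assert (Ekk : (RtoC kk = - (2 * (nu * nu)))%C)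
    by (unfold kk; now rewrite RtoC_opp, !RtoC_mult).
  pose (mu := (3 * (nu * nu * nu) / (a * a))%C).
  exists (-4), kk, mu, (- kk * c)%C, (- kk * f0)%C, (- mu * w0)%C, (fun q => nu * y q)%C.
  split; [now apply hol_scal|]. split; [unfold kk; nra|]. split; [|split; [lra|]].
  - unfold mu, Cdiv. rewrite !nrm2_mult, nrm2_inv, nrm2_mult, !nrm2_RtoC by now apply Cmult_neq_0.
    fold N. unfold kk, nu. field. lra.
  - intros q Hq. split.
    { rewrite (is_hd_cd _ q (nu * b q)%C); [apply Cmult_neq_0; auto|].
      apply is_hd_scal; auto. }
    destruct (fam_regions (-4)) as [(_ & Ra & Rb & Re & Rd & R2 & R1)|[H|[H|[H|H]]]];
      try (exfalso; lra).
    replace (-3 - -4) with 1 in R1 by ring.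
    unfold famW, famF. rewrite Ra, Rb, Re, Rd, R2, R1, Rmult_0_l, Ekk, Ef, Ew by auto. split.
    + unfold mu. field; auto.
    + field; auto.
Qed.

(** p + s P and p - s P are eigenfunctions of d/d zeta for s and - s, so P = A E + B / E with E =
    e^(s zeta). The last hypothesis makes A nonzero. *)
Lemma normal_form_helicoidal (s : C) (c : R) : c <> 0 -> (s * s = Ci * c)%C ->
  (forall q, D q -> is_hd p q (b q * (s * s * P q))%C) ->
  (exists q0, D q0 /\ (p q0 + s * P q0 <> 0)%C) -> normal_form D W F.
Proof.
  intros Hc Hs Hp [q0 [Hq0 Hu0]]. assert (HO := proj1 HD).
  assert (HCi : Ci <> 0%C) by (intros E; injection E; lra).
  assert (HcC := RtoC_neq_0 c Hc).
  assert (Hs0 : s <> 0%C).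
  { intros ->. apply (Cmult_neq_0 Ci c HCi HcC). rewrite <- Hs. ring. }
  pose (E := fun q => cexp (s * z q)).
  assert (HE : forall q, D q -> is_hd E q (s * b q * E q)%C).
  { intros q Hq. apply is_hd_exp, is_hd_scal; auto. }
  assert (HE0 : forall q, E q <> 0%C) by (intros; apply cexp_neq_0).
  assert (HEi : forall q, D q -> is_hd (fun q => / E q)%C q (- s * b q * / E q)%C).
  { intros q Hq. eapply is_hd_eq; [apply is_hd_inv; [apply HE; auto|apply HE0]|]. field. apply HE0. }
  destruct (hd_zero_const D (fun q => (p q + s * P q) * / E q)%C HD) as [u Eu].
  { intros q Hq. eapply is_hd_eq; [apply is_hd_mult; [apply is_hd_plus; [apply Hp; auto|
      apply is_hd_scal, HP; auto]|apply HEi; auto]|]. cbv beta. field. apply HE0. }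
  destruct (hd_zero_const D (fun q => (p q + - s * P q) * E q)%C HD) as [v Ev].
  { intros q Hq. eapply is_hd_eq; [apply is_hd_mult; [apply is_hd_plus; [apply Hp; auto|
      apply is_hd_scal, HP; auto]|apply HE; auto]|]. cbv beta. ring. }
  assert (H2 : RtoC 2 <> 0%C) by (apply RtoC_neq_0; lra).
  assert (Hu : u <> 0%C).
  { rewrite <- (Eu q0 Hq0). apply Cmult_neq_0; auto.
    intros E0. apply (HE0 q0). transitivity (/ E q0 * E q0 * E q0)%C; [field; auto|].
    rewrite E0. ring. }
  pose (A := (u / (2 * s))%C). pose (B := (- v / (2 * s))%C).
  assert (HA : A <> 0%C).
  { unfold A. intros E0. apply Hu. transitivity (u / (2 * s) * (2 * s))%C; [field; auto|].
    rewrite E0. ring. }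
  assert (EP : forall q, D q -> (P q = A * E q + B * / E q)%C).
  { intros q Hq. assert (HEq := HE0 q). unfold A, B. rewrite <- (Eu q Hq), <- (Ev q Hq).
    field; auto. }
  assert (Ep : forall q, D q -> (p q = s * (A * E q - B * / E q))%C).
  { intros q Hq. assert (HEq := HE0 q). unfold A, B. rewrite <- (Eu q Hq), <- (Ev q Hq).
    field; auto. }
  destruct (hd_same_const D W (fun q => A * A / (2 * s) * (E q * E q) + 2 * A * B * z q
     + - (B * B) / (2 * s) * (/ E q * / E q))%C _ HD HW) as [w0 Ew].
  { intros q Hq. assert (HEq := HE0 q). eapply is_hd_eq; [apply is_hd_plus; [apply is_hd_plus;
      [apply is_hd_scal, is_hd_mult; apply HE; auto|apply is_hd_scal, Hzb; auto]
      |apply is_hd_scal, is_hd_mult; apply HEi; auto]|].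
    rewrite EP by auto. field; auto. }
  (* A particular partner of P with Wronskian 1 is - 1 / (2 s A E); P2 differs from it by a constant
     multiple e P, which contributes e W to F. *)
  destruct (hd_zero_const D (fun q => (P2 q + / (2 * s * A) * / E q) * / P q)%C HD) as [e Ee].
  { intros q Hq. assert (HPq := HP0 q Hq). assert (HEq := HE0 q).
    eapply is_hd_eq; [apply is_hd_mult; [apply is_hd_plus;
      [apply HP2; auto|apply is_hd_scal, HEi; auto]|apply is_hd_inv; [apply HP; auto|auto]]|].
    cbv beta.
    transitivity (b q * ((P q * p2 q - p q * P2 q) - (P q * s + p q) / (2 * s * A * E q))
       / (P q * P q))%C; [field; auto|].
    rewrite (Hwr q Hq).
    replace (P q * s + p q)%C with (2 * s * A * E q)%C
      by (rewrite EP, Ep by auto; field; auto).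
    field; auto. }
  destruct (hd_same_const D F (fun q => e * W q + - / (2 * s) * z q
     + B / (4 * s * s * A) * (/ E q * / E q))%C _ HD HF) as [f0 Ef].
  { intros q Hq. assert (HPq := HP0 q Hq). assert (HEq := HE0 q). eapply is_hd_eq; [apply is_hd_plus; [apply is_hd_plus;
      [apply is_hd_scal, HW; auto|apply is_hd_scal, Hzb; auto]
      |apply is_hd_scal, is_hd_mult; apply HEi; auto]|].
    rewrite <- (Ee q Hq).
    transitivity (b q * (P q * P2 q) + b q / (2 * s * A * E q) * (P q - A * E q - B * / E q))%C;
      [field; auto|].
    replace (P q - A * E q - B * / E q)%C with (RtoC 0) by (rewrite EP by auto; ring). ring. }
  pose (NA := nrm2 A). assert (HNA : 0 < NA) by now apply C_norm2_pos.
  pose (Ns := nrm2 s). assert (HNs : 0 < Ns) by now apply C_norm2_pos.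
  (* With e^phi = x E^2, matching W gives mu = 2 s x / A^2 and d = - x B / A, and matching F gives k
     = 4 i s^2 = - 4 c. Then |mu| = |k| prescribes |x|^2, and d >= 0 its argument. *)
  destruct (exists_mult_nonneg (- B / A)%C (16 * c * c * (NA * NA) / (4 * Ns))) as (x & Hx0 & Hx & d & Hd & Ed).
  { assert (Hcc : 0 < c * c) by now apply Rsqr_pos_lt.
    assert (HNA2 : 0 < NA * NA) by nra.
    apply Rdiv_lt_0_compat; [|lra]. rewrite (Rmult_assoc 16). nra. }
  destruct (cexp_surj x Hx0) as [e0 He0].
  pose (mu := (x * (2 * s / (A * A)))%C).
  pose (phi := fun q => (2 * s * z q + e0)%C).
  exists (2 + d), (- (4 * c)), mu, (4 * c * e)%C, (4 * c * f0 - Ci * e0)%C,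
    (- mu * w0 - 2 * d * e0)%C, phi.
  split; [apply hol_plus; auto; [now apply hol_scal|now apply hol_const]|].
  split; [lra|]. split; [|split; [lra|]].
  - unfold mu, Cdiv. rewrite !nrm2_mult, nrm2_inv, nrm2_mult, Hx, nrm2_RtoC by now apply Cmult_neq_0.
    fold NA Ns. field. lra.
  - intros q Hq. assert (HEq := HE0 q). split.
    { rewrite (is_hd_cd _ q (2 * s * b q)%C).
      - apply Cmult_neq_0; auto. now apply Cmult_neq_0.
      - eapply is_hd_eq; [apply is_hd_plus; [apply is_hd_scal, Hzb; auto|apply is_hd_const]|]. ring. }
    destruct (fam_regions (2 + d)) as [H|[H|[H|[H|(_ & Ra & Rb & Re & Rd & R2 & R1)]]]];
      try (exfalso; lra).
    assert (Edd : fam_d (2 + d) = d) by (unfold fam_d; rewrite Rmax_right; lra).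
    rewrite Rmin_left in R2 by lra.
    assert (Ephi : cexp (phi q) = (x * (E q * E q))%C).
    { unfold phi, E. rewrite cexp_plus, He0, <- cexp_plus, Cmult_comm.
      do 2 f_equal. ring. }
    assert (Ephi' : cexp (- (1) * phi q)%C = (/ x * (/ E q * / E q))%C).
    { replace (- (1) * phi q)%C with (- phi q)%C by ring. rewrite cexp_opp, Ephi. field; auto. }
    unfold famW, famF. rewrite Ra, Rb, Re, R2, R1, Edd, Ephi, Ephi', RtoC_opp, !RtoC_mult, <- Ed.
    unfold phi, mu. rewrite Ef, Ew by auto. split.
    + field; auto.
    + rewrite RtoC_opp, RtoC_mult.
      assert (Ec : RtoC c = (- Ci * (s * s))%C).
      { rewrite Hs. apply injective_projections; simpl; ring. }
      rewrite Ec. field; auto.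
Qed.

End NormalForm.

Lemma affine_minimal_normal_form D eps W F : simply_connected_domain D -> eps * eps = 1 ->
  hol D W -> hol D F -> (forall q, D q -> cd W q <> 0%C) ->
  (forall q, D q -> nondegenerate_at (surf eps W F) q /\
     zero_affine_mean_curvature_at (surf eps W F) q) ->
  normal_form D W F.
Proof.
  intros Hsc Heps HW HF HW0 Hmin. assert (HD := proj1 Hsc). assert (HO := proj1 HD).
  destruct (weierstrass_data D eps W F Hsc HW HF HW0 (fun q Hq => proj1 (Hmin q Hq)))
    as (b & P & p & P2 & p2 & k & Hb & HP & Hk & Hdata).
  assert (HWd : forall q, D q -> is_hd W q (b q * (P q * P q))%C) by apply Hdata.
  assert (HFd : forall q, D q -> is_hd F q (b q * (P q * P2 q))%C) by apply Hdata.
  assert (HPd : forall q, D q -> is_hd P q (b q * p q)%C) by apply Hdata.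
  assert (Hpd : forall q, D q -> is_hd p q (b q * (k q * P q))%C) by apply Hdata.
  assert (HP2d : forall q, D q -> is_hd P2 q (b q * p2 q)%C) by apply Hdata.
  assert (Hwr : forall q, D q -> (P q * p2 q - p q * P2 q = 1)%C) by apply Hdata.
  assert (Hb0 : forall q, D q -> b q <> 0%C) by apply Hdata.
  assert (HP0 : forall q, D q -> P q <> 0%C) by apply Hdata.
  clear Hdata.
  assert (Hk0 : forall q, D q -> fst (k q) = 0).
  { intros q Hq.
    apply (surf_affine_minimal_at D eps W F b (cd b) P p P2 p2 k); auto.
    - intros; now apply (hol_hd D).
    - now apply Hmin. }
  destruct (hd_zero_const D k HD) as [k0 Ek].
  { intros q Hq. eapply is_hd_eq; [now apply (hol_hd D)|].
    assert (Hdv := proj1 (hol_dv D k q Hk Hq)).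
    assert (Edu : du (fun q => fst (k q)) q = 0).
    { rewrite (du_ext D _ (fun _ => 0) q HO Hq); auto. exact (Derive_const 0 (fst q)). }
    assert (Edv : dv (fun q => fst (k q)) q = 0).
    { rewrite (dv_ext D _ (fun _ => 0) q HO Hq); auto. exact (Derive_const 0 (snd q)). }
    apply injective_projections; [exact Edu|]. rewrite Edv in Hdv. simpl in *. lra. }
  destruct (proj1 (proj2 HD)) as [q0 Hq0].
  assert (Ek0 : k0 = (Ci * snd k0)%C).
  { assert (E0 := Hk0 q0 Hq0). rewrite (Ek q0 Hq0) in E0.
    apply injective_projections; simpl; lra. }
  destruct (hol_primitive D b Hsc Hb) as [z [Hz Hzb]].
  destruct (Req_dec (snd k0) 0) as [Hc|Hc].
  - assert (Ek00 : k0 = 0%C) by (rewrite Ek0, Hc; ring).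
    destruct (hd_zero_const D p HD) as [a Ea].
    { intros q Hq. eapply is_hd_eq; [apply Hpd; auto|]. rewrite Ek, Ek00 by auto. ring. }
    destruct (classic (a = 0%C)) as [->|Ha].
    + now apply (normal_form_paraboloid D W F b P p P2 p2 z).
    + now apply (normal_form_cuspidal D W F b P p P2 p2 z) with (a := a).
  - destruct (csqrt_exists k0) as [s Hs].
    assert (Hpd' : forall q, D q -> is_hd p q (b q * (s * s * P q))%C).
    { intros q Hq. rewrite Hs, <- (Ek q Hq). auto. }
    (* As P does not vanish at q0, p + s P and p - s P cannot both be 0 there; if the first is, - s
       takes the place of s. *)
    destruct (classic (p q0 + s * P q0 = 0)%C) as [E|E].
    + apply (normal_form_helicoidal D W F b P p P2 p2 z) with (s := (- s)%C) (c := snd k0); auto.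
      * rewrite <- Ek0, <- Hs. ring.
      * intros q Hq. eapply is_hd_eq; [apply Hpd'; auto|]. ring.
      * exists q0. split; auto. intros E'.
        assert (Hs0 : s <> 0%C).
        { intros ->. apply Hc. replace k0 with (RtoC 0) by (rewrite <- Hs; ring). reflexivity. }
        apply (Cmult_neq_0 s (P q0)); auto.
        transitivity (/ 2 * ((p q0 + s * P q0) - (p q0 + - s * P q0)))%C; [field|].
        rewrite E, E'. ring.
    + apply (normal_form_helicoidal D W F b P p P2 p2 z) with (s := s) (c := snd k0); auto.
      * now rewrite <- Ek0.
      * now exists q0.
Qed.

(** * Orientation reversal, planes and the conclusion *)

Lemma cexp_conj z : cexp (Cconj z) = Cconj (cexp z).
Proof.
  unfold cexp, Cconj; simpl. rewrite cos_neg, sin_neg. apply injective_projections; simpl; ring.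
Qed.

(** W has real coefficients. Under conjugation the z^2 term of Re F is even, while the terms with a
    factor i are odd; the two kinds never occur together. *)
Lemma fam_conj t : t <= 0 \/ 1 <= t -> exists sg, sg * sg = 1 /\ forall w,
  famW t (Cconj w) = Cconj (famW t w) /\ fst (famF t (Cconj w)) = sg * fst (famF t w).
Proof.
  intros Ht.
  assert (HW : forall w, famW t (Cconj w) = Cconj (famW t w)).
  { intros w. unfold famW. rewrite cexp_conj.
    replace (- (1) * Cconj w)%C with (Cconj (- (1) * w)) by
      (apply injective_projections; simpl; ring).
    rewrite cexp_conj. generalize (cexp w) (cexp (- (1) * w)%C). intros E E'.
    apply injective_projections; simpl; ring. }
  assert (HF : forall w, fst (famF t (Cconj w)) = fam_c1 t * fst (w * w)%C
      - (fam_c2 t * snd w + fam_d t * snd (cexp (- (1) * w)%C)) /\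
    fst (famF t w) = fam_c1 t * fst (w * w)%C
      + (fam_c2 t * snd w + fam_d t * snd (cexp (- (1) * w)%C))).
  { intros w. unfold famF.
    replace (- (1) * Cconj w)%C with (Cconj (- (1) * w)) by
      (apply injective_projections; simpl; ring).
    rewrite cexp_conj. generalize (cexp (- (1) * w)%C). intros E.
    split; simpl; ring. }
  assert (Hcase : (fam_c2 t = 0 /\ fam_d t = 0) \/ fam_c1 t = 0)
    by (destruct (fam_regions t) as [H|[H|[H|[H|H]]]]; lra).
  destruct Hcase as [[E1 E2]|E1].
  - exists 1. split; [ring|]. intros w. split; [apply HW|].
    destruct (HF w) as [-> ->]. rewrite E1, E2. ring.
  - exists (-1). split; [ring|]. intros w. split; [apply HW|].
    destruct (HF w) as [-> ->]. rewrite E1. ring.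
Qed.

Lemma normal_form_piece D eps W F : open D -> eps * eps = 1 -> normal_form D W F ->
  exists t g, similarity g /\ piece_of D (fun p => g (surf eps W F p)) plane (fam t).
Proof.
  intros HO Heps (t & k & mu & m & c0 & c1 & phi & Hphi & Hk & Hmu & Ht & H).
  destruct (Hphi) as [[S1 S2] _].
  assert (Hcase : eps = 1 \/ eps = -1).
  { assert (E : (eps - 1) * (eps + 1) = 0) by (ring_simplify; lra).
    apply Rmult_integral in E. destruct E; [left|right]; lra. }
  assert (Hjac : forall p, D p ->
    du (fun q => fst (phi q)) p * dv (fun q => snd (phi q)) p
      - dv (fun q => fst (phi q)) p * du (fun q => snd (phi q)) p = nrm2 (cd phi p)).
  { intros p Hp. destruct (hol_dv D phi p Hphi Hp) as [-> ->]. unfold nrm2, cd; simpl. ring. }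
  assert (Hpos : forall p, D p -> 0 < nrm2 (cd phi p)).
  { intros p Hp. apply C_norm2_pos. now apply H. }
  exists t. destruct Hcase as [-> | ->].
  - destruct (similarity_complex k mu m (fst c0) c1 Hk Hmu) as [g [Hg Eg]].
    exists g. split; auto. exists phi. split; [exact S1|]. split; [exact S2|].
    intros p Hp. split; [exact I|]. split.
    + rewrite Hjac by auto. specialize (Hpos p Hp). lra.
    + unfold surf at 1, pt. rewrite Rmult_1_l, Eg. unfold fam, surf, pt.
      destruct (H p Hp) as (_ & -> & ->). pair_eq; simpl; ring.
  (* The point of the surface now has (x, y) part conj W. Conjugating [phi] conjugates the matching
     of W, and the parity [sg] of Re F enters the l-part of the similarity. *)
  - destruct (fam_conj t Ht) as (sg & Hsg & Hconj).
    destruct (similarity_complex (sg * k) (Cconj mu) (sg * Cconj m)%C (sg * fst c0) (Cconj c1))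
      as [g [Hg Eg]].
    { apply Rmult_integral_contrapositive. split; auto. intros E. rewrite E in Hsg. lra. }
    { transitivity (sg * sg * (k * k)); [|ring]. rewrite Hsg, <- Hmu. unfold nrm2; simpl. ring. }
    exists g. split; auto. exists (fun q => Cconj (phi q)).
    assert (Eopp : forall p, du (fun q => snd (Cconj (phi q))) p = - du (fun q => snd (phi q)) p /\
      dv (fun q => snd (Cconj (phi q))) p = - dv (fun q => snd (phi q)) p).
    { intros p. split; [apply (Derive_opp (fun u => snd (phi (u, snd p))))
                       |apply (Derive_opp (fun v => snd (phi (fst p, v))))]. }
    split; [exact S1|]. split; [exact (smooth_opp D _ HO S2)|].
    intros p Hp. split; [exact I|]. split.
    + destruct (Eopp p) as [-> ->]. specialize (Hjac p Hp). specialize (Hpos p Hp).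
      simpl. lra.
    + unfold surf at 1, pt.
      transitivity (g (fst (F p), fst (Cconj (W p)), snd (Cconj (W p)))).
      { f_equal. simpl. pair_eq; ring. }
      rewrite Eg. unfold fam, surf, pt. destruct (Hconj (phi p)) as [-> ->].
      destruct (H p Hp) as (_ & -> & ->). pair_eq; simpl; ring.
Qed.

(** A spacelike plane is a graph over (x, y), since a linear relation between x and y alone would
    kill their Jacobian. A null rotation and a translation flatten it to l = 0; (x, y) is then the
    reparametrization into the member t = -2, where W is the identity and F = 0. *)
Lemma planar_piece D X : simply_connected_domain D -> smooth_surface D X ->
  (forall p, D p -> spacelike_conformal_at X p) -> planar D X ->
  exists t g, similarity g /\ piece_of D (fun p => g (X p)) plane (fam t).
Proof.
  intros Hsc (Sl & Sx & Sy) Hconf (a & b & c & d & Hn & Hpl).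
  assert (HO := proj1 (proj1 Hsc)). destruct (proj1 (proj2 (proj1 Hsc))) as [q0 Hq0].
  assert (Hjac : forall p, D p ->
    du (fun q => cx (X q)) p * dv (fun q => cy (X q)) p
      - dv (fun q => cx (X q)) p * du (fun q => cy (X q)) p <> 0).
  { intros p Hp. destruct (Hconf p Hp) as (H1 & H2 & H3).
    unfold metric_uu, metric_uv, metric_vv, mink, emb, Xu, Xv, cl, cx, cy in *. simpl in *.
    apply conformal_sign; lra. }
  assert (Ha : a <> 0).
  { intros ->.
    assert (E : forall q, D q -> b * cx (X q) + c * cy (X q) = d)
      by (intros q Hq; rewrite <- (Hpl q Hq); ring).
    assert (Eu : b * du (fun q => cx (X q)) q0 + c * du (fun q => cy (X q)) q0 = 0).
    { rewrite <- (is_du_unique (fun q => b * cx (X q) + c * cy (X q)) q0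
        (b * du (fun q => cx (X q)) q0 + c * du (fun q => cy (X q)) q0)).
      - rewrite (du_ext D _ (fun _ => d) q0 HO Hq0 E). exact (Derive_const d (fst q0)).
      - apply (is_derive_plus (V:=R_NormedModule)); apply is_derive_scal;
          [exact (smooth_is_du D _ q0 Sx Hq0)|exact (smooth_is_du D _ q0 Sy Hq0)]. }
    assert (Ev : b * dv (fun q => cx (X q)) q0 + c * dv (fun q => cy (X q)) q0 = 0).
    { rewrite <- (is_dv_unique (fun q => b * cx (X q) + c * cy (X q)) q0
        (b * dv (fun q => cx (X q)) q0 + c * dv (fun q => cy (X q)) q0)).
      - rewrite (dv_ext D _ (fun _ => d) q0 HO Hq0 E). exact (Derive_const d (snd q0)).
      - apply (is_derive_plus (V:=R_NormedModule)); apply is_derive_scal;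
          [exact (smooth_is_dv D _ q0 Sx Hq0)|exact (smooth_is_dv D _ q0 Sy Hq0)]. }
    specialize (Hjac q0 Hq0).
    set (xu := du (fun q => cx (X q)) q0) in *. set (yu := du (fun q => cy (X q)) q0) in *.
    set (xv := dv (fun q => cx (X q)) q0) in *. set (yv := dv (fun q => cy (X q)) q0) in *.
    assert (Hb : b * (xu * yv - xv * yu) = 0).
    { transitivity ((b * xu + c * yu) * yv - (b * xv + c * yv) * yu); [ring|].
      rewrite Eu, Ev. ring. }
    assert (Hc : c * (xu * yv - xv * yu) = 0).
    { transitivity ((b * xv + c * yv) * xu - (b * xu + c * yu) * xv); [ring|].
      rewrite Eu, Ev. ring. }
    apply Rmult_integral in Hb. apply Rmult_integral in Hc.
    apply Hn. destruct Hb; [|lra]. destruct Hc; [|lra]. congruence. }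
  destruct (similarity_complex 1 1%C (b / a, - (c / a)) (- (d / a)) 0%C) as [g [Hg Eg]].
  { lra. } { unfold nrm2; simpl. ring. }
  exists (-2), g. split; auto. exists (fun p => (cx (X p), cy (X p))).
  split; [exact Sx|]. split; [exact Sy|]. intros p Hp. split; [exact I|].
  split; [exact (Hjac p Hp)|].
  assert (H : fam_a (-2) = 0 /\ fam_b (-2) = 1 /\ fam_e (-2) = 0 /\ fam_d (-2) = 0 /\
    fam_c2 (-2) = 0 /\ fam_c1 (-2) = 0).
  { assert (HR : Rabs (-2 + 1) = 1) by (rewrite Rabs_left; lra).
    destruct (fam_regions (-2)) as [H|[H|[H|[H|H]]]]; lra. }
  destruct H as (Ra & Rb & Re & Rd & R2 & R1).
  specialize (Hpl p Hp). destruct (X p) as [[l x] y]. unfold cl, cx, cy in *. simpl in Hpl.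
  change (g (l, x, y)) with (g (l, fst ((x, y) : C), snd ((x, y) : C))). rewrite Eg.
  unfold fam, surf, pt, famW, famF. rewrite Ra, Rb, Re, Rd, R2, R1.
  generalize (cexp (x, y)) (cexp (- (1) * (x, y))%C). intros E E'.
  pair_eq; simpl; try ring. rewrite <- Hpl. field. auto.
Qed.

Lemma plane_plane_domain : plane_domain plane.
Proof.
  split; [apply open_plane|]. split; [now exists 0%C|]. intros p q _ _.
  exists (fun t => (fst p + t * (fst q - fst p), snd p + t * (snd q - snd p))).
  split; [split|].
  - intros t. apply continuous_pair; apply (ex_derive_continuous (V:=R_NormedModule));
      auto_derive; trivial.
  - intros; exact I.
  - split; apply injective_projections; simpl; ring.
Qed.

Theorem theorem6p3 :
  exists (I : R -> Prop) (D : C -> Prop) (F : R -> C -> I3),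
    interval I /\ plane_domain D /\
    continuous_deformation I D F /\
    (forall t, I t ->
       smooth_surface D (F t) /\ isolated_singularities D (F t) /\
       zero_mean_curvature D (F t) /\ affine_minimal D (F t)) /\
    (forall (Sigma : C -> Prop) (X : C -> I3),
       simply_connected_domain Sigma -> smooth_surface Sigma X ->
       (forall p, Sigma p -> spacelike_conformal_at X p) ->
       zero_mean_curvature Sigma X -> affine_minimal Sigma X ->
       exists t g,
         I t /\ similarity g /\ piece_of Sigma (fun p => g (X p)) D (F t)).
Proof.
  exists (fun _ => True), plane, fam. split; [|split; [|split; [|split]]].
  - split; [now intros|]. exists 0, 1. repeat split; lra.
  - exact plane_plane_domain.
  - exact fam_continuous.
  - intros t _. split; [apply fam_smooth|]. split; [apply fam_isolated|].
    split; [|apply fam_affine_minimal]. intros p Hp.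
    apply (surf_zmc 1 plane); auto using open_plane, famW_hol, famF_hol. lra.
  - intros Sigma X Hsc HX Hconf Hzmc Hmin.
    assert (H : exists t g, similarity g /\ piece_of Sigma (fun p => g (X p)) plane (fam t)).
    { destruct Hmin as [Hpl|Hmin]; [now apply planar_piece|].
      destruct (surface_representation Sigma X Hsc HX Hconf Hzmc)
        as (eps & W & F & Heps & HW & HF & -> & HW0).
      apply normal_form_piece; auto; [apply Hsc|].
      apply (affine_minimal_normal_form Sigma eps W F); auto.
      intros q Hq. apply Hmin; auto. now apply conformal_immersed, Hconf. }
    destruct H as (t & g & Hg & Hp). exists t, g. auto.
Qed.
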